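(* There is an algorithm that, given a graph $G$ with $n$ nodes and $m$ edges, decides in time $O(n^3m)$ whether $G$ contains no theta, no wheel and no pyramid as an induced subgraph.
   Context: A hole is a chordless cycle of length at least 4. A pyramid consists of three chordless paths $a\dots b_1$, $a\dots b_2$, $a\dots b_3$ of length at least 1, at least two of length at least 2, pairwise node-disjoint except at $a$, such that $b_1b_2b_3$ is a triangle and there are no edges between the paths other than those of the triangle and the three edges incident to $a$. A theta consists of three internally node-disjoint chordless paths between two nodes $a,b$, each of length at least 2, with no edges between the paths other than the three edges at $a$ and the three edges at $b$. A wheel is a hole $H$ together with a node $c\notin V(H)$ having at least three neighbors in $H$. Graphs are finite and simple. *)

(* Defs.v *)
From HB Require Import structures.
From mathcomp Require Import all_boot.

Set Implicit Arguments.
Unset Strict Implicit.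
Unset Printing Implicit Defensive.

(** * Graphs *)

Record sgraph (V : finType) := SGraph {
  adj :> rel V;
  adj_sym : symmetric adj;
  adj_irr : irreflexive adj
}.

Definition edges (V : finType) (G : sgraph V) : {set {set V}} :=
  [set [set p.1; p.2] | p : V * V & G p.1 p.2].

Section Induced.
Variables (V : finType) (G : sgraph V) (S : {set V}).

Definition induced_adj : rel {x : V | x \in S} :=
  fun x y => G (val x) (val y).

Lemma induced_sym : symmetric induced_adj.
Proof. by move=> x y; apply: adj_sym. Qed.

Lemma induced_irr : irreflexive induced_adj.
Proof. by move=> x; apply: adj_irr. Qed.

Definition induced : sgraph {x : V | x \in S} := SGraph induced_sym induced_irr.
End Induced.

Definition contains_induced (P : forall W : finType, sgraph W -> Prop)
    (V : finType) (G : sgraph V) : Prop :=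
  exists S : {set V}, P _ (induced G S).

Section Configurations.
Variables (V : finType) (G : sgraph V).

(* The path is [a :: q]; its length (number of edges) is [size q]. *)
Definition chordless_path (a b : V) (q : seq V) : Prop :=
  [/\ path G a q, uniq (a :: q), last a q = b
    & {in a :: q &, forall u v, G u v ->
        (index u (a :: q)).+1 = index v (a :: q) \/
        (index v (a :: q)).+1 = index u (a :: q)}].

Definition hole (h : seq V) : Prop :=
  [/\ ucycle G h, 4 <= size h
    & {in h &, forall u v, G u v -> next h u = v \/ next h v = u}].

(* The three predicates below say that the whole graph [G] is a theta, a
   pyramid or a wheel: the last clause of each makes the configuration
   spanning. *)

(* A node of one path may be adjacent to a node of another one only if one of
   the two is an end [a] or [b]. Since [a] and [b] lie on all the paths and
   these are chordless, the only such edges are the end edges of the paths. *)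
Definition is_theta : Prop :=
  exists (a b : V) (q : 'I_3 -> seq V),
    [/\ forall i, chordless_path a b (q i) /\ 2 <= size (q i),
        forall i j x, i != j -> x \in a :: q i -> x \in a :: q j ->
          x = a \/ x = b,
        forall i j u v, i != j -> u \in a :: q i -> v \in a :: q j -> G u v ->
          [\/ u = a, u = b, v = a | v = b]
      & forall x, exists i, x \in a :: q i].

(* As for thetas, the cases [u = a] and [v = a] only allow the first edges of
   the three paths. *)
Definition is_pyramid : Prop :=
  exists (a : V) (b : 'I_3 -> V) (q : 'I_3 -> seq V),
    [/\ (forall i, chordless_path a (b i) (q i) /\ 1 <= size (q i)) /\
          2 <= #|[pred i | 2 <= size (q i)]|,
        forall i j x, i != j -> x \in a :: q i -> x \in a :: q j -> x = a,
        forall i j, i != j -> G (b i) (b j),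
        forall i j u v, i != j -> u \in a :: q i -> v \in a :: q j -> G u v ->
          [\/ u = b i /\ v = b j, u = a | v = a]
      & forall x, exists i, x \in a :: q i].

Definition is_wheel : Prop :=
  exists (h : seq V) (c : V),
    [/\ hole h, c \notin h, 3 <= count (G c) h
      & forall x, x = c \/ x \in h].
End Configurations.

(** * Random access machine *)

(* A unit-cost word RAM, presented as a while language. The memory is an array
   of natural numbers, with indirect addressing; the input is a read-only array
   of natural numbers. Every arithmetic operation, memory or input access,
   assignment and test takes one time unit. All the numbers computed, addresses
   included, must be smaller than a bound [w], the number of machine words;
   a program that exceeds it gets stuck (it has no execution). *)

Inductive expr :=
| Const of nat
| Input of expr
| Mem of expr
| Add of expr & expr
| Sub of expr & expr   (* truncated, so that [Sub y x] tests [x < y] *)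
| Mul of expr & expr.

Inductive program :=
| Skip
| Assign of expr & expr   (* [Assign a e] stores [e] at address [a] *)
| Seq of program & program
| If of expr & program & program
| While of expr & program.

Definition memory := nat -> nat.

Definition update (m : memory) (a x : nat) : memory :=
  fun b => if b == a then x else m b.

Section Semantics.
Variables (w : nat) (inp : seq nat).

Fixpoint eval (m : memory) (e : expr) : nat :=
  match e with
  | Const x => x
  | Input e1 => nth 0 inp (eval m e1)
  | Mem e1 => m (eval m e1)
  | Add e1 e2 => eval m e1 + eval m e2
  | Sub e1 e2 => eval m e1 - eval m e2
  | Mul e1 e2 => eval m e1 * eval m e2
  end.

Fixpoint fits (m : memory) (e : expr) : bool :=
  (eval m e < w) &&
  match e with
  | Const _ => true
  | Input e1 | Mem e1 => fits m e1
  | Add e1 e2 | Sub e1 e2 | Mul e1 e2 => fits m e1 && fits m e2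
  end.

Fixpoint cost (e : expr) : nat :=
  match e with
  | Const _ => 1
  | Input e1 | Mem e1 => (cost e1).+1
  | Add e1 e2 | Sub e1 e2 | Mul e1 e2 => (cost e1 + cost e2).+1
  end.

(* [exec p m m' t]: started in memory [m], the program [p] halts in memory [m']
   after exactly [t] time units. *)
Inductive exec : program -> memory -> memory -> nat -> Prop :=
| ExecSkip m : exec Skip m m 1
| ExecAssign a e m :
    fits m a -> fits m e ->
    exec (Assign a e) m (update m (eval m a) (eval m e)) (cost a + cost e).+1
| ExecSeq p1 p2 m m1 m2 t1 t2 :
    exec p1 m m1 t1 -> exec p2 m1 m2 t2 ->
    exec (Seq p1 p2) m m2 (t1 + t2)
| ExecIfTrue e p1 p2 m m1 t :
    fits m e -> eval m e != 0 -> exec p1 m m1 t ->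
    exec (If e p1 p2) m m1 (cost e + t).+1
| ExecIfFalse e p1 p2 m m1 t :
    fits m e -> eval m e = 0 -> exec p2 m m1 t ->
    exec (If e p1 p2) m m1 (cost e + t).+1
| ExecWhileTrue e p m m1 m2 t1 t2 :
    fits m e -> eval m e != 0 -> exec p m m1 t1 ->
    exec (While e p) m1 m2 t2 ->
    exec (While e p) m m2 (cost e + t1 + t2).+1
| ExecWhileFalse e p m :
    fits m e -> eval m e = 0 ->
    exec (While e p) m m (cost e).+1.
End Semantics.

(** * Graphs as inputs *)

(* [s] lists every edge of [G] exactly once, in any order and orientation. *)
Definition edge_list (V : finType) (G : sgraph V) (s : seq (V * V)) : Prop :=
  perm_eq [seq [set p.1; p.2] | p <- s] (enum (edges G)).

(* The input array is  n, m, u_1, v_1, ..., u_m, v_m. *)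
Definition graph_input (n : nat) (s : seq ('I_n * 'I_n)) : seq nat :=
  n :: size s :: flatten [seq [:: val p.1; val p.2] | p <- s].

Definition graph_property := forall V : finType, sgraph V -> Prop.

(* The program starts with an all-zero memory and answers in cell 0 (nonzero
   means yes). Words have k * log2 (n + 2) = O(log n) bits. The [+ 1] matters
   only when [T n m = 0], where no program could run within [C * T n m]. *)
Definition decidable_in_time (P : graph_property) (T : nat -> nat -> nat) :
    Prop :=
  exists (p : program) (C k : nat),
    forall (n : nat) (G : sgraph 'I_n) (s : seq ('I_n * 'I_n)),
      edge_list G s ->
      exists (m' : memory) (t : nat),
        [/\ exec ((n + 2) ^ k) (graph_input s) p (fun=> 0) m' t,
            t <= C * (T n #|edges G| + 1)
          & m' 0 <> 0 <-> P _ G].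

(* Main.v *)
(* Say that a neighbour of a node a is attached to a component K of G - N[a] if
   it has a neighbour in K. In a graph without theta, wheel and pyramid:
   (1) no three pairwise nonadjacent nodes are attached to the same K;
   (2) no two nonadjacent nodes attached to K are connected in G - K - a;
   (3) if two nonadjacent nodes are attached to K, then K contains a node x that
       is not adjacent to two adjacent attached nodes and such that x, together
       with one of the at most two cliques formed by the neighbours of x attached
       to the component of a in G - N[x], separates any two nonadjacent nodes
       attached to K inside the union of K and its attached nodes.
   Conversely, the three neighbours of an end of a theta, or of the apex a of a
   pyramid, violate (1), and a wheel with centre a that respects (1) and (2) has two disjoint sectors through the
   same K whose ends are paired by edges; the cut of (3) would have to meet both
   sectors, which its clique structure forbids.
   The components are those of O(n^2) subgraphs, each computed by n rounds of
   propagation of the least label along the m edges; every other condition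
   ranges over one edge and at most three nodes, or is tabulated beforehand. *)

Require Import Defs.
From HB Require Import structures.
From mathcomp Require Import all_boot zify.

Set Implicit Arguments.
Unset Strict Implicit.
Unset Printing Implicit Defensive.

(** Conditions (1) and (2) force the nodes attached to K into at most two cliques with no edge
    between them. Condition (3) is proved by contradiction. Let A and B be the two cliques and
    suppose that no node of K gives a cut. If A is a single node s, the cut at a neighbour of s in K
    that contains s cannot fail. Otherwise two nodes of A close into a hole H inside the union of K
    and A, and a path Z leads from a node x of H in K to B. Take Z as short as possible. Its first
    node is adjacent to a neighbour h of x on H, and the cut at x through the clique of h fails; the
    path avoiding this cut, glued to Z, produces a forbidden configuration or another hole with a
    shorter Z. The running time rests on one remark: a node attached to a component of G - N[a] is a
    neighbour of a, so the centre and one attached node are the two ends of a single edge, and a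
    condition on five nodes costs three node loops and one edge loop. *)

Lemma split_first (T : Type) (a : pred T) (s : seq T) :
  has a s -> exists s1 w s2, [/\ s = s1 ++ w :: s2, a w & ~~ has a s1].
Proof.
elim: s => //= x s IH; case: (boolP (a x)) => [ax _|nax /= /IH].
  by exists [::], x, s.
by case=> s1 [w [s2 [-> aw h1]]]; exists (x :: s1), w, s2; rewrite /= (negbTE nax).
Qed.

Lemma split_last (T : Type) (a : pred T) (s : seq T) :
  has a s -> exists s1 w s2, [/\ s = s1 ++ w :: s2, a w & ~~ has a s2].
Proof.
rewrite -has_rev => /split_first [s1 [w [s2 [es aw h1]]]].
exists (rev s2), w, (rev s1); rewrite has_rev; split=> //.
by rewrite -[s]revK es rev_cat rev_cons cat_rcons.
Qed.

(** * Induced paths, connected sets and holes *)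

Section InducedPath.
Variables (T : eqType) (e : rel T).
Hypotheses (e_sym : symmetric e) (e_irr : irreflexive e).

(** Recursion on the first node suits induction and concatenation; [ipath_of_index] and
    [ipath_index] translate from and to the index formulation of [chordless_path]. *)
Fixpoint ipath (s : seq T) : bool :=
  if s is x :: s' then
    if s' is y :: s'' then
      [&& e x y, x \notin s', all (fun z => ~~ e x z) s'' & ipath s']
    else true
  else true.

Lemma ipath_consE x y s :
  ipath [:: x, y & s] =
  [&& e x y, x \notin y :: s, all (fun z => ~~ e x z) s & ipath (y :: s)].
Proof. by []. Qed.

Lemma ipath_behead s : ipath s -> ipath (behead s).
Proof. by case: s => [|x [|y s]] // /and4P[]. Qed.

Lemma ipath_catr s1 s2 : ipath (s1 ++ s2) -> ipath s2.
Proof. by elim: s1 => // x s1 IH h; apply: IH; exact: (ipath_behead h). Qed.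

Lemma ipath_catl s1 s2 : ipath (s1 ++ s2) -> ipath s1.
Proof.
elim: s1 => // x [|y s1] IH // /and4P[exy nx na h].
have {nx}: x \notin (y :: s1) ++ s2 by [].
have {na}: all (fun z => ~~ e x z) (s1 ++ s2) by [].
rewrite all_cat mem_cat negb_or => /andP[na _] /andP[nx _].
by rewrite ipath_consE exy nx na IH.
Qed.

Lemma ipath_uniq s : ipath s -> uniq s.
Proof. by elim: s => // x [|y s] IH // /and4P[_ nx _ h]; rewrite cons_uniq nx IH. Qed.

Lemma ipath_path x s : ipath (x :: s) -> path e x s.
Proof. by elim: s x => // y s IH x /and4P[exy _ _ h]; rewrite /= exy IH. Qed.

Lemma ipath_far s1 w s2 x y :
  ipath (s1 ++ w :: s2) -> x \in s1 -> y \in s2 -> ~~ e x y.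
Proof.
elim: s1 => // z s1 IH h; rewrite inE => /orP[/eqP->|xs1] ys2; last first.
  exact: IH (ipath_behead h) xs1 ys2.
case: s1 h {IH} => [|z' s1] /and4P[_ _ /allP na _]; apply: na => //.
by rewrite mem_cat inE ys2 !orbT.
Qed.

Lemma ipath_next s1 x y s2 : ipath (s1 ++ x :: y :: s2) -> e x y.
Proof. by move/ipath_catr => /and4P[]. Qed.

Lemma ipath_join x s1 y s2 : ipath (x :: s1) -> ipath (y :: s2) ->
  e (last x s1) y ->
  {in x :: s1 & y :: s2, forall a b, a != b} ->
  {in x :: s1 & y :: s2, forall a b, e a b -> a = last x s1 /\ b = y} ->
  ipath (x :: s1 ++ y :: s2).
Proof.
move=> p1 p2 exy; elim: s1 x p1 exy => [|z s1 IH] x p1 exy dis adj.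
  rewrite cat0s ipath_consE exy p2 andbT /=.
  apply/andP; split.
    by apply/negP => /(dis x x (mem_head _ _)); rewrite eqxx.
  apply/allP=> w ws; apply/negP=> exw.
  have [_ ewy] := adj x w (mem_head _ _) (mem_behead (s := y :: s2) ws) exw.
  by move: (ipath_uniq p2); rewrite /= -ewy ws.
have {p1} /and4P[exz nx na p1] := p1.
have {}IH : ipath (z :: s1 ++ y :: s2).
  apply: IH => // a b aH; [apply: dis|apply: adj]; by rewrite inE aH orbT.
rewrite cat_cons ipath_consE exz IH -cat_cons mem_cat negb_or nx /= all_cat andbT.
rewrite na /=; apply/andP; split.
- by apply/negP => /(dis x x (mem_head _ _)); rewrite eqxx.
change (all (fun z => ~~ e x z) (y :: s2)); apply/allP=> w ws; apply/negP=> exw.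
have [exl _] := adj x w (mem_head _ _) ws exw.
by move/negP: nx; apply; rewrite [X in X \in _]exl; exact: (mem_last z s1).
Qed.

Lemma ipath_rcons x s y : ipath (x :: s) -> e (last x s) y -> y \notin x :: s ->
  {in x :: s, forall a, e a y -> a = last x s} -> ipath (x :: rcons s y).
Proof.
move=> p exy ny adj; rewrite -cats1; apply: ipath_join => //.
  by move=> a b aH; rewrite inE => /eqP->; apply: contraNneq ny => <-.
by move=> a b aH; rewrite inE => /eqP-> /(adj _ aH).
Qed.

Lemma ipath_rev s : ipath s -> ipath (rev s).
Proof.
elim: s => // x [|y s] IH // /and4P[exy nx /allP na h].
rewrite rev_cons; have := IH h; have lr : last x (rev (y :: s)) = y.
  by rewrite rev_cons last_rcons.
have mr : rev (y :: s) =i y :: s by move=> z; rewrite mem_rev.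
move: lr mr; case: (rev (y :: s)) => [|z t] lr mr pt.
  by move: (mr y); rewrite inE eqxx.
rewrite /= in lr; rewrite rcons_cons; apply: ipath_rcons => //.
- by rewrite lr e_sym.
- by rewrite mr.
- move=> a; rewrite mr inE => /orP[/eqP->|/na]; first by rewrite lr.
  by rewrite e_sym => /negbTE->.
Qed.

(* Jump from [x] to the last node of the path that it sees, and recurse. *)
Lemma ipath_of_path x p : path e x p ->
  exists q, [/\ ipath (x :: q), last x q = last x p & {subset q <= p}].
Proof.
elim: p x => [|z p IH] x /=; first by exists [::].
case/andP=> exz /IH [q [pq lq sq]].
have /split_last [s1 [w [s2 [es /orP aw nh]]]] :
    has (fun u => (u == x) || e x u) (z :: q) by rewrite /= exz orbT.
have sub u : u \in w :: s2 -> u \in z :: p.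
  move=> us; have : u \in z :: q by rewrite es mem_cat us orbT.
  by rewrite !inE => /orP[->|/sq ->] //; rewrite orbT.
have lw : last w s2 = last z p by have := congr1 (last x) es; rewrite last_cat /= lq.
have pw : ipath (w :: s2) by apply: (@ipath_catr s1); rewrite -es.
case: aw => [/eqP ewx|exw].
  exists s2; rewrite -ewx; split=> // u us.
  by apply: sub; rewrite inE us orbT.
case: (eqVneq w x) => [ewx|nwx]; first by rewrite ewx e_irr in exw.
exists (w :: s2); split => //.
rewrite exw pw inE negb_or eq_sym nwx /= andbT.
apply/andP; split.
  by apply: contra nh => xs; apply/hasP; exists x => //; rewrite eqxx.
by rewrite all_predC; apply: contra nh; apply: sub_has => u ->; rewrite orbT.
Qed.

Lemma ipath_adj s u v : ipath s -> u \in s -> v \in s -> e u v ->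
  (exists s1 s2, s = s1 ++ u :: v :: s2) \/ (exists s1 s2, s = s1 ++ v :: u :: s2).
Proof.
move=> ps us; case/splitPr: us ps => s1 s2 ps.
rewrite mem_cat inE => /or3P[vs1|/eqP->|vs2] euv; last 2 first.
- by rewrite e_irr in euv.
- left; case: s2 ps vs2 => // w s2 ps; rewrite inE => /orP[/eqP<-|vs2]; first by exists s1, s2.
  by move: (@ipath_far (rcons s1 u) w s2 u v); rewrite cat_rcons euv mem_rcons mem_head => /(_ ps isT vs2).
- right; case/lastP: s1 ps vs1 => // s1 w ps; rewrite mem_rcons inE => /orP[/eqP->|vs1].
    by exists s1, s2; rewrite cat_rcons.
  by move: (@ipath_far s1 w (u :: s2) v u); rewrite -cat_rcons e_sym euv mem_head => /(_ ps vs1 isT).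
Qed.

Lemma ipath_of_index s : uniq s -> sorted e s ->
  {in s &, forall u v, e u v ->
    (index u s).+1 = index v s \/ (index v s).+1 = index u s} -> ipath s.
Proof.
elim: s => // x [|y s] IH // /andP[nx us] /andP[exy ps] adj.
rewrite ipath_consE exy nx /=; apply/andP; split.
  apply/allP=> z zs; apply/negP=> exz.
  have zxs : z \in [:: x, y & s] by rewrite !inE zs !orbT.
  have := adj x z (mem_head _ _) zxs exz; rewrite /= eqxx.
  have -> : (x == z) = false by apply: contraNF nx => /eqP->; rewrite inE zs orbT.
  have -> : (y == z) = false by case/andP: us => ny _; apply: contraNF ny => /eqP->.
  by case.
apply: IH => // u v uH vH euv.
have := adj u v (mem_behead (s := x :: y :: s) uH) (mem_behead (s := x :: y :: s) vH) euv.
have neq w : w \in y :: s -> (x == w) = false by move=> wH; apply: contraNF nx => /eqP->.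
by rewrite ![index _ (x :: _)]/= !neq // => -[[]|[]]; [left|right].
Qed.

Lemma ipath_index s : ipath s ->
  {in s &, forall u v, e u v ->
    (index u s).+1 = index v s \/ (index v s).+1 = index u s}.
Proof.
move=> ps u v us vs euv.
have aux a b s1 s2 : s = s1 ++ a :: b :: s2 -> (index a s).+1 = index b s.
  move=> es; have := ipath_uniq ps; rewrite es cat_uniq => /and3P[_ nh na].
  move: nh na; rewrite [has _ _]/= !cons_uniq inE !negb_or => /and3P[n1 n2 _] /andP[/andP[nab _] _].
  by rewrite !index_cat (negbTE n1) (negbTE n2) /= (negbTE nab) !eqxx addn0 addn1.
by have [[s1 [s2 /aux]]|[s1 [s2 /aux]]] := ipath_adj ps us vs euv; [left|right].
Qed.

End InducedPath.
Arguments ipath {T} e s : simpl never.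

Section ConnectedSets.
Variables (V : finType) (G : sgraph V).
Implicit Types (C D : {set V}) (u v x y : V).

Definition rst (D : {set V}) : rel V := fun u v => [&& u \in D, v \in D & G u v].
Definition conn (C : {set V}) := {in C &, forall u v, connect (rst C) u v}.
Definition sees (C : {set V}) (x : V) := [exists u in C, G x u].
Definition anti (C D : {set V}) := {in C & D, forall u v, ~~ G u v /\ u != v}.

Lemma rst_sym D : symmetric (rst D).
Proof. by move=> u v; rewrite /rst adj_sym andbCA. Qed.

Lemma connect_rst_sym D : connect_sym (rst D).
Proof. by apply: sym_connect_sym; apply: rst_sym. Qed.

Lemma connect_rstS C D u v : C \subset D -> connect (rst C) u v -> connect (rst D) u v.
Proof.
move=> /subsetP sCD; apply: connect_sub => a b /and3P[aC bC ab].
by apply: connect1; rewrite /rst ab !sCD.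
Qed.

Lemma seesP C x : reflect (exists2 u, u \in C & G x u) (sees C x).
Proof. by apply: (iffP exists_inP) => -[u uC xu]; exists u. Qed.

Lemma seesI C x u : u \in C -> G x u -> sees C x.
Proof. by move=> uC xu; apply/seesP; exists u. Qed.

Lemma seesS C D x : C \subset D -> sees C x -> sees D x.
Proof. by move=> /subsetP s /seesP[u uC xu]; apply: (seesI (s _ uC)). Qed.

Lemma antiC C D : anti C D -> anti D C.
Proof. by move=> a u v uD vC; have [n1 n2] := a v u vC uD; rewrite adj_sym eq_sym. Qed.

Lemma conn1 x : conn [set x].
Proof. by move=> u v; rewrite !inE => /eqP-> /eqP->. Qed.

Lemma connU C D u v : conn C -> conn D -> u \in C -> v \in D -> (u == v) || G u v ->
  conn (C :|: D).
Proof.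
move=> cC cD uC vD uv.
have cuv : connect (rst (C :|: D)) u v.
  case/orP: uv => [/eqP->//|guv]; apply: connect1.
  by rewrite /rst !inE uC vD guv orbT.
have inC a b : a \in C -> b \in C -> connect (rst (C :|: D)) a b.
  by move=> aC bC; apply: connect_rstS (cC a b aC bC); apply: subsetUl.
have inD a b : a \in D -> b \in D -> connect (rst (C :|: D)) a b.
  by move=> aD bD; apply: connect_rstS (cD a b aD bD); apply: subsetUr.
have tou a : a \in C :|: D -> connect (rst (C :|: D)) a u.
  rewrite inE => /orP[aC|aD]; first exact: inC.
  by apply: connect_trans (inD a v aD vD) _; rewrite connect_rst_sym.
move=> a b /tou ca /tou; rewrite connect_rst_sym; exact: connect_trans.
Qed.

Lemma conn_path x s : path G x s -> conn [set y in x :: s].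
Proof.
elim: s x => [|y s IH] x; first by rewrite set_cons set_nil setU0 => _; apply: conn1.
case/andP=> xy /IH c; rewrite set_cons.
by apply: (connU (u := x) (v := y)); rewrite ?inE ?eqxx ?xy ?orbT //; apply: conn1.
Qed.

Lemma conn_ipath s : ipath G s -> conn [set y in s].
Proof.
by case: s => [|x s /ipath_path/conn_path //] _ u v; rewrite inE.
Qed.

Lemma connect_conn D x : conn [set y | connect (rst D) x y].
Proof.
have to_x y : connect (rst D) x y -> connect (rst [set y | connect (rst D) x y]) x y.
  case/connectP=> p; elim/last_ind: p y => [|p z IH] y; first by move=> _ ->.
  rewrite rcons_path last_rcons => /andP[pp lz] ->.
  have cl : connect (rst D) x (last x p) by apply/connectP; exists p.
  apply: connect_trans (IH _ pp erefl) _; apply: connect1.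
  rewrite /rst !inE cl (connect_trans cl (connect1 lz)) /=.
  by case/and3P: lz.
move=> u v; rewrite !inE => /to_x cu /to_x; apply: connect_trans.
by rewrite connect_rst_sym.
Qed.

Lemma rst_path D x p : path (rst D) x p -> path G x p /\ {subset p <= D}.
Proof.
elim: p x => //= y p IH x /andP[/and3P[_ yD xy] /IH[pp sp]].
by rewrite xy; split=> // z; rewrite inE => /orP[/eqP->|/sp].
Qed.

(** Take an induced path inside [C] from a neighbour of [x] to a neighbour of [y], drop what
    precedes the last neighbour of [x], then what follows the first neighbour of [y]. *)
Lemma link C x y : conn C -> sees C x -> sees C y -> exists u t,
  [/\ ipath G (u :: t), {subset u :: t <= C},
      G x u /\ {in u :: t, forall v, G x v -> v = u}
    & G y (last u t) /\ {in u :: t, forall v, G y v -> v = last u t}].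
Proof.
move=> cC /seesP[u0 u0C xu0] /seesP[v0 v0C yv0].
have /connectP[p pp lp] := cC _ _ u0C v0C.
have [pG sp] := rst_path pp.
have [q [iq lq sq]] := ipath_of_path (adj_irr G) pG.
have sC : {subset u0 :: q <= C}.
  by move=> z; rewrite inE => /orP[/eqP->//|/sq/sp].
have /split_last [s1 [u [s2 [es xu nh]]]] : has (G x) (u0 :: q) by rewrite /= xu0.
have is2 : ipath G (u :: s2) by apply: (@ipath_catr _ _ s1); rewrite -es.
have ls2 : last u s2 = v0 by rewrite lp -lq; have := congr1 (last u) es; rewrite last_cat.
have /split_first [t1 [w [t2 [et yw nt]]]] : has (G y) (u :: s2).
  by apply/hasP; exists v0 => //; rewrite -ls2 mem_last.
have sub : {subset t1 ++ [:: w] <= u :: s2}.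
  by move=> z; rewrite et !mem_cat inE => /orP[->//|/eqP->]; rewrite inE eqxx orbT.
have ip : ipath G (t1 ++ [:: w]) by apply: (@ipath_catl _ _ _ t2); rewrite -catA /= -et.
have hu : head u (t1 ++ [:: w]) = u by case: (t1) et => [|z t1'] [<-].
have xonly : {in u :: s2, forall v, G x v -> v = u}.
  move=> v; rewrite inE => /orP[/eqP->//|vs] xv.
  by case/negP: nh; apply/hasP; exists v.
have yonly : {in t1 ++ [:: w], forall v, G y v -> v = w}.
  move=> v; rewrite mem_cat inE => /orP[vs|/eqP->//] yv.
  by case/negP: nt; apply/hasP; exists v.
have sCu : {subset u :: s2 <= C}.
  by move=> z zs; apply: sC; rewrite es mem_cat zs orbT.
case: t1 => [|z t1] in et nt sub ip hu yonly *.
  rewrite /= in hu; subst w; exists u, [::]; split=> //.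
  - by move=> z zs; apply: sCu; apply: sub.
  - by split=> // v vs; apply: xonly; apply: sub.
rewrite /= in hu; subst z.
exists u, (t1 ++ [:: w]); split=> //.
- by move=> v vs; apply: sCu; apply: sub.
- by split=> // v vs; apply: xonly; apply: sub.
- by rewrite last_cat /=; split.
Qed.

End ConnectedSets.

Section Holes.
Variables (V : finType) (G : sgraph V).

Lemma next_mid (s1 s2 : seq V) u v : uniq (s1 ++ u :: v :: s2) ->
  next (s1 ++ u :: v :: s2) u = v.
Proof.
move=> un; rewrite -(next_rot (size s1) un) rot_size_cat /=.
by rewrite eqxx.
Qed.

Lemma hole_rot n h : hole G h -> hole G (rot n h).
Proof.
case=> uc sz adj; split; first by rewrite rot_ucycle.
  by rewrite size_rot.
move=> u v; rewrite !mem_rot => uh vh uv.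
by rewrite !next_rot ?(ucycle_uniq uc) //; apply: adj.
Qed.

Lemma hole_rev h : hole G h -> hole G (rev h).
Proof.
case=> /andP[cy un] sz adj; split.
- rewrite /ucycle rev_uniq un andbT rev_cycle.
  by rewrite (@eq_cycle _ _ G) // => x y; rewrite /= adj_sym.
- by rewrite size_rev.
- move=> u v; rewrite !mem_rev => uh vh uv; rewrite !next_rev //.
  by case: (adj u v uh vh uv) => <-; [right|left]; rewrite prev_next.
Qed.

Lemma next_index (x : V) s u : u \in x :: s ->
  next (x :: s) u = nth x s (index u (x :: s)).
Proof. by move=> us; rewrite next_nth us. Qed.

(** Away from [x] the cyclic successor is the list successor, so a hole opened at [x] is an induced
    path whose two ends are the only neighbours of [x]. *)
Lemma hole_consP x s : hole G (x :: s) ->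
  [/\ ipath G s, 3 <= size s, G x (head x s), G x (last x s)
    & {in s, forall v, G x v -> v = head x s \/ v = last x s}].
Proof.
case=> /andP[cy un] sz adj.
have sz3 : 2 < size s by [].
have nx : {in s, forall u, (x == u) = false}.
  by move=> u us; apply: contraTF un => /eqP->; rewrite /= us.
have key u v : u \in s -> v \in s -> next (x :: s) u = v -> (index u s).+1 = index v s.
  move=> us vs; rewrite next_index ?inE ?us ?orbT //= nx // => nv.
  have [lt|ge] := ltnP (index u s).+1 (size s).
    by rewrite -nv index_uniq //; case/andP: un.
  by move: nv; rewrite nth_default // => xv; move: (nx _ vs); rewrite xv eqxx.
case: s cy un sz adj sz3 nx key => // y s.
rewrite [cycle _ _]/= rcons_path => /and3P[xy ps lx] un sz adj sz3 nx key; split=> //.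
- apply: ipath_of_index => //; first by case/andP: un.
  move=> u v us vs uv.
  have := adj u v (mem_behead (s := x :: y :: s) us) (mem_behead (s := x :: y :: s) vs) uv.
  by case=> /key h; [left|right]; apply: h.
- by rewrite adj_sym.
move=> v vs xv.
have vxs : v \in x :: y :: s by rewrite inE vs orbT.
have := adj x v (mem_head _ _) vxs xv.
rewrite !next_index ?mem_head // [index x _]/= eqxx => -[/= <-|]; first by left.
rewrite [index v _]/= nx // => nthx; right.
have : index v (y :: s) < size (y :: s) by rewrite index_mem.
rewrite leq_eqVlt => /orP[/eqP iv|lt]; last first.
  by have := nx (nth x (y :: s) (index v (y :: s)).+1) (mem_nth _ lt); rewrite nthx eqxx.
have vv := nth_index x vs; rewrite -vv.
have -> : index v (y :: s) = size s by case: iv.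
exact: (nth_last x (y :: s)).
Qed.

Lemma hole_uniq h : hole G h -> uniq h.
Proof. by case=> /andP[]. Qed.

Lemma hole_at x h : hole G h -> x \in h ->
  exists s, [/\ hole G (x :: s), x :: s =i h & perm_eq (x :: s) h].
Proof.
move=> hh xh; have [i s e] := rot_to xh.
exists s; rewrite -e; split; [exact: hole_rot|exact: mem_rot|].
by rewrite perm_rot.
Qed.

Lemma mk_hole p s u t : ipath G (p :: s) -> ipath G (u :: t) ->
  G (last p s) u -> G (last u t) p ->
  {in p :: s & u :: t, forall a b, a != b} ->
  {in p :: s & u :: t, forall a b, G a b ->
     (a = last p s /\ b = u) \/ (a = p /\ b = last u t)} ->
  4 <= size ((p :: s) ++ (u :: t)) ->
  hole G ((p :: s) ++ (u :: t)).
Proof.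
move=> ps pt qu wp dis adj sz.
have un : uniq ((p :: s) ++ (u :: t)).
  rewrite cat_uniq (ipath_uniq ps) (ipath_uniq pt) andbT /=.
  apply/negP; rewrite -/(has (mem (p :: s)) (u :: t)).
  by case/hasP => z zt zs; have := dis z z zs zt; rewrite eqxx.
split=> //.
  rewrite /ucycle un andbT cat_cons /= rcons_path cat_path /= qu last_cat /= wp andbT.
  by rewrite (ipath_path ps) (ipath_path pt).
have nxt a b s1 s2 : (p :: s) ++ (u :: t) = s1 ++ a :: b :: s2 ->
    next ((p :: s) ++ (u :: t)) a = b.
  by move=> e; rewrite e next_mid // -e.
have nxt' a b s1 s2 : (u :: t) ++ (p :: s) = s1 ++ a :: b :: s2 ->
    next ((p :: s) ++ (u :: t)) a = b.
  move=> e; rewrite -(next_rot (size (p :: s)) un) rot_size_cat e next_mid // -e.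
  by rewrite uniq_catC.
have [sym irr] := (adj_sym G, adj_irr G).
have cross a b : a \in p :: s -> b \in u :: t -> G a b ->
   next ((p :: s) ++ (u :: t)) a = b \/ next ((p :: s) ++ (u :: t)) b = a.
  move=> aS bT /(adj _ _ aS bT)[[-> ->]|[-> ->]].
    by left; apply: (nxt _ _ (belast p s) t); rewrite [X in X ++ _]lastI cat_rcons.
  by right; apply: (nxt' _ _ (belast u t) s); rewrite [X in X ++ _]lastI cat_rcons.
move=> a b; rewrite !mem_cat => /orP[aS|aT] /orP[bS|bT] ab.
- have [[s1 [s2 es]]|[s1 [s2 es]]] := ipath_adj sym irr ps aS bS ab; [left|right];
  by apply: (nxt _ _ s1 (s2 ++ u :: t)); rewrite es -catA.
- exact: cross.
- by rewrite sym in ab; case: (cross b a bS aT ab); [right|left].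
- have [[s1 [s2 es]]|[s1 [s2 es]]] := ipath_adj sym irr pt aT bT ab; [left|right];
  by apply: (nxt' _ _ s1 (s2 ++ p :: s)); rewrite es -catA.
Qed.

End Holes.

(** * Configurations inside a graph *)

Section Embedding.
Variables (V : finType) (G : sgraph V).

(** These three predicates drop the spanning clause; the node set of the induced subgraph is
    recovered as the union of the paths, or of the rim and the hub. *)
Definition theta_in : Prop :=
  exists (a b : V) (q : 'I_3 -> seq V),
    [/\ forall i, chordless_path G a b (q i) /\ 2 <= size (q i),
        forall i j x, i != j -> x \in a :: q i -> x \in a :: q j ->
          x = a \/ x = b
      & forall i j u v, i != j -> u \in a :: q i -> v \in a :: q j -> G u v ->
          [\/ u = a, u = b, v = a | v = b]].

Definition pyramid_in : Prop :=
  exists (a : V) (b : 'I_3 -> V) (q : 'I_3 -> seq V),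
    [/\ (forall i, chordless_path G a (b i) (q i) /\ 1 <= size (q i)) /\
          2 <= #|[pred i | 2 <= size (q i)]|,
        forall i j x, i != j -> x \in a :: q i -> x \in a :: q j -> x = a,
        forall i j, i != j -> G (b i) (b j)
      & forall i j u v, i != j -> u \in a :: q i -> v \in a :: q j -> G u v ->
          [\/ u = b i /\ v = b j, u = a | v = a]].

Definition wheel_in : Prop :=
  exists (h : seq V) (c : V), [/\ hole G h, c \notin h & 3 <= count (G c) h].

Section Sub.
Variable S : {set V}.
Local Notation W := {x : V | x \in S}.
Local Notation GS := (induced G S).

Lemma lift_seq (s : seq V) : {subset s <= S} -> exists s' : seq W, map val s' = s.
Proof.
elim: s => [|x s IH] sub; first by exists [::].
have [s' <-] : exists s' : seq W, map val s' = s.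
  by apply: IH => y ys; apply: sub; rewrite inE ys orbT.
have xS : x \in S by apply: sub; rewrite mem_head.
by exists (exist _ x xS :: s').
Qed.

Lemma chordless_val (a b : W) (q : seq W) :
  chordless_path GS a b q <-> chordless_path G (val a) (val b) (map val q).
Proof.
rewrite /chordless_path last_map path_map -map_cons (map_inj_uniq val_inj).
split=> -[p u l adj]; split=> //.
- by rewrite l.
- move=> x y /mapP[x' xs ->] /mapP[y' ys ->] xy.
  by rewrite !(index_map val_inj); apply: adj.
- exact: val_inj.
- move=> x y xs ys xy; have := adj (val x) (val y) (map_f _ xs) (map_f _ ys) xy.
  by rewrite !(index_map val_inj).
Qed.

Lemma hole_val (h : seq W) : hole GS h <-> hole G (map val h).
Proof.
rewrite /hole /ucycle size_map (map_inj_uniq val_inj).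
have -> : cycle G (map val h) = cycle GS h.
  by case: h => //= x h; rewrite -map_rcons path_map.
split=> -[/andP[p u] sz adj]; split; rewrite ?p //.
- move=> x y /mapP[x' xs ->] /mapP[y' ys ->] xy.
  rewrite !(next_map val_inj) //.
  by case: (adj x' y' xs ys xy) => ->; [left|right].
- move=> x y xs ys xy; have := adj (val x) (val y) (map_f _ xs) (map_f _ ys) xy.
  by rewrite !(next_map val_inj) // => -[]/val_inj; [left|right].
Qed.
End Sub.

Lemma contains_theta : contains_induced is_theta G <-> theta_in.
Proof.
split=> [[S [a [b [q [cp d1 d2 _]]]]]|[a [b [q [cp d1 d2]]]]].
  exists (val a), (val b), (fun i => map val (q i)); split.
  - by move=> i; rewrite size_map -chordless_val.
  - move=> i j x ij; rewrite -!map_cons => /mapP[x' xi ->] /mapP[x'' xj /val_inj ex].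
    by rewrite -ex in xj; case: (d1 i j x' ij xi xj) => ->; [left|right].
  - move=> i j u v ij; rewrite -!map_cons => /mapP[u' ui ->] /mapP[v' vj ->] uv.
    by case: (d2 i j u' v' ij ui vj uv) => ->; [constructor 1|constructor 2|constructor 3|constructor 4].
pose S := [set x | [exists i, x \in a :: q i]]; exists S.
have aS : a \in S by rewrite inE; apply/existsP; exists ord0; rewrite mem_head.
have /fin_all_exists[q' eq'] i : exists s' : seq {x | x \in S}, map val s' = q i.
  by apply: lift_seq => x xq; rewrite inE; apply/existsP; exists i; rewrite inE xq orbT.
have bq i : b \in a :: q i by have [[_ _ <- _] _] := cp i; apply: mem_last.
have bS : b \in S by rewrite inE; apply/existsP; exists ord0.
pose a' : {x | x \in S} := exist _ a aS; pose b' : {x | x \in S} := exist _ b bS.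
have memq i x : (x \in a' :: q' i) = (val x \in a :: q i).
  by rewrite -eq' -[a in RHS]/(val a') -map_cons (mem_map val_inj).
exists a', b', q'; split.
- by move=> i; rewrite -(size_map val) eq' chordless_val eq'.
- move=> i j x ij; rewrite !memq => xi xj.
  by case: (d1 i j _ ij xi xj) => e; [left|right]; apply: val_inj.
- move=> i j u v ij; rewrite !memq => ui vj uv.
  by case: (d2 i j _ _ ij ui vj uv) => e;
    [constructor 1|constructor 2|constructor 3|constructor 4]; apply: val_inj.
- by move=> x; have := valP x; rewrite inE => /existsP[i xi]; exists i; rewrite memq.
Qed.

Lemma contains_pyramid : contains_induced is_pyramid G <-> pyramid_in.
Proof.
split=> [[S [a [b [q [[cp c2] d1 tr d2 _]]]]]|[a [b [q [[cp c2] d1 tr d2]]]]].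
  exists (val a), (val \o b), (fun i => map val (q i)); split.
  - split; first by move=> i; rewrite size_map -chordless_val.
    rewrite (eq_card (B := [pred i | 2 <= size (q i)])) // => i.
    by rewrite !inE size_map.
  - move=> i j x ij; rewrite -!map_cons => /mapP[x' xi ->] /mapP[x'' xj /val_inj ex].
    by rewrite -ex in xj; rewrite (d1 i j x' ij xi xj).
  - by move=> i j ij; apply: tr.
  - move=> i j u v ij; rewrite -!map_cons => /mapP[u' ui ->] /mapP[v' vj ->] uv.
    by case: (d2 i j u' v' ij ui vj uv) => [[-> ->]|->|->];
      [constructor 1|constructor 2|constructor 3].
pose S := [set x | [exists i, x \in a :: q i]]; exists S.
have aS : a \in S by rewrite inE; apply/existsP; exists ord0; rewrite mem_head.
have /fin_all_exists[q' eq'] i : exists s' : seq {x | x \in S}, map val s' = q i.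
  by apply: lift_seq => x xq; rewrite inE; apply/existsP; exists i; rewrite inE xq orbT.
have bS i : b i \in S.
  by rewrite inE; apply/existsP; exists i; have [[_ _ <- _] _] := cp i; apply: mem_last.
pose a' : {x | x \in S} := exist _ a aS; pose b' i : {x | x \in S} := exist _ (b i) (bS i).
have memq i x : (x \in a' :: q' i) = (val x \in a :: q i).
  by rewrite -eq' -[a in RHS]/(val a') -map_cons (mem_map val_inj).
exists a', b', q'; split.
- split; first by move=> i; rewrite -(size_map val) eq' chordless_val eq'; apply: cp.
  rewrite (eq_card (B := [pred i | 2 <= size (q i)])) // => i.
  by rewrite !inE -(size_map val) eq'.
- move=> i j x ij; rewrite !memq => xi xj.
  by apply: val_inj; rewrite (d1 i j _ ij xi xj).
- by move=> i j ij; apply: tr.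
- move=> i j u v ij; rewrite !memq => ui vj uv.
  case: (d2 i j _ _ ij ui vj uv) => [[e1 e2]|e|e].
  - by constructor 1; split; apply: val_inj.
  - by constructor 2; apply: val_inj.
  - by constructor 3; apply: val_inj.
- by move=> x; have := valP x; rewrite inE => /existsP[i xi]; exists i; rewrite memq.
Qed.

Lemma contains_wheel : contains_induced is_wheel G <-> wheel_in.
Proof.
split=> [[S [h [c [hh ch cnt _]]]]|[h [c [hh ch cnt]]]].
  exists (map val h), (val c); split; first exact/hole_val.
    by rewrite (mem_map val_inj).
  by rewrite count_map.
pose S := [set x in c :: h]; exists S.
have cS : c \in S by rewrite inE mem_head.
have [h' eh] : exists s' : seq {x | x \in S}, map val s' = h.
  by apply: lift_seq => x xq; rewrite !inE xq orbT.
pose c' : {x | x \in S} := exist _ c cS.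
exists h', c'; split.
- by apply/hole_val; rewrite eh.
- by rewrite -(mem_map val_inj) eh.
- by rewrite -eh count_map in cnt.
- move=> x; have := valP x; rewrite !inE => /orP[/eqP e|xh]; first by left; apply: val_inj.
  by right; rewrite -(mem_map val_inj) eh.
Qed.

End Embedding.

(** * Thetas, pyramids and holes built from connected sets *)

Section Builders.
Variables (V : finType) (G : sgraph V).
Implicit Types (C D : {set V}) (u v x y : V).

Lemma chordless_of_ipath a q : ipath G (a :: q) -> chordless_path G a (last a q) q.
Proof.
move=> p; split=> //; [exact: ipath_path|exact: ipath_uniq p|].
exact: (ipath_index (adj_sym G) (adj_irr G)).
Qed.

Lemma ipath_of_chordless a b q : chordless_path G a b q -> ipath G (a :: q).
Proof. by case=> p un _ adj; apply: ipath_of_index. Qed.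

Lemma ipath_cons x u t : ipath G (u :: t) -> x \notin u :: t -> G x u ->
  {in u :: t, forall v, G x v -> v = u} -> ipath G (x :: u :: t).
Proof.
move=> p nx xu adj; rewrite ipath_consE xu nx p andbT /=.
apply/allP=> v vt; apply/negP=> /(adj v (mem_behead (s := u :: t) vt)) e.
by move: (ipath_uniq p); rewrite /= -e vt.
Qed.

Lemma link_chordless C x y : conn G C -> x \notin C -> y \notin C -> x != y ->
  ~~ G x y -> sees G C x -> sees G C y ->
  exists s, [/\ ipath G (x :: rcons s y), 0 < size s & {subset s <= C}].
Proof.
move=> cC nx ny nxy xy sx sy.
have [u [t [it sub [xu xo] [yl yo]]]] := link cC sx sy.
have nxt : x \notin u :: t by apply: contra nx => /sub.
have nyt : y \notin u :: t by apply: contra ny => /sub.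
exists (u :: t); split=> //; apply: ipath_rcons.
- exact: ipath_cons.
- by rewrite /= adj_sym.
- by rewrite inE eq_sym negb_or nxy.
- move=> a; rewrite inE => /orP[/eqP->|at_ ay]; first by rewrite (negbTE xy).
  by rewrite /=; apply: yo => //; rewrite adj_sym.
Qed.

Lemma link_to C a b : conn G C -> sees G C a -> b \in C -> exists u t,
  [/\ ipath G (u :: t), {subset u :: t <= C}, last u t = b,
      G a u & {in u :: t, forall v, G a v -> v = u}].
Proof.
move=> cC /seesP[u0 u0C xu0] bC.
have /connectP[p pp lp] := cC _ _ u0C bC.
have [pG sp] := rst_path pp.
have [q [iq lq sq]] := ipath_of_path (adj_irr G) pG.
have sC : {subset u0 :: q <= C}.
  by move=> z; rewrite inE => /orP[/eqP->//|/sq/sp].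
have /split_last [s1 [u [s2 [es xu nh]]]] : has (G a) (u0 :: q) by rewrite /= xu0.
exists u, s2; split=> //.
- by apply: (@ipath_catr _ _ s1); rewrite -es.
- by move=> z zs; apply: sC; rewrite es mem_cat zs orbT.
- by rewrite lp -lq; have := congr1 (last u) es; rewrite last_cat.
- move=> v; rewrite inE => /orP[/eqP->//|vs] av.
  by case/negP: nh; apply/hasP; exists v.
Qed.

(** One induced path through each set suffices: the sets are disjoint with no edge between them, so
    the paths meet and see one another only at [x] and [y]. *)
Lemma theta_of_sets x y (C : 'I_3 -> {set V}) : x != y -> ~~ G x y ->
  (forall i, [/\ conn G (C i), x \notin C i, y \notin C i, sees G (C i) x & sees G (C i) y]) ->
  (forall i j, i != j -> anti G (C i) (C j)) -> theta_in G.
Proof.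
move=> nxy xy Ci aC.
have /fin_all_exists[s hs] i : exists s,
    [/\ ipath G (x :: rcons s y), 0 < size s & {subset s <= C i}].
  by have [c nx ny sx sy] := Ci i; apply: link_chordless.
exists x, y, (fun i => rcons (s i) y); split.
- move=> i; have [ps sz _] := hs i; rewrite size_rcons ltnS; split=> //.
  by have := chordless_of_ipath ps; rewrite last_rcons.
- move=> i j z ij; rewrite !inE !mem_rcons !inE.
  case/or3P=> [/eqP->|/eqP->|zi]; [by left|by right|].
  case/or3P=> [/eqP->|/eqP->|zj]; [by left|by right|].
  have [_ _ si] := hs i; have [_ _ sj] := hs j.
  by have [_] := aC i j ij z z (si z zi) (sj z zj); rewrite eqxx.
- move=> i j u v ij; rewrite !inE !mem_rcons !inE.
  case/or3P=> [/eqP->|/eqP->|ui]; [by constructor 1|by constructor 2|].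
  case/or3P=> [/eqP->|/eqP->|vj]; [by constructor 3|by constructor 4|].
  have [_ _ si] := hs i; have [_ _ sj] := hs j.
  by have [/negbTE-> _] := aC i j ij u v (si u ui) (sj v vj).
Qed.

(** [i0] is the only index whose path may reduce to an edge at the apex, which leaves two paths of
    length at least 2. *)
Lemma pyramid_of_sets a (b : 'I_3 -> V) (C : 'I_3 -> {set V}) (i0 : 'I_3) :
  (forall i, [/\ conn G (C i), a \notin C i, sees G (C i) a & b i \in C i]) ->
  (forall i j, i != j -> G (b i) (b j)) ->
  (forall i, i != i0 -> ~~ G a (b i)) ->
  (forall i j u v, i != j -> u \in C i -> v \in C j ->
     u != v /\ (G u v -> u = b i /\ v = b j)) -> pyramid_in G.
Proof.
move=> Ci tr far adj.
have /fin_all_exists[q hq] i : exists q,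
    [/\ ipath G (a :: q), {subset q <= C i}, last a q = b i & 0 < size q].
  have [c na sa bC] := Ci i; have [u [t [p sub l au ao]]] := link_to c sa bC.
  exists (u :: t); split=> //; apply: ipath_cons => //.
  by apply: contra na => /sub.
exists a, b, q; split=> //.
- split; first by move=> i; have [p _ <- sz] := hq i; split=> //; apply: chordless_of_ipath.
  have c2 : 2 <= #|predC1 i0| by rewrite cardC1 card_ord.
  apply: leq_trans c2 _; apply: subset_leq_card; apply/subsetP=> i; rewrite !inE => /far ab.
  have [p _ l] := hq i; case: (q i) p l => [|u [|v t]] //= /andP[au _] e.
  by rewrite -e au in ab.
- move=> i j x ij; rewrite !inE => /orP[/eqP->//|xi] /orP[/eqP->//|xj].
  have [_ si _ _] := hq i; have [_ sj _ _] := hq j.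
  by have [] := adj i j x x ij (si x xi) (sj x xj); rewrite eqxx.
- move=> i j u v ij; rewrite !inE => /orP[/eqP->//|ui]; first by constructor 2.
  move=> /orP[/eqP->//|vj]; first by constructor 3.
  have [_ si _ _] := hq i; have [_ sj _ _] := hq j.
  by have [_ h] := adj i j u v ij (si u ui) (sj v vj); move=> /h; constructor 1.
Qed.

(** The path closes up through [C]. The last hypothesis concerns a path that is one edge: a common
    neighbour of its ends in [C] would give a triangle instead of a hole. *)
Lemma hole_of_link p s C : ipath G (p :: s) -> s != [::] -> conn G C ->
  {in C & p :: s, forall u v, u != v /\ (G u v -> v = p \/ v = last p s)} ->
  sees G C p -> sees G C (last p s) ->
  (size s = 1 -> {in C, forall u, G p u -> ~~ G (last p s) u}) ->
  exists u t, [/\ hole G ((p :: s) ++ (u :: t)), {subset u :: t <= C},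
     G (last p s) u & G p (last u t)].
Proof.
move=> ps s0 cC adj sp sq nocom.
have [u [t [it sub [qu qo] [pl po]]]] := link cC sq sp.
exists u, t; split=> //; apply: mk_hole => //.
- by rewrite adj_sym.
- by move=> a b aS /sub bC; rewrite eq_sym; case: (adj b a bC aS).
- move=> a b aS bT ab; have bC := sub _ bT.
  rewrite adj_sym in ab; have [_ /(_ ab)[ea|ea]] := adj b a bC aS; move: ab; rewrite ea adj_sym.
    by move=> /(po _ bT); right.
  by move=> /(qo _ bT); left.
- case: s s0 {ps adj} nocom sq qu qo => // x [|y s] _ nocom sq qu qo; last by rewrite size_cat /= addnS.
  case: t it sub pl po qo => [|v t] //= it sub pl po qo.
  by have := nocom erefl u (sub _ (mem_head _ _)) pl; rewrite /= qu.
Qed.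

End Builders.

(** * Neighbours of a hole in a graph without theta, wheel and pyramid *)

Section Tame.
Variables (V : finType) (G : sgraph V).
Implicit Types (C D : {set V}) (u v x y : V).

Definition tame : Prop := [/\ ~ theta_in G, ~ wheel_in G & ~ pyramid_in G].

Hypothesis tG : tame.

Definition pick3 T (x y z : T) (i : 'I_3) := nth x [:: x; y; z] i.

Lemma pick3P T (P : 'I_3 -> T -> Prop) (x y z : T) :
  P (@Ordinal 3 0 isT) x -> P (@Ordinal 3 1 isT) y -> P (@Ordinal 3 2 isT) z ->
  forall i, P i (pick3 x y z i).
Proof.
move=> px py pz [[|[|[|//]]] h]; rewrite /pick3 /=.
- by rewrite (bool_irrelevance h isT).
- by rewrite (bool_irrelevance h isT).
- by rewrite (bool_irrelevance h isT).
Qed.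

Lemma no_theta x y C1 C2 C3 : x != y -> ~~ G x y ->
  [/\ conn G C1, x \notin C1, y \notin C1, sees G C1 x & sees G C1 y] ->
  [/\ conn G C2, x \notin C2, y \notin C2, sees G C2 x & sees G C2 y] ->
  [/\ conn G C3, x \notin C3, y \notin C3, sees G C3 x & sees G C3 y] ->
  anti G C1 C2 -> anti G C1 C3 -> anti G C2 C3 -> False.
Proof.
move=> nxy xy h1 h2 h3 a12 a13 a23; have [nt _ _] := tG; apply: nt.
apply: (@theta_of_sets _ G x y (pick3 C1 C2 C3)) => //.
  exact: (pick3P (P := fun i C => [/\ conn G C, x \notin C, y \notin C, sees G C x & sees G C y])).
move=> [[|[|[|//]]] hi] [[|[|[|//]]] hj] //= _; rewrite /pick3 /=; exact: antiC || by [].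
Qed.

Lemma no_pyramid a b1 b2 b3 C1 C2 C3 :
  [/\ conn G C1, a \notin C1, sees G C1 a & b1 \in C1] ->
  [/\ conn G C2, a \notin C2, sees G C2 a & b2 \in C2] ->
  [/\ conn G C3, a \notin C3, sees G C3 a & b3 \in C3] ->
  G b1 b2 -> G b1 b3 -> G b2 b3 ->
  ~~ G a b3 -> ~~ (G a b1 && G a b2) ->
  {in C1 & C2, forall u v, u != v /\ (G u v -> u = b1 /\ v = b2)} ->
  {in C1 & C3, forall u v, u != v /\ (G u v -> u = b1 /\ v = b3)} ->
  {in C2 & C3, forall u v, u != v /\ (G u v -> u = b2 /\ v = b3)} -> False.
Proof.
move=> h1 h2 h3 b12 b13 b23 ab3 ab12 a12 a13 a23; have [_ _ np] := tG; apply: np.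
have sw b b' (C C' : {set V}) : {in C & C', forall u v, u != v /\ (G u v -> u = b /\ v = b')} ->
    {in C' & C, forall u v, u != v /\ (G u v -> u = b' /\ v = b)}.
  move=> h u v uC vC; have [n e] := h v u vC uC; rewrite eq_sym n adj_sym.
  by split=> // /e[].
have [a21 [a31 a32]] := (sw _ _ _ _ a12, (sw _ _ _ _ a13, sw _ _ _ _ a23)).
apply: (@pyramid_of_sets _ G a (pick3 b1 b2 b3) (pick3 C1 C2 C3)
  (if G a b1 then @Ordinal 3 0 isT else @Ordinal 3 1 isT)).
- by move=> [[|[|[|//]]] hi].
- by move=> [[|[|[|//]]] hi] [[|[|[|//]]] hj] //= _; rewrite /pick3 /= // adj_sym.
- move=> [[|[|[|//]]] hi]; rewrite /pick3 /=; case: ifP ab12 => //= ab1 ab2 //.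
- move=> [[|[|[|//]]] hi] [[|[|[|//]]] hj] u v //= _; rewrite /pick3 /=; auto.
Qed.

Lemma hole_arcs x s2 y s3 : hole G (x :: s2 ++ y :: s3) -> ~~ G x y ->
  [/\ [/\ conn G [set z in s2], x \notin s2, y \notin s2,
           sees G [set z in s2] x & sees G [set z in s2] y],
      [/\ conn G [set z in s3], x \notin s3, y \notin s3,
           sees G [set z in s3] x & sees G [set z in s3] y]
    & anti G [set z in s2] [set z in s3]].
Proof.
move=> hh xy; have [ip _ xhd xl _] := hole_consP hh.
have := hole_uniq hh; rewrite /= mem_cat inE !negb_or cat_uniq /=.
case/and3P=> /and3P[x2 nxy x3] u2 /and3P[nh y3 u3].
move: nh; rewrite negb_or => /andP[y2 nh].
have ip2 := ipath_catl ip; have ip3 := ipath_catr ip.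
have s2n : s2 != [::] by apply: contraNneq xy => e2; rewrite e2 in xhd.
have s3n : s3 != [::] by apply: contraNneq xy => e3; rewrite e3 last_cat in xl.
have hd2 : head x (s2 ++ y :: s3) \in s2.
  by case: (s2) s2n => //= z t _; rewrite mem_head.
have l3 : last x (s2 ++ y :: s3) \in s3.
  by rewrite last_cat /=; case: (s3) s3n => //= z t _; rewrite mem_last.
have l2y : exists2 z, z \in s2 & G y z.
  case/lastP: (s2) s2n ip => // t z _; rewrite cat_rcons => /ipath_next zy.
  by exists z; rewrite ?mem_rcons ?mem_head // adj_sym.
have h3y : exists2 z, z \in s3 & G y z.
  by case: (s3) s3n ip3 => // z t _ /and4P[yz _ _ _]; exists z; rewrite ?mem_head.
split.
- split=> //; [exact: conn_ipath|by apply: seesI xhd; rewrite inE|].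
  by case: l2y => z z2 yz; apply: seesI yz; rewrite inE.
- split=> //; [by apply: conn_ipath; apply: (ipath_behead ip3)|by apply: seesI xl; rewrite inE|].
  by case: h3y => z z2 yz; apply: seesI yz; rewrite inE.
- move=> a b; rewrite !inE => a2 b3; split; first exact: (ipath_far ip a2 b3).
  by apply: contraNneq nh => e; apply/hasP; exists b => //; rewrite -e.
Qed.

(** Without wheels, [v] has at most two neighbours on the hole; if these were nonadjacent, [v] and
    the two arcs between them would form a theta. Most contradictions below come from this fact. *)
Lemma hole_nbrs h v x y : hole G h -> v \notin h -> x \in h -> y \in h ->
  G v x -> G v y -> (x == y) || G x y.
Proof.
move=> hh vh xh yh vx vy; apply: contraT; rewrite negb_or => /andP[nxy xy].
have [_ nw _] := tG.
have two w : w \in h -> G v w -> (w == x) || (w == y).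
  move=> wh vw; apply: contraT; rewrite negb_or => /andP[wx wy]; exfalso; apply: nw.
  exists h, v; split=> //; rewrite -size_filter.
  have : {subset [:: x; y; w] <= [seq z <- h | G v z]}.
    by move=> z; rewrite !inE mem_filter => /or3P[]/eqP->; rewrite ?vx ?vy ?vw.
  apply: uniq_leq_size; rewrite /= !inE negb_or nxy /= andbT.
  by rewrite eq_sym wx eq_sym wy.
have [s [hs es _]] := hole_at hh xh.
have ys : y \in s by move: yh; rewrite -es inE eq_sym (negbTE nxy).
case/splitPr: ys hs es => s2 s3 hs es.
have [[c2 x2 y2 sx2 sy2] [c3 x3 y3 sx3 sy3] a23] := hole_arcs hs xy.
have nv z : z \in s2 ++ s3 -> ~~ G v z /\ v != z.
  move=> zs; have zh : z \in h.
    by rewrite -es inE mem_cat inE; move: zs; rewrite mem_cat => /orP[]->; rewrite !orbT.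
  split; last by apply: contraNneq vh => ->.
  apply/negP=> /(two z zh) /orP[]/eqP e; move: zs; rewrite e mem_cat.
    by rewrite (negbTE x2) (negbTE x3).
  by rewrite (negbTE y2) (negbTE y3).
exfalso; apply: (@no_theta x y [set z in s2] [set z in s3] [set v]) => //.
- by split; rewrite ?inE.
- by split; rewrite ?inE.
- split; rewrite ?inE.
  + exact: conn1.
  + by apply: contraNneq vh => <-.
  + by apply: contraNneq vh => <-.
  + by apply: (seesI (u := v)); rewrite ?inE // adj_sym.
  + by apply: (seesI (u := v)); rewrite ?inE // adj_sym.
- apply: antiC => a b; rewrite !inE => /eqP-> b2; apply: nv.
  by rewrite mem_cat b2.
- apply: antiC => a b; rewrite !inE => /eqP-> b2; apply: nv.
  by rewrite mem_cat b2 orbT.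
Qed.

(** An induced path from [x] to [y] through [C] closes through [D] into a hole, on which [a],
    whatever else it sees there, has the nonadjacent neighbours [x] and [y]. *)
Lemma no_crossing x y a C D : x != y -> ~~ G x y -> G a x -> G a y ->
  [/\ conn G C, x \notin C, y \notin C, sees G C x & sees G C y] ->
  [/\ conn G D, x \notin D, y \notin D, sees G D x & sees G D y] ->
  anti G C D -> a \notin C -> a \notin D -> False.
Proof.
move=> nxy xy ax ay [cC xC yC sx sy] [cD xD yD tx ty] aCD aC aD.
have [s [ips sz sub]] := link_chordless cC xC yC nxy xy sx sy.
have lst : last x (rcons s y) = y by rewrite last_rcons.
have [||||u [t [hh subt _ _]]] := hole_of_link ips _ cD _ tx; rewrite ?lst //.
- by case: (s).
- move=> u v uD; rewrite inE mem_rcons inE => /or3P[/eqP->|/eqP->|/sub vC].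
  + by split; [apply: contraNneq xD => <-|left].
  + by split; [apply: contraNneq yD => <-|right].
  + by have [n1 n2] := antiC aCD uD vC; split=> // uv; rewrite uv in n1.
- by rewrite size_rcons => -[/eqP]; rewrite size_eq0 => /eqP e; rewrite e in sz.
have [] : (x == y) || G x y; last by rewrite (negbTE nxy) (negbTE xy).
apply: (hole_nbrs hh _ _ _ ax ay).
- apply/negP; rewrite mem_cat => /orP[|/subt]; last by rewrite (negbTE aD).
  rewrite inE mem_rcons inE => /or3P[/eqP e|/eqP e|/sub]; last by rewrite (negbTE aC).
    by rewrite e adj_irr in ax.
  by rewrite e adj_irr in ay.
- by rewrite mem_cat mem_head.
- by rewrite mem_cat inE mem_rcons mem_head orbT.
Qed.

End Tame.

Section PathSplit.
Variables (V : finType) (G : sgraph V).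

Lemma uniq_split (T : eqType) (s1 s2 t1 t2 : seq T) x : uniq (s1 ++ x :: s2) ->
  s1 ++ x :: s2 = t1 ++ x :: t2 -> s1 = t1 /\ s2 = t2.
Proof.
elim: s1 t1 => [|y s1 IH] [|z t1] /=.
- by move=> _ [].
- by move=> /andP[nx _] [e1 e2]; move: nx; rewrite e2 -e1 mem_cat mem_head orbT.
- by move=> /andP[nx _] [e1 e2]; move: nx; rewrite e1 mem_cat mem_head orbT.
- by move=> /andP[_ un] [-> /(IH _ un)[-> ->]].
Qed.

Lemma ipath2 x y : G x y -> ipath G [:: x; y].
Proof.
move=> xy; apply/and4P; split=> //.
by rewrite inE; apply: contraTneq xy => ->; rewrite adj_irr.
Qed.

Lemma ipath_cross s1 u v s2 a b : ipath G (s1 ++ u :: v :: s2) ->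
  a \in rcons s1 u -> b \in v :: s2 -> a != b /\ (G a b -> a = u /\ b = v).
Proof.
move=> ip as1 bs2; split.
  have := ipath_uniq ip; rewrite -cat_rcons cat_uniq => /and3P[_ nh _].
  by apply: contraNneq nh => e; apply/hasP; exists b => //; rewrite -e.
move=> ab; move: as1 bs2; rewrite mem_rcons !inE.
case/orP=> [/eqP ea|a1]; case/orP=> [/eqP eb|b2]; subst=> //.
- move: ip; rewrite -cat_rcons => ip.
  by have := @ipath_far _ _ (rcons s1 u) v s2 u b ip; rewrite ab mem_rcons mem_head => /(_ isT b2).
- by have := @ipath_far _ _ _ _ _ a v ip a1; rewrite ab mem_head => /(_ isT).
- by have := @ipath_far _ _ _ _ _ a b ip a1; rewrite ab inE b2 orbT => /(_ isT).
Qed.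

Lemma ipath_split s1 w s2 : ipath G (s1 ++ w :: s2) -> s1 != [::] -> s2 != [::] ->
  [/\ [/\ conn G [set z in s1], w \notin s1 & sees G [set z in s1] w],
      [/\ conn G [set z in s2], w \notin s2 & sees G [set z in s2] w]
    & anti G [set z in s1] [set z in s2]].
Proof.
move=> ip n1 n2; have i1 := ipath_catl ip; have i2 := ipath_catr ip.
have := ipath_uniq ip; rewrite cat_uniq /= negb_or => /and4P[u1 /andP[w1 nh] w2 u2].
split.
- split=> //; first exact: conn_ipath.
  case/lastP: s1 n1 ip {i1 u1 w1 nh} => // s u _; rewrite cat_rcons => /ipath_next uw.
  by apply: (seesI (u := u)); rewrite ?inE ?mem_rcons ?mem_head // adj_sym.
- split=> //; first by apply: conn_ipath; apply: (ipath_behead i2).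
  case: s2 n2 i2 {ip u2 w2 nh} => // u s _ /and4P[wu _ _ _].
  by apply: (seesI (u := u)); rewrite ?inE ?eqxx.
- move=> a b; rewrite !inE => a1 b2; split; first exact: ipath_far ip a1 b2.
  by apply: contraNneq nh => e; apply/hasP; exists b => //; rewrite -e.
Qed.

Lemma fan_hole a x p y : ipath G (x :: rcons p y) -> p != [::] -> a \notin p ->
  {in p, forall u, ~~ G a u} -> G a x -> G a y ->
  hole G ((x :: rcons p y) ++ [:: a]).
Proof.
move=> ip n0 ap adj ax ay; apply: mk_hole => //.
- by rewrite last_rcons adj_sym.
- move=> u v; rewrite !inE mem_rcons inE => us /eqP->.
  case/or3P: us => [/eqP->|/eqP->|us].
  + by apply: contraTneq ax => ->; rewrite adj_irr.
  + by apply: contraTneq ay => ->; rewrite adj_irr.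
  + by apply: contraNneq ap => <-.
- move=> u v; rewrite !inE mem_rcons inE last_rcons => us /eqP->.
  case/or3P: us => [/eqP->|/eqP->|us]; [by right|by left|].
  by rewrite adj_sym (negbTE (adj u us)).
- by rewrite size_cat /= size_rcons addn1; case: (p) n0.
Qed.

End PathSplit.

(** * Three pairwise nonadjacent neighbours of a node and a connected set *)

Section TameLocal.
Variables (V : finType) (G : sgraph V).
Hypothesis tG : tame G.
Implicit Types (C D : {set V}) (a u v x y z : V).

(** [a] closes the path into a hole; [z] lies off this hole and sees its nonadjacent nodes [a] and
    [w]. *)
Lemma fan_attach a x p y z w : ipath G (x :: rcons p y) -> a \notin p ->
  {in p, forall u, ~~ G a u} -> G a x -> G a y -> G a z -> x != z -> y != z ->
  w \in p -> G z w -> False.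
Proof.
move=> ip ap adj ax ay az xz yz wp zw.
have hh : hole G ((x :: rcons p y) ++ [:: a]).
  by apply: fan_hole => //; case: (p) wp.
have [] : (a == w) || G a w; last first.
- by rewrite (negbTE (adj w wp)) orbF => /eqP e; rewrite e wp in ap.
apply: (hole_nbrs tG hh _ _ _ (v := z)) => //; last by rewrite adj_sym.
- rewrite mem_cat !inE mem_rcons inE eq_sym (negbTE xz) eq_sym (negbTE yz) /=.
  rewrite negb_or; apply/andP; split; last by apply: contraTneq az => ->; rewrite adj_irr.
  by apply/negP => /adj; rewrite az.
- by rewrite mem_cat mem_seq1 eqxx orbT.
- by rewrite mem_cat inE mem_rcons inE wp !orbT.
Qed.

Definition stable3 x y z := [&& x != y, x != z, y != z, ~~ G x y, ~~ G x z & ~~ G y z].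

Lemma stable3E x y z : stable3 x y z ->
  [/\ x != y, x != z & y != z] /\ [/\ ~~ G x y, ~~ G x z & ~~ G y z].
Proof. by case/and5P=> -> -> -> -> /andP[-> ->]. Qed.

Lemma stable3_swap x y z : stable3 x y z -> stable3 y x z.
Proof.
case/stable3E=> -[n1 n2 n3] [n4 n5 n6]; rewrite /stable3 n3 n6 eq_sym n1 n2 n5.
by rewrite adj_sym n4.
Qed.

(** The path from [z] to the first node seen by [x] closes into a hole through [x] and [a]; [y] sees
    [a] and an inner node of that path, as in [fan_attach]. *)
Lemma path_attach_aux a x y z u W : ipath G (u :: W) -> a \notin u :: W ->
  {in u :: W, forall v, ~~ G a v} -> G a x -> G a y -> G a z -> stable3 x y z ->
  G z u -> {in u :: W, forall v, G z v -> v = u} ->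
  forall s1 w s2, u :: W = s1 ++ w :: s2 -> G x w -> ~~ has (G x) s1 ->
  has (G y) (rcons s1 w) -> False.
Proof.
move=> ip na adj ax ay az st zu zo s1 w s2 e xw nh /hasP[v vs yv].
have sub : {subset rcons s1 w <= u :: W}.
  by move=> b; rewrite e -cat_rcons mem_cat => ->.
have [[n1 n2 n3] [n4 n5 n6]] := stable3E st.
have nt b : b \in u :: W -> G a b = false by move=> /adj/negbTE.
apply: (@fan_attach a z (rcons s1 w) x y v) => //; try by rewrite eq_sym.
- have ip1 : ipath G (rcons s1 w) by apply: (@ipath_catl _ _ _ s2); rewrite cat_rcons -e.
  case: s1 e nh {vs} ip1 sub => [|b s1] [eb eW] nh ip1 sub.
    rewrite /= -eb; apply/and4P; split=> //; last by rewrite eb; apply: ipath2; rewrite adj_sym.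
      rewrite !inE negb_or; apply/andP; split.
        by apply: contraTneq az => ->; rewrite nt ?mem_head.
      by rewrite eq_sym.
    by rewrite /= adj_sym n5.
  subst b; apply: ipath_cons.
  + rewrite -rcons_cons; apply: (ipath_rcons (x := u)) => //.
    * by rewrite last_rcons adj_sym.
    * by apply: contraTN ax => /sub/adj.
    * move=> b; rewrite -rcons_cons mem_rcons inE last_rcons => /orP[/eqP//|bs] bx.
      by case/negP: nh; apply/hasP; exists b => //; rewrite adj_sym.
  + rewrite -rcons_cons mem_rcons inE negb_or eq_sym n2 /=.
    by apply: contraTN az => /sub/adj.
  + by [].
  + move=> b; rewrite -rcons_cons mem_rcons inE => /orP[/eqP->|/sub/zo//].
    by rewrite adj_sym (negbTE n5).
- by apply: contra na => /sub.
- by move=> b /sub/adj.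
Qed.

(** Whichever of [x] and [y] is met later along the path plays the part of [x] in
    [path_attach_aux]. *)
Lemma path_attach a x y z u W : ipath G (u :: W) -> a \notin u :: W ->
  {in u :: W, forall v, ~~ G a v} -> G a x -> G a y -> G a z -> stable3 x y z ->
  G z u -> {in u :: W, forall v, G z v -> v = u} ->
  has (G x) (u :: W) -> has (G y) (u :: W) -> False.
Proof.
move=> ip na adj ax ay az st zu zo /split_first[s1 [w [s2 [e xw nh]]]].
have aux := path_attach_aux ip na adj ax ay az st zu zo e xw nh.
case: (boolP (has (G y) (rcons s1 w))) => // nh1.
move=> /split_first[t1 [w' [t2 [e' yw nh']]]].
have w't : w' \in s2.
  have : w' \in rcons s1 w ++ s2 by rewrite cat_rcons -e e' mem_cat mem_head orbT.
  by rewrite mem_cat => /orP[ws|//]; case/hasP: nh1; exists w'.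
apply: (path_attach_aux ip na adj ay ax az (stable3_swap st) zu zo e' yw nh').
case/splitPr: w't e => r1 r2 e.
(* The nodes are distinct, so what precedes the first neighbour [w'] of [y] is determined by its
   position and contains the first neighbour [w] of [x]. *)
have : t1 = rcons s1 w ++ r1.
  have un := ipath_uniq ip.
  have := congr1 (index w') e'; rewrite e -cat_rcons catA.
  move: un; rewrite e -cat_rcons catA cat_uniq => /and3P[_ nin _].
  move=> _; have : take (index w' (u :: W)) (u :: W) = t1.
    rewrite e' index_cat; have -> : (w' \in t1) = false.
      have := ipath_uniq ip; rewrite e' cat_uniq => /and3P[_ + _].
      by rewrite /= negb_or => /andP[/negbTE].
    by rewrite /= eqxx addn0 take_size_cat.
  move=> <-; rewrite e -cat_rcons catA index_cat.
  move: nin; rewrite /= negb_or => /andP[/negbTE-> _].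
  by rewrite /= eqxx addn0 take_size_cat.
move=> ->; rewrite has_rcons has_cat has_rcons xw.
by rewrite !orbT.
Qed.

(** Join [x] to [y] by an induced path [p] through [C], which [z] does not see, and stop a path from
    [z] at the first node [w] that sees [p]. The first and last neighbours [f] and [l] of [w] on [p]
    are equal or adjacent: if equal, there is a theta with ends [a] and [f]; if adjacent, a pyramid
    with apex [a] and triangle [f], [l], [w]. *)
Lemma no_claw a x y z C : conn G C -> a \notin C -> {in C, forall u, ~~ G a u} ->
  G a x -> G a y -> G a z -> stable3 x y z ->
  sees G C x -> sees G C y -> sees G C z -> False.
Proof.
move=> cC aC adj ax ay az st sx sy sz.
have [[n1 n2 n3] [n4 n5 n6]] := stable3E st.
have nC b : G a b -> b \notin C by apply: contraTN => /adj.
have [p [ip p0 subp]] := link_chordless cC (nC x ax) (nC y ay) n1 n4 sx sy.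
have ap : a \notin p by apply: contra aC => /subp.
have adjp : {in p, forall u, ~~ G a u} by move=> u /subp/adj.
have zp w : w \in p -> ~~ G z w.
  by move=> wp; apply/negP=> zw; exact: (fan_attach ip ap adjp ax ay az n2 n3 wp zw).
have [v0 v0p] : exists v0, v0 \in p by case: (p) p0 => // b q _; exists b; rewrite mem_head.
have [u [t [it subt lt zu zo]]] := link_to cC sz (subp _ v0p).
have /split_first[t1 [w [t2 [et wat nt1]]]] : has (fun b => has (G b) p || (b \in p)) (u :: t).
  by apply/hasP; exists v0; rewrite ?v0p ?orbT // -lt mem_last.
have t1n b : b \in t1 -> ~~ has (G b) p /\ b \notin p.
  by move=> bt; apply/andP; rewrite -negb_or; apply: contra nt1 => h; apply/hasP; exists b.
(* If [w] were on [p], either it would be the neighbour of [z] on the path, or its predecessor would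
   already see [p]. *)
have wp : w \notin p.
  apply/negP=> wp; case/lastP: t1 et t1n {nt1} => [|r b] et t1n.
    by move: et => [eu _]; move: (zp w wp); rewrite -eu zu.
  have /t1n[/hasP nh _] : b \in rcons r b by rewrite mem_rcons mem_head.
  apply: nh; exists w => //; rewrite et cat_rcons in it; exact: ipath_next it.
rewrite (negbTE wp) orbF in wat.
have ipQ : ipath G (rcons t1 w) by apply: (@ipath_catl _ _ _ t2); rewrite cat_rcons -et.
have subQ : {subset rcons t1 w <= u :: t}.
  by move=> b bs; rewrite et -cat_rcons mem_cat bs.
have [W eW] : exists W, rcons t1 w = u :: W.
  by case: (t1) et => [|b r] [-> _]; [exists [::]|exists (rcons r w)].
have QC : {subset u :: W <= C} by move=> b; rewrite -eW => /subQ/subt.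
have Qp b : b \in u :: W -> b \notin p.
  by rewrite -eW mem_rcons inE => /orP[/eqP->//|/t1n[]].
have Qadj b c : b \in u :: W -> c \in p -> G b c -> b = w.
  rewrite -eW mem_rcons inE => /orP[/eqP->//|/t1n[nb _]] cp bc.
  by case/hasP: nb; exists c.
have lQ : last u W = w by have := congr1 (last u) eW; rewrite last_rcons.
have wQ : w \in u :: W by rewrite -lQ mem_last.
have [f1 [f [f2 [ef wf nf]]]] := split_first wat.
have [l1 [l [l2 [el wl nl]]]] := split_last wat.
rewrite eW in ipQ.
have Qz : {in u :: W, forall v, G z v -> v = u}.
  by move=> b bQ; apply: zo; apply: subQ; rewrite eW.
have Qa : a \notin u :: W by apply: contra aC => /QC.
have ip' : ipath G p.
  by move: (ipath_behead ip); rewrite -cats1 => /ipath_catl.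
(* The path from [z] to [w], continued along [p] from [l] to its end, is seen by [y] at its last
   node, so [path_attach] forbids [x] to see it. [hy] is the mirror image, along [p] from [f] back
   to its start. *)
have hx : ~~ has (G x) ((u :: W) ++ (l :: l2)).
  apply/negP=> hx; apply: (@path_attach a x y z u (W ++ l :: l2)) => //.
  - apply: ipath_join => //; first by apply: (@ipath_catr _ _ l1); rewrite -el.
    + by rewrite lQ.
    + move=> b c bQ cl; apply: contraNneq (Qp b bQ) => ->; by rewrite el mem_cat cl orbT.
    + move=> b c bQ cl bc; have cp : c \in p by rewrite el mem_cat cl orbT.
      have ebw := Qadj b c bQ cp bc; split; first by rewrite lQ.
      move: cl; rewrite inE => /orP[/eqP//|cl]; case/hasP: nl; exists c => //.
      by rewrite -ebw.
  - rewrite -cat_cons mem_cat negb_or Qa /=; apply: contra ap => al.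
    by rewrite el mem_cat al orbT.
  - move=> b; rewrite -cat_cons mem_cat => /orP[/QC/adj//|bl].
    by apply: adjp; rewrite el mem_cat bl orbT.
  - move=> b; rewrite -cat_cons mem_cat => /orP[/Qz//|bl] zb.
    by have := zp b; rewrite zb el mem_cat bl orbT => /(_ isT).
  - apply/hasP; exists (last l l2); first by rewrite -cat_cons mem_cat mem_last orbT.
    move: (ipath_path ip); rewrite rcons_path => /andP[_].
    by rewrite el last_cat adj_sym.
have hy : ~~ has (G y) ((u :: W) ++ (f :: rev f1)).
  have ff b : b \in f :: rev f1 -> b \in p.
    by rewrite inE mem_rev ef mem_cat inE orbA [_ || (b == f)]orbC => ->.
  have ipf : ipath G (f :: rev f1).
    rewrite -rev_rcons; apply: (ipath_rev (adj_sym G)).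
    by apply: (@ipath_catl _ _ _ f2); rewrite cat_rcons -ef.
  apply/negP=> hy; apply: (@path_attach a x y z u (W ++ f :: rev f1)) => //.
  - apply: ipath_join => //.
    + by rewrite lQ.
    + move=> b c bQ cl; apply: contraNneq (Qp b bQ) => ->; exact: ff.
    + move=> b c bQ cl bc; have ebw := Qadj b c bQ (ff c cl) bc; split; first by rewrite lQ.
      move: cl; rewrite inE mem_rev => /orP[/eqP//|cl]; case/hasP: nf; exists c => //.
      by rewrite -ebw.
  - by rewrite -cat_cons mem_cat negb_or Qa /=; apply: contra ap => /ff.
  - by move=> b; rewrite -cat_cons mem_cat => /orP[/QC/adj//|/ff/adjp].
  - move=> b; rewrite -cat_cons mem_cat => /orP[/Qz//|/ff bl] zb.
    by have := zp b bl; rewrite zb.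
  - case: (p) p0 ip ef => // h q _ /and4P[xh _ _ _] ef.
    apply/hasP; exists h => //; rewrite -cat_cons mem_cat.
    suff -> : h \in f :: rev f1 by rewrite orbT.
    by rewrite inE mem_rev; case: (f1) ef => [|h' q'] [-> _]; rewrite ?mem_head ?eqxx ?orbT.
have Qx b : b \in u :: W -> ~~ G x b.
  by move=> bQ; apply: contra hx => xb; apply/hasP; exists b; rewrite // mem_cat bQ.
have Qy b : b \in u :: W -> ~~ G y b.
  by move=> bQ; apply: contra hy => xb; apply/hasP; exists b; rewrite // mem_cat bQ.
have lx b : b \in l :: l2 -> ~~ G x b.
  by move=> bQ; apply: contra hx => xb; apply/hasP; exists b; rewrite // mem_cat bQ orbT.
have fy b : b \in rcons f1 f -> ~~ G y b.
  move=> bQ; apply: contra hy => xb; apply/hasP; exists b; rewrite // mem_cat.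
  suff -> : b \in f :: rev f1 by rewrite orbT.
  by rewrite inE mem_rev -in_cons -mem_rcons.
have sees_last s b : s != [::] -> ipath G (rcons s b) -> sees G [set c in s] b.
  case/lastP: s => // s c _; rewrite -cats1 cat_rcons => /ipath_next cb.
  by apply: (seesI (u := c)); rewrite ?inE ?mem_rcons ?mem_head // adj_sym.
have nxz : x \notin z :: u :: W.
  by rewrite inE negb_or n2; apply: contraTN ax => /QC/adj.
have nyz : y \notin z :: u :: W.
  by rewrite inE negb_or n3; apply: contraTN ay => /QC/adj.
have zQ b : b \in z :: u :: W -> b \notin x :: rcons p y.
  rewrite inE => /orP[/eqP->|bQ].
    rewrite inE mem_rcons inE eq_sym (negbTE n2) eq_sym (negbTE n3) /=.
    by apply: contraTN az => /adjp.
  rewrite inE mem_rcons inE (negbTE (Qp b bQ)) orbF; apply/norP; split.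
    by apply: contraNneq nxz => <-; rewrite inE bQ orbT.
  by apply: contraNneq nyz => <-; rewrite inE bQ orbT.
have cz : conn G [set b in z :: u :: W].
  by apply: conn_path; rewrite /= zu (ipath_path ipQ).
have wa : G a w = false by apply/negbTE; apply: adj; apply: QC.
have fp : f \in p by rewrite ef mem_cat mem_head orbT.
have lp : l \in p by rewrite el mem_cat mem_head orbT.
have p0n : p != [::] by case: (p) p0.
have wnb c : c \in p -> G w c -> c \notin f1 /\ c \notin l2.
  by move=> cp wc; split; [apply: contra nf|apply: contra nl] => h; apply/hasP; exists c.
(* [w] lies off the hole that [a] makes with [p]. *)
have fl : (f == l) || G f l.
  apply: (hole_nbrs tG (fan_hole ip p0n ap adjp ax ay) (v := w)) => //.
  - rewrite mem_cat mem_seq1 negb_or zQ; last by rewrite in_cons wQ orbT.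
    by apply: contraTneq wQ => ->.
  - by rewrite mem_cat inE mem_rcons inE fp !orbT.
  - by rewrite mem_cat inE mem_rcons inE lp !orbT.
have zQadj b c : b \in z :: u :: W -> c \in x :: rcons p y -> G b c ->
    b = w /\ (c \in p).
  move=> bQ cp bc; have cpp : c \in p.
    move: cp; rewrite inE mem_rcons inE => /or3P[/eqP e|/eqP e|//]; subst c.
      move: bQ; rewrite inE => /orP[/eqP e|/Qx]; last by rewrite adj_sym bc.
      by rewrite e adj_sym (negbTE n5) in bc.
    move: bQ; rewrite inE => /orP[/eqP e|/Qy]; last by rewrite adj_sym bc.
    by rewrite e adj_sym (negbTE n6) in bc.
  split=> //; move: bQ; rewrite inE => /orP[/eqP e|bQ]; last exact: Qadj bQ cpp bc.
  by have := zp c cpp; rewrite -e bc.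
have sza : sees G [set b in z :: u :: W] a.
  by apply: (seesI (u := z)); rewrite ?inE ?eqxx.
case/orP: fl => [/eqP efl|Gfl].
  subst l; have [e1 e2] : f1 = l1 /\ f2 = l2.
    by apply: (@uniq_split _ _ _ _ _ f); rewrite -ef //; apply: (ipath_uniq ip').
  move: (ip); rewrite el rcons_cat rcons_cons -cat_cons => ipx.
  have [//||[c1 fn1 s1f] [c2 fn2 s2f] a12] := ipath_split ipx _ _; first by case: (l2).
  apply: (no_theta tG (x := a) (y := f) _ _ (C1 := [set b in x :: l1])
    (C2 := [set b in rcons l2 y]) (C3 := [set b in z :: u :: W])).
  - by apply: contraNneq ap => ->.
  - exact: adjp.
  - split=> //; rewrite ?inE //; last by apply: (seesI (u := x)); rewrite ?inE ?eqxx.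
    rewrite negb_or; apply/andP; split; first by apply: contraTneq ax => ->; rewrite adj_irr.
    by apply: contra ap => al; rewrite el mem_cat al.
  - split=> //; rewrite ?inE //; last first.
      by apply: (seesI (u := y)); rewrite ?inE ?mem_rcons ?mem_head.
    rewrite mem_rcons inE negb_or; apply/andP; split.
      by apply: contraTneq ay => ->; rewrite adj_irr.
    by apply: contra ap => al; rewrite el mem_cat inE al !orbT.
  - split=> //.
    + by rewrite in_set in_cons negb_or Qa andbT; apply: contraTneq az => ->; rewrite adj_irr.
    + rewrite inE; apply/negP=> /zQ; by rewrite inE mem_rcons inE fp !orbT.
    + by apply: (seesI (u := w)); [rewrite in_set in_cons wQ orbT|rewrite adj_sym].
  - exact: a12.
  - apply: antiC => b c; rewrite [b \in _]inE [c \in _]inE => bQ cl.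
    have cp : c \in x :: rcons p y.
      by move: cl; rewrite inE inE mem_rcons inE el mem_cat => /orP[]->; rewrite ?orbT.
    split; last by apply: contraNneq (zQ b bQ) => ->.
    apply/negP=> bc; have [ebw cpp] := zQadj b c bQ cp bc; subst b.
    have [nf1 _] := wnb c cpp bc; move: cl; rewrite -e1 inE (negbTE nf1) orbF => /eqP ecx.
    by rewrite adj_sym ecx (negbTE (Qx w wQ)) in bc.
  - apply: antiC => b c; rewrite [b \in _]inE [c \in _]inE => bQ cl.
    have cp : c \in x :: rcons p y.
      move: cl; rewrite mem_rcons inE inE mem_rcons inE el mem_cat.
      by case/orP=> [->|h]; rewrite ?orbT // inE h !orbT.
    split; last by apply: contraNneq (zQ b bQ) => ->.
    apply/negP=> bc; have [ebw cpp] := zQadj b c bQ cp bc; subst b.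
    have [_ nf1] := wnb c cpp bc; move: cl; rewrite mem_rcons inE (negbTE nf1) orbF => /eqP ecx.
    by rewrite adj_sym ecx (negbTE (Qy w wQ)) in bc.
have up := ipath_uniq ip'.
have lf2 : l \in f2.
  have [nl1 _] := wnb l lp wl; move: lp; rewrite ef mem_cat inE.
  rewrite (negbTE nl1) /= => /orP[/eqP elf|//].
  by rewrite elf adj_irr in Gfl.
have [f3 ef2] : exists f3, f2 = l :: f3.
  case: (f2) lf2 ef => // r f3; rewrite inE => /orP[/eqP->|lf3] ef; first by exists f3.
  have := @ipath_far _ G (rcons f1 f) r f3 f l; rewrite cat_rcons -ef Gfl mem_rcons mem_head.
  by move=> /(_ ip' isT lf3).
have [el1 el2] : rcons f1 f = l1 /\ f3 = l2.
  apply: (@uniq_split _ _ _ _ _ l); first by rewrite cat_rcons -ef2 -ef.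
  by rewrite cat_rcons -ef2 -ef.
subst f3; rewrite ef2 in ef.
move: (ip); rewrite ef rcons_cat rcons_cons rcons_cons -cat_cons => ipx.
apply: (no_pyramid tG (a := a) (b1 := f) (b2 := l) (b3 := w)
  (C1 := [set b in x :: rcons f1 f]) (C2 := [set b in rcons (l :: l2) y])
  (C3 := [set b in z :: u :: W])) => //.
- split; rewrite ?inE ?mem_rcons ?mem_head ?inE ?eqxx ?orbT //.
  + apply: conn_ipath; apply: (@ipath_catl _ _ _ (l :: rcons l2 y)).
    by rewrite -rcons_cons cat_rcons.
  + apply/norP; split; first by apply: contraTneq ax => ->; rewrite adj_irr.
    by move: ap; rewrite ef mem_cat inE !negb_or => /and3P[-> -> _].
  + by apply: (seesI (u := x)); rewrite ?inE ?eqxx.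
- split; rewrite ?inE ?mem_rcons ?mem_head ?inE ?eqxx ?orbT //.
  + apply: conn_ipath; apply: (@ipath_catr _ _ (rcons (x :: f1) f)).
    by rewrite cat_rcons.
  + rewrite !negb_or; apply/and3P; split; first by apply: contraNneq ap => ->.
      by apply: contraTneq ay => ->; rewrite adj_irr.
    by apply: contra ap => al; rewrite el mem_cat inE al !orbT.
  + by apply: (seesI (u := y)); rewrite // in_set mem_rcons mem_head.
- split=> //; rewrite in_set in_cons.
  + by rewrite negb_or Qa andbT; apply: contraTneq az => ->; rewrite adj_irr.
  + by rewrite wQ orbT.
- by rewrite adj_sym.
- by rewrite adj_sym.
- by rewrite wa.
- by rewrite (negbTE (adjp f fp)).
- move=> b c; rewrite [b \in _]inE [c \in _]inE => bC cC'.
  by apply: (ipath_cross ipx).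
- move=> b c; rewrite [b \in _]inE [c \in _]inE => bC cQ.
  have bp : b \in x :: rcons p y.
    move: bC; rewrite ef inE mem_rcons inE inE mem_rcons inE mem_cat inE.
    by case/or3P=> ->; rewrite ?orbT.
  split; first by apply: contraNneq (zQ c cQ) => <-.
  rewrite adj_sym => bc; have [ecw bpp] := zQadj c b cQ bp bc; split=> //; subst c.
  have [nf1 _] := wnb b bpp bc; move: bC; rewrite inE mem_rcons inE (negbTE nf1) orbF.
  case/orP=> /eqP // ebx.
  by rewrite adj_sym ebx (negbTE (Qx w wQ)) in bc.
- move=> b c; rewrite [b \in _]inE [c \in _]inE => bC cQ.
  have bp : b \in x :: rcons p y.
    move: bC; rewrite el mem_rcons inE inE inE mem_rcons inE mem_cat inE.
    by case/or3P=> ->; rewrite ?orbT.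
  split; first by apply: contraNneq (zQ c cQ) => <-.
  rewrite adj_sym => bc; have [ecw bpp] := zQadj c b cQ bp bc; split=> //; subst c.
  have [_ nf1] := wnb b bpp bc; move: bC; rewrite mem_rcons inE inE (negbTE nf1) orbF.
  case/orP=> /eqP // ebx.
  by rewrite adj_sym ebx (negbTE (Qy w wQ)) in bc.
Qed.

End TameLocal.

Section PrefixSplit.
Variables (V : finType) (G : sgraph V).

Lemma first_split_prefix (T : eqType) (a : pred T) (s s1 s2 t1 t2 : seq T) w w' :
  uniq s -> s = s1 ++ w :: s2 -> s = t1 ++ w' :: t2 -> a w' -> ~~ has a (rcons s1 w) ->
  exists r, t1 = rcons s1 w ++ r.
Proof.
move=> un e e' aw nh.
have : w' \in rcons s1 w ++ s2 by rewrite cat_rcons -e e' mem_cat mem_head orbT.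
rewrite mem_cat => /orP[h|]; first by case/hasP: nh; exists w'.
move=> h; case/splitPr: h e => r1 r2 e; exists r1.
have e2 : (rcons s1 w ++ r1) ++ w' :: r2 = t1 ++ w' :: t2 by rewrite -catA cat_rcons -e.
by case: (uniq_split _ e2) => //; rewrite e2 -e'.
Qed.

Lemma ipath_inner x q y : ipath G (x :: rcons q y) -> q != [::] ->
  [/\ conn G [set z in q], x \notin q, y \notin q,
      sees G [set z in q] x & sees G [set z in q] y].
Proof.
move=> ip qn; have ipq : ipath G (rcons q y) := ipath_behead ip.
have := ipath_uniq ip; rewrite cons_uniq rcons_uniq mem_rcons inE negb_or.
case/and3P=> /andP[_ xq] yq _; split=> //.
- by apply: conn_ipath; apply: (@ipath_catl _ _ _ [:: y]); rewrite cats1.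
- case: q qn ip {ipq xq yq} => // u q _ /and4P[xu _ _ _].
  by apply: (seesI (u := u)); rewrite ?in_set ?mem_head.
- case/lastP: q qn ipq {ip xq yq} => // q u _; rewrite -cats1 cat_rcons => /ipath_next uy.
  by apply: (seesI (u := u)); rewrite ?in_set ?mem_rcons ?mem_head // adj_sym.
Qed.

End PrefixSplit.

(** * Attachments and cuts *)

Section Criterion.
Variables (V : finType) (G : sgraph V).
Implicit Types (a u v w x y z : V).

Definition far a : {set V} := [set u | (u != a) && ~~ G a u].
(* Meant for [v] in [far a]; otherwise it is the singleton of [v]. *)
Definition component a v : {set V} := [set u | connect (rst G (far a)) v u].
(** The guard [u \in far a] makes this false when [v] is not in [far a], where [component a v] is
    only a singleton. *)
Definition att a v y := G a y && [exists u, [&& G y u, u \in far a & u \in component a v]].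
Definition outside a v : {set V} := [set u | (u != a) && (u \notin component a v)].

Lemma comp_refl a v : v \in component a v.
Proof. by rewrite inE. Qed.

Lemma comp_sym a u v : (u \in component a v) = (v \in component a u).
Proof. by rewrite !inE connect_rst_sym. Qed.

Lemma comp_eq a u v : u \in component a v -> component a u = component a v.
Proof.
rewrite inE => uv; apply/setP=> w; rewrite !inE.
by rewrite (same_connect (connect_rst_sym G (far a)) uv).
Qed.

Lemma comp_far a u v : u \in far a -> v \in component a u -> v \in far a.
Proof.
move=> uf; rewrite inE => /connectP[p pp ->].
have [_ sp] := rst_path pp.
by have := mem_last u p; rewrite inE => /orP[/eqP->|/sp].
Qed.

Lemma comp_step a v u w : u \in far a -> u \in component a v -> w \in far a -> G u w -> w \in component a v.
Proof.
move=> uf; rewrite !inE => uv wf uw; apply: connect_trans uv (connect1 _).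
by move: uf wf; rewrite /rst inE !inE uw => -> ->.
Qed.

Lemma conn_comp a v : conn G (component a v).
Proof. exact: connect_conn. Qed.

Lemma attP a v y : reflect [/\ G a y, v \in far a & exists2 u, u \in component a v & G y u] (att a v y).
Proof.
apply: (iffP andP) => [[ay /existsP[u /and3P[yu uf uc]]]|[ay vf [u uc yu]]].
  split=> //; last by exists u.
  by apply: (comp_far uf); rewrite comp_sym.
split=> //; apply/existsP; exists u; rewrite yu uc (comp_far vf) //.
Qed.

Lemma att_comp a u v y : u \in component a v -> att a u y = att a v y.
Proof. by move=> uv; rewrite /att (comp_eq uv). Qed.

Lemma att_sees a v y : att a v y -> sees G (component a v) y.
Proof. by case/attP=> _ _ [u uc yu]; apply: seesI uc yu. Qed.

Lemma far_adj a u : u \in far a -> ~~ G a u.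
Proof. by rewrite inE => /andP[]. Qed.

Lemma far_self a : a \notin far a.
Proof. by rewrite inE eqxx. Qed.

Lemma far_sym a u : (u \in far a) = (a \in far u).
Proof. by rewrite !inE eq_sym adj_sym. Qed.

Lemma att_notin a v x : att a v x -> x \notin component a v.
Proof.
case/attP=> ax vf _; apply/negP=> /(comp_far vf)/far_adj.
by rewrite ax.
Qed.

Lemma comp_self a v : v \in far a -> a \notin component a v.
Proof. by move=> vf; apply/negP => /(comp_far vf); rewrite (negbTE (far_self a)). Qed.

Lemma comp_conn a v C u w : conn G C -> C \subset far a -> u \in C -> w \in C ->
  u \in component a v -> w \in component a v.
Proof.
move=> cC sC uC wC; rewrite !inE => uv; apply: connect_trans uv _.
exact: connect_rstS sC (cC u w uC wC).
Qed.

Definition claw_attached a v x y z :=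
  [&& att a v x, att a v y, att a v z & stable3 G x y z].

Definition bypass a v x y :=
  [&& att a v x, att a v y, x != y, ~~ G x y & connect (rst G (outside a v)) x y].

Section Clean.
Hypothesis nocl : forall a v x y z, ~~ claw_attached a v x y z.
Hypothesis nobp : forall a v x y, ~~ bypass a v x y.

(** If [x] and [z] were nonadjacent, [y] itself would be a bypass between them. This lemma and the
    next give the two cliques; they start from the tested conditions and not from [tame], because
    both directions of the equivalence need them. *)
Lemma att_trans_of a v x y z : att a v x -> att a v y -> att a v z ->
  G x y -> G y z -> x != z -> G x z.
Proof.
move=> hx hy hz xy yz nxz; apply: contraT => xz.
have := nobp a v x z; rewrite /bypass hx hz nxz xz /=.
have out w : att a v w -> w \in outside a v.
  move=> h; rewrite inE (att_notin h) andbT; case/attP: h => aw _ _.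
  by apply: contraTneq aw => ->; rewrite adj_irr.
move=> /negP[]; apply: (@connect_trans _ _ y); apply: connect1;
by rewrite /rst !out ?xy ?yz.
Qed.

Lemma att_two_of a v x y z : att a v x -> att a v y -> att a v z ->
  x != y -> ~~ G x y -> (z == x) || (z == y) || G z x || G z y.
Proof.
move=> hx hy hz nxy xy; have := nocl a v x y z.
rewrite /claw_attached hx hy hz /stable3 nxy xy /= ![_ == z]eq_sym ![G _ z]adj_sym.
by rewrite !negb_and !negbK !orbA.
Qed.

End Clean.

Section Tame.
Hypothesis tG : tame G.

Lemma no_claw_attached a v x y z : ~~ claw_attached a v x y z.
Proof.
apply/negP=> /and4P[hx hy hz st].
have [[ax vf _] [ay _ _] [az _ _]] := And3 (attP _ _ _ hx) (attP _ _ _ hy) (attP _ _ _ hz).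
apply: (no_claw tG (@conn_comp a v) (comp_self vf) _ ax ay az st) => //; try exact: att_sees.
by move=> u /(comp_far vf)/far_adj.
Qed.

(** Induction on the length of an induced path in [outside a v]. If no inner node is attached, the
    inner nodes do not see the component, and [no_crossing] applies with [a] as common neighbour. An
    attached inner node [w] that is nonadjacent to an end gives a shorter path; adjacent to both
    ends, it becomes the common neighbour, and the singleton of [a] the second connected set. *)
Lemma no_bypass a v x y : ~~ bypass a v x y.
Proof.
apply/negP=> /and5P[hx hy nxy xy /connectP[p pp lp]].
have [pG sp] := rst_path pp.
have [q [ipq lq sq]] := ipath_of_path (adj_irr G) pG.
have vf : v \in far a by case/attP: hx.
have attO w : att a v w -> w \in outside a v.
  move=> h; rewrite inE (att_notin h) andbT; case/attP: h => aw _ _.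
  by apply: contraTneq aw => ->; rewrite adj_irr.
have subO : {subset x :: q <= outside a v}.
  by move=> w; rewrite inE => /orP[/eqP->|/sq/sp//]; apply: attO.
have {lq lp} lq : last x q = y by rewrite lq.
move: {2}(size q) (leqnn (size q)) => n.
elim: n => [|n IH] in x y q hx hy nxy xy ipq lq subO {p pp pG sp sq} *.
  by rewrite leqn0 size_eq0 => /eqP q0; move: lq nxy; rewrite q0 /= => ->; rewrite eqxx.
case/lastP: q lq ipq subO => [/= exy|q y']; first by rewrite exy eqxx in nxy.
rewrite last_rcons => -> ipq subO; rewrite size_rcons ltnS => sz.
have notC w : w \in q -> w \notin component a v.
  move=> wq; have : w \in outside a v by apply: subO; rewrite inE mem_rcons inE wq !orbT.
  by rewrite inE => /andP[].
have nota w : w \in q -> w != a.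
  move=> wq; have : w \in outside a v by apply: subO; rewrite inE mem_rcons inE wq !orbT.
  by rewrite inE => /andP[].
have notx w : att a v w -> (w != a).
  by case/attP=> aw _ _; apply: contraTneq aw => ->; rewrite adj_irr.
case: (boolP (has (att a v) q)) => [/hasP[w wq hw]|nh]; last first.
  have qn : q != [::].
    by apply: contraNneq xy => q0; move: (ipath_path ipq); rewrite q0 /= andbT.
  have [cq xq yq sqx sqy] := ipath_inner ipq qn.
  apply: (no_crossing tG nxy xy _ _ (a := a) (C := component a v) (D := [set z in q])).
  - by case/attP: hx.
  - by case/attP: hy.
  - by split; [exact: conn_comp|exact: att_notin|exact: att_notin|exact: att_sees|exact: att_sees].
  - by split; rewrite ?in_set.
  - move=> u w uC; rewrite in_set => wq; split; last by apply: contraTneq uC => ->; apply: notC.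
    apply/negP=> uw; case/hasP: nh; exists w => //; apply/attP; split=> //; last first.
      by exists u; rewrite // adj_sym.
    apply: contraT => aw; case/negP: (notC w wq); apply: (comp_step (comp_far vf uC) uC) => //.
    by rewrite inE nota.
  - exact: comp_self.
  - by rewrite in_set; apply/negP=> /nota; rewrite eqxx.
have ne u u' (p1 p2 : seq V) : ipath G (u :: rcons p1 u' ++ p2) -> u != u'.
  by move/ipath_uniq => /andP[]; rewrite mem_cat mem_rcons inE !negb_or => /andP[/andP[]].
case/splitPr: wq ipq subO sz notC nota => q1 q2 ipq subO sz notC nota.
have ip1 : ipath G (x :: rcons q1 w).
  by move: ipq; rewrite rcons_cat rcons_cons -cat_rcons -cat_cons => /ipath_catl.
have ip2 : ipath G (w :: rcons q2 y).
  by move: ipq; rewrite rcons_cat rcons_cons -cat_cons => /ipath_catr.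
have nxw : x != w by apply: (ne _ _ q1 [::]); rewrite cats0.
have nwy : w != y by apply: (ne _ _ q2 [::]); rewrite cats0.
have [xw|xw] := boolP (G x w); last first.
  apply: (IH x w (rcons q1 w)) => //; first by rewrite last_rcons.
  - move=> z; rewrite inE mem_rcons inE => zs; apply: subO.
    by rewrite inE mem_rcons inE mem_cat inE; case/or3P: zs => ->; rewrite ?orbT.
  - by rewrite size_rcons; move: sz; rewrite size_cat /= addnS => /(leq_trans _); apply; rewrite ltnS leq_addr.
have [wy|wy] := boolP (G w y); last first.
  apply: (IH w y (rcons q2 y)) => //; first by rewrite last_rcons.
  - move=> z; rewrite inE mem_rcons inE => zs; apply: subO.
    by rewrite inE mem_rcons inE mem_cat inE; case/or3P: zs => ->; rewrite ?orbT.
  - by rewrite size_rcons; move: sz; rewrite size_cat /= addnS => /(leq_trans _); apply; rewrite ltnS leq_addl.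
have aC := comp_self vf.
apply: (no_crossing tG nxy xy _ _ (a := w) (C := component a v) (D := [set a])).
- by rewrite adj_sym.
- by [].
- by split; [exact: conn_comp|exact: att_notin|exact: att_notin|exact: att_sees|exact: att_sees].
- split; rewrite ?in_set1 ?notx //; first exact: conn1.
    by apply: (seesI (u := a)); rewrite ?in_set1 // adj_sym; case/attP: hx.
  by apply: (seesI (u := a)); rewrite ?in_set1 // adj_sym; case/attP: hy.
- move=> u w' uC; rewrite in_set1 => /eqP->; split; last by apply: contraTneq uC => ->.
  by rewrite adj_sym; apply: far_adj; apply: comp_far uC.
- by apply: notC; rewrite mem_cat mem_head orbT.
- by rewrite in_set1 nota // mem_cat mem_head orbT.
Qed.

Definition att_trans := att_trans_of no_bypass.
Definition att_two := att_two_of no_claw_attached.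

Lemma common_attach_aux c z b L y y' s1 w s2 : ipath G (b :: L) -> {subset L <= component c z} ->
  att c z b -> att c z y -> att c z y' -> y != y' -> b != y -> b != y' ->
  ~~ G b y -> ~~ G b y' -> b :: L = s1 ++ w :: s2 -> G y w -> ~~ has (G y) s1 ->
  has (G y') (rcons s1 w) -> False.
Proof.
move=> ip sub hb hy hy' nyy nby nby' by_ by'_ e yw nh.
case: s1 e nh => [|b' s1] [eb eL] nh; first by rewrite -eb adj_sym (negbTE by_) in yw.
subst b'; rewrite rcons_cons /= adj_sym (negbTE by'_) /= => /hasP[v vs y'v].
have sub' : {subset rcons s1 w <= component c z}.
  by move=> u us; apply: sub; rewrite eL -cat_rcons mem_cat us.
have cf : z \in far c by case/attP: hb.
have nyC : y \notin component c z by apply: att_notin.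
apply: (fan_attach tG (a := c) (x := b) (p := rcons s1 w) (y := y) (z := y') (w := v)) => //.
- rewrite -rcons_cons; apply: (ipath_rcons (x := b)).
  + by apply: (@ipath_catl _ _ _ s2); rewrite cat_cons cat_rcons -eL.
  + by rewrite last_rcons adj_sym.
  + by rewrite inE eq_sym negb_or nby; apply: contra nyC => /sub'.
  + move=> u; rewrite inE mem_rcons inE last_rcons => /or3P[/eqP->|/eqP->//|us] uy.
      by rewrite uy in by_.
    by case/negP: nh; rewrite /= ; apply/orP; right; apply/hasP; exists u; rewrite // adj_sym.
- by apply/negP=> /sub'; apply/negP; apply: comp_self.
- by move=> u /sub'/(comp_far cf)/far_adj.
- by case/attP: hb.
- by case/attP: hy.
- by case/attP: hy'.
Qed.

(** Walk from [b] through the component to [x], which both [y] and [y'] see. The one met later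
    closes a hole with [b] and [c]; the other sees [c] and an inner node of the walk, as in
    [fan_attach]. *)
Lemma no_common_attach c z b x y y' : att c z b -> att c z y -> att c z y' ->
  G y y' -> b != y -> ~~ G b y -> x \in component c z -> G x y -> ~~ G x y'.
Proof.
move=> hb hy hy' yy' nby by_ xC xy; apply/negP=> xy'.
have nyy : y != y' by apply: contraTneq yy' => ->; rewrite adj_irr.
have nby' : b != y' by apply: contraNneq by_ => ->; rewrite adj_sym.
have by'_ : ~~ G b y'.
  by apply: contra by_ => h; apply: (att_trans hb hy' hy) => //; rewrite adj_sym.
have [u [t [ip sub lt bu bo]]] := link_to (@conn_comp c z) (att_sees hb) xC.
have ipb : ipath G (b :: u :: t).
  by apply: ipath_cons => //; apply: contra (att_notin hb) => /sub.
have hasx v : G x v -> has (G v) (b :: u :: t).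
  move=> xv; apply/hasP; exists x; last by rewrite adj_sym.
  by rewrite -lt inE mem_last orbT.
have [s1 [w [s2 [e yw nh]]]] := split_first (hasx y xy).
have aux := common_attach_aux ipb sub hb hy hy' nyy nby nby' by_ by'_ e yw nh.
case: (boolP (has (G y') (rcons s1 w))) => // nh1.
have [t1 [w' [t2 [e' yw' nh']]]] := split_first (hasx y' xy').
apply: (common_attach_aux ipb sub hb hy' hy _ nby' nby by'_ by_ e' yw' nh').
  by rewrite eq_sym.
have [r er] := first_split_prefix (ipath_uniq ipb) e e' yw' nh1.
by rewrite er has_rcons has_cat has_rcons yw !orbT.
Qed.

End Tame.
End Criterion.

Section InducedPathSees.
Variables (V : finType) (G : sgraph V).

Lemma ipath_sees s v : ipath G s -> 1 < size s -> v \in s -> sees G [set w in s] v.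
Proof.
move=> ip sz vs; case/splitPr: vs ip sz => r1 [|r r2] ip sz.
  case/lastP: r1 sz ip => // r1 r _; rewrite cat_rcons => /ipath_next rv.
  apply: (seesI (u := r)); last by rewrite adj_sym.
  by rewrite in_set mem_cat !inE eqxx !orbT.
apply: (seesI (u := r)); last exact: ipath_next ip.
by rewrite in_set mem_cat !inE eqxx !orbT.
Qed.

Lemma hole_ends x h1 R h2 : hole G (x :: h1 :: rcons R h2) -> R != [::] ->
  h1 != h2 /\ ~~ G h1 h2.
Proof.
move=> hh Rn; have [ip _ _ _ _] := hole_consP hh; split.
  by have := ipath_uniq ip => /andP[+ _]; rewrite mem_rcons inE negb_or => /andP[].
case: (R) Rn ip => // r R' _ ip; apply: (@ipath_far _ G [:: h1] r (rcons R' h2)) => //.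
  by rewrite mem_head.
by rewrite mem_rcons mem_head.
Qed.

End InducedPathSees.

(** * Good cuts and their existence *)

Section Cuts.
Variables (V : finType) (G : sgraph V).
Implicit Types (c u v w x y z : V) (W : {set V}).

(* The neighbours of [x] attached to the component of [c] form at most two
   cliques; [g] is any one of them and [b] tells whether to take its clique. *)
Definition cutset g x c (b : bool) : {set V} :=
  x |: [set u | att G x c u && (((u == g) || G g u) == b)].

Definition region c x W : {set V} := [set u | (u \in component G c x) || att G c x u] :\: W.

Definition crossed c x W y y' :=
  [&& att G c x y, att G c x y', y \notin W, y' \notin W,
      ~~ ((y == y') || G y y') & connect (rst G (region c x W)) y y'].

Definition separates c x W := ~~ [exists y, exists y', crossed c x W y y'].

Definition admissible c x :=
  ~~ [exists y, exists y', [&& att G c x y, att G c x y', G y y', G x y & G x y']].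

Definition needs_cut c z :=
  [exists s, exists t, [&& att G c z s, att G c z t & ~~ ((s == t) || G s t)]].

Definition good_cut (g : V -> V -> V) c x :=
  admissible c x && (separates c x (cutset (g c x) x c true) ||
                     separates c x (cutset (g c x) x c false)).

(** [g] is left arbitrary because the program records whichever attached node it happens to write
    last. *)
Definition witness (g : V -> V -> V) := forall c x u, att G x c u -> att G x c (g c x).

Section Existence.
Hypothesis tG : tame G.
Variables (g : V -> V -> V) (c z s t : V).
Hypotheses (gP : witness g) (hs : att G c z s) (ht : att G c z t).
Hypotheses (nst : s != t) (st : ~~ G s t).

Local Notation K := (component G c z).
Local Notation S := (att G c z).
(** [A] is the clique of [s] among the attached nodes, [B] the other clique, which contains [t]. *)
Let A : {set V} := [set u | S u && ((u == s) || G s u)].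
Let B : {set V} := [set u | S u && ~~ ((u == s) || G s u)].

Let zf : z \in far G c. Proof. by case/attP: hs. Qed.
Let Kf u : u \in K -> u \in far G c. Proof. exact: comp_far. Qed.

Let SAB u : S u -> (u \in A) || (u \in B).
Proof. by rewrite !inE => ->; rewrite orbN. Qed.

Let AS u : u \in A -> S u. Proof. by rewrite inE => /andP[]. Qed.
Let BS u : u \in B -> S u. Proof. by rewrite inE => /andP[]. Qed.
Let sA : s \in A. Proof. by rewrite inE hs eqxx. Qed.
Let tB : t \in B. Proof. by rewrite inE ht negb_or eq_sym nst. Qed.

Let Acl u v : u \in A -> v \in A -> (u == v) || G u v.
Proof.
rewrite !inE => /andP[hu su] /andP[hv sv]; case: eqVneq => //= nuv.
case/orP: su => [/eqP us|su]; case/orP: sv => [/eqP vs|sv].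
- by rewrite us vs eqxx in nuv.
- by rewrite us.
- by rewrite vs adj_sym.
- by apply: (att_trans tG hu hs hv) => //; rewrite adj_sym.
Qed.

Let AB u v : u \in A -> v \in B -> ~~ G u v /\ u != v.
Proof.
move=> uA vB; split; last first.
  by apply: contraTneq uA => ->; move: vB; rewrite !inE => /andP[-> /negbTE->].
apply/negP=> uv; move: vB uA; rewrite !inE => /andP[hv nv] /andP[hu su].
case/norP: nv => nvs /negP[]; case/orP: su => [/eqP <-//|su].
by apply: (att_trans tG hs hu hv) => //; rewrite eq_sym.
Qed.

Let Bcl u v : u \in B -> v \in B -> (u == v) || G u v.
Proof.
rewrite !inE => /andP[hu nu] /andP[hv nv]; apply: contraT; rewrite negb_or => /andP[nuv uv].
have := att_two tG hu hv hs nuv uv; rewrite ![s == _]eq_sym.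
by move: nu nv; rewrite !negb_or => /andP[/negbTE-> /negbTE->] /andP[/negbTE-> /negbTE->].
Qed.

Let KA u : u \in K -> u \notin A.
Proof. by move=> uK; apply/negP=> /AS/att_notin; rewrite uK. Qed.
Let KB u : u \in K -> u \notin B.
Proof. by move=> uK; apply/negP=> /BS/att_notin; rewrite uK. Qed.
Let SK u : S u -> G c u. Proof. by case/attP. Qed.

(** Two adjacent attached nodes lie in the same clique, and [no_common_attach] applies to them with
    [s] or [t], whichever is in the other clique. *)
Lemma all_admissible x : x \in K -> admissible c x.
Proof.
move=> xK; apply/existsP=> -[y /existsP[y' /and5P[]]].
rewrite !(att_comp _ xK) => hy hy' yy' xy; apply/negP.
case/orP: (SAB hy) => [yA|yB].
  apply: (no_common_attach tG ht hy hy' yy') => //.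
    by have [_] := AB yA tB; rewrite eq_sym.
  by have [] := AB yA tB; rewrite adj_sym.
apply: (no_common_attach tG hs hy hy' yy') => //.
  by have [_] := AB sA yB.
by have [] := AB sA yB.
Qed.

Hypothesis nocut : forall x, x \in K -> ~~ good_cut g c x.

(** Admissibility being automatic, both cuts at [x] fail to separate; the nonadjacent ends of a
    crossing lie one in each clique. *)
Lemma crossed_path x b : x \in K -> exists al be,
  [/\ al \in A, be \in B, al \notin cutset (g c x) x c b, be \notin cutset (g c x) x c b
    & connect (rst G (region c x (cutset (g c x) x c b))) be al].
Proof.
move=> xK; have := nocut xK; rewrite /good_cut all_admissible //= negb_or => /andP[n1 n2].
have : ~~ separates c x (cutset (g c x) x c b) by case: b.
rewrite negbK => /existsP[y /existsP[y' /and5P[]]].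
rewrite !(att_comp _ xK) => hy hy' nW nW' /andP[nyy cn].
case/orP: (SAB hy) => [yA|yB]; case/orP: (SAB hy') => [y'A|y'B].
- by rewrite Acl in nyy.
- by exists y, y'; split=> //; rewrite connect_rst_sym.
- by exists y', y.
- by rewrite Bcl in nyy.
Qed.

(* Starting point of a descent on [size Z]: when the cuts at [x] fail, the path of
   [crossed_path] reroutes [H] through the first node of [Z]. *)
Definition cut_hole (H : seq V) (x : V) (Z : seq V) : Prop :=
  [/\ hole G H, {subset H <= K :|: A},
      exists a a', [/\ a != a', a \in A, a' \in A, a \in H & a' \in H],
      x \in H /\ x \in K
    & [/\ path G x Z, {subset Z <= K :|: B}, Z != [::] & last x Z \in B]].

(** The edge between [s] and [s'] closes into a hole through [K], because no node of [K] sees both.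
    A path in [K] from that hole to a neighbour of [t], extended by [t], serves as [Z]. *)
Lemma cut_hole_exists s' : s' \in A -> s' != s -> exists H x Z, cut_hole H x Z.
Proof.
move=> s'A ns; have Gss : G s s'.
  by have := Acl sA s'A; rewrite eq_sym (negbTE ns).
have hs' := AS s'A.
have [||||||u [r [hh sub _ _]]] := @hole_of_link _ G s [:: s'] K _ _ (@conn_comp _ G c z).
- exact: ipath2.
- by [].
- move=> u v uK; rewrite !inE => vs; split.
    by apply: contraTneq uK => ->; case/orP: vs => /eqP->; apply: att_notin.
  by move=> _; case/orP: vs => /eqP->; [left|right].
- exact: att_sees.
- exact: att_sees.
- move=> _ u uK su; rewrite adj_sym.
  apply: (no_common_attach tG ht hs hs' Gss) => //; rewrite ?[t == s]eq_sym //.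
    by rewrite adj_sym.
  by rewrite adj_sym.
have uK : u \in K by apply: sub; rewrite mem_head.
have /seesP[w wK tw] := att_sees ht.
have /connectP[p pp lp] := @conn_comp _ G c z u w uK wK.
have [pG sp] := rst_path pp.
exists ([:: s; s'] ++ u :: r), u, (rcons p t); split=> //.
- move=> v; rewrite !inE => /or3P[/eqP->|/eqP->|vs].
  + by rewrite hs eqxx orbT.
  + by rewrite hs' Gss !orbT.
  + by have := sub v; rewrite inE vs inE => /(_ isT)->.
- exists s, s'; split=> //; first by rewrite eq_sym.
    by rewrite mem_head.
  by rewrite in_cons mem_head orbT.
- by split=> //; rewrite mem_cat mem_head orbT.
- split.
  + by rewrite rcons_path pG -lp adj_sym.
  + move=> v; rewrite mem_rcons inE => /orP[/eqP->|/sp vK]; first by rewrite in_setU tB orbT.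
    by rewrite in_setU vK.
  + by case: (p).
  + by rewrite last_rcons.
Qed.

Section Step.
Variables (n : nat).
Hypothesis IH : forall H x Z, size Z < n -> cut_hole H x Z -> False.

(** The cut at [x] with the clique of [h1] contains [z1], and it fails: following [Z'] and then the
    crossing path gives a connected set [D] from [z1] to a first node [u] that sees the part [R1] of
    the hole. Either the neighbours of [u] yield a forbidden configuration, or they are two
    consecutive nodes [k0] and [k1], and [D] divides the hole into two holes through [z1]. One of
    them has two nodes of [A], and [Z'] leads from it to [B]. *)
Lemma cut_hole_step x h1 R h2 z1 Z' :
  size (z1 :: Z') <= n ->
  cut_hole (x :: h1 :: rcons R h2) x (z1 :: Z') -> att G x c h1 -> att G x c h2 -> att G x c z1 ->
  G z1 h1 -> z1 \notin x :: h1 :: rcons R h2 -> (forall v, v \in Z' -> ~~ G x v /\ v != x) ->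
  False.
Proof.
move=> szn [hH subH [a1 [a2 [na a1A a2A a1H a2H]]] [_ xK] [pZ subZ _ lZ]] at1 at2 atz z1h1 z1H nZ.
have [ipH szH xh1 xh2 xo] := hole_consP hH.
rewrite /= last_rcons in xh1 xh2 xo.
have xf := Kf xK; have cx : c \in far G x by rewrite far_sym.
have cT : c \in component G x c := comp_refl _ _ _.
have Rn : R != [::] by case: (R) szH.
have := hole_uniq hH; rewrite !cons_uniq rcons_uniq in_cons !mem_rcons !in_cons !negb_or.
case/and3P=> /and3P[nx1 nx2 xR] /andP[n12 h1R] /andP[h2R uR].
have Rx v : v \in R -> ~~ G x v.
  move=> vR; apply/negP=> xv; have vs : v \in h1 :: rcons R h2 by rewrite inE mem_rcons inE vR !orbT.
  case: (xo v vs xv) => e; first by rewrite -e vR in h1R.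
  by rewrite -e vR in h2R.
have [_ h12] := hole_ends hH Rn.
pose R1 := rcons R h2.
have R1H v : v \in R1 -> v \in x :: h1 :: R1 by move=> vR; rewrite !inE vR !orbT.
(* [z1] sees [x] and [h1], so any further neighbour on the hole would have to equal or see each of
   them. *)
have z1R v : v \in R1 -> ~~ G z1 v.
  move=> vR; apply/negP=> z1v.
  have := hole_nbrs tG hH z1H _ (R1H v vR) z1h1 z1v.
  rewrite in_cons mem_head orbT => /(_ isT).
  have := hole_nbrs tG hH z1H _ (R1H v vR) _ z1v.
  move: vR; rewrite mem_rcons inE => /orP[/eqP->|vR].
    by rewrite (negbTE n12) (negbTE h12).
  move=> /(_ x (mem_head _ _)); case/attP: atz => xz1 _ _; rewrite adj_sym xz1 => /(_ isT).
  by rewrite (negbTE (Rx v vR)) orbF => /eqP e; rewrite e vR in xR.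
(* [b] selects the clique of [h1]. Closed adjacency is transitive on attached nodes, so the facts
   that follow can describe [W] through [h1] instead of [g c x]. *)
pose b := (h1 == g c x) || G (g c x) h1; pose W := cutset (g c x) x c b.
have gx : att G x c (g c x) by apply: (gP at1).
have eT u v w : att G x c u -> att G x c v -> att G x c w ->
    (v == u) || G u v -> (w == v) || G v w -> (w == u) || G u w.
  move=> hu hv hw /orP[/eqP->//|uv] /orP[/eqP->|vw]; first by rewrite uv orbT.
  case: eqVneq => //= nwu; apply: (att_trans tG hu hv hw) => //.
  by rewrite eq_sym.
have eC u v : ((u == v) || G v u) = ((v == u) || G u v) by rewrite eq_sym adj_sym.
have inW u : (u \in W) = (u == x) || (att G x c u && (((u == g c x) || G (g c x) u) == b)).
  by rewrite /W !inE.
have xW : x \in W by rewrite inW eqxx.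
have h1W : h1 \in W by rewrite inW at1 eqxx orbT.
have W_of u : att G x c u -> (u == h1) || G h1 u -> u \in W.
  move=> hu e; rewrite inW hu; apply/orP; right; rewrite /= /b.
  apply/eqP; apply/idP/idP => e'; first by apply: (eT _ u _ gx hu at1 e'); rewrite eC.
  exact: (eT _ h1 _ gx at1 hu e' e).
have z1W : z1 \in W by apply: W_of => //; rewrite adj_sym z1h1 orbT.
have W_h1 u : u \in W -> u != x -> att G x c u -> (u == h1) || G h1 u.
  rewrite inW => /orP[->//|/andP[_ /eqP eb]] _ hu; move: eb; rewrite /b.
  case: (boolP ((h1 == g c x) || G (g c x) h1)) => e1 e2.
    by apply: (eT _ (g c x) _ at1 gx hu) => //; rewrite eC.
  move/negbT: e2; rewrite negb_or => /andP[n1 n2].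
  move: e1; rewrite negb_or => /andP[n3 n4].
  apply: contraT; rewrite negb_or => /andP[n5 n6].
  have := att_two tG hu gx at1 n1; rewrite adj_sym n2 => /(_ isT).
  by rewrite eq_sym (negbTE n5) (negbTE n3) (negbTE n6) adj_sym (negbTE n4).
have notW u : att G x c u -> u \notin W -> ~~ G h1 u /\ ((u == h2) || G u h2).
  move=> hu uW; have : ~~ ((u == h1) || G h1 u) by apply: contra uW; exact: W_of.
  rewrite negb_or => /andP[n1 n2]; split=> //.
  have := att_two tG at1 at2 hu n12 h12.
  by rewrite (negbTE n1) [G u h1]adj_sym (negbTE n2) orbF /=.
have Watt u : u \in W -> u != x -> att G x c u.
  by rewrite inW => /orP[/eqP->|/andP[]//]; rewrite eqxx.
have R1W v : v \in R1 -> v \notin W.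
  move=> vR; apply/negP=> vW; have nvx : v != x.
    by move: vR; rewrite mem_rcons inE => /orP[/eqP->|]; [rewrite eq_sym|apply: contraTneq => ->].
  have hv := Watt v vW nvx; have := W_h1 v vW nvx hv.
  have /attP[xv _ _] := hv; move: vR; rewrite mem_rcons inE => /orP[/eqP->|/Rx].
    by rewrite eq_sym (negbTE n12) (negbTE h12).
  by rewrite xv.
(* Of the two nodes of [A] on the hole, none is [x] and at most one is [h1]. *)
have [a0 [a0A a0R]] : exists a0, a0 \in A /\ a0 \in R1.
  have xA : x \notin A := KA xK.
  move: a1H a2H; rewrite !inE => /or3P[/eqP e|/eqP e|h]; first by rewrite -e a1A in xA.
    move=> /or3P[/eqP e'|/eqP e'|h]; first by rewrite -e' a2A in xA.
      by rewrite e e' eqxx in na.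
    by exists a2.
  by exists a1.
have eK : component G c x = K by apply: comp_eq.
have inF u : (u \in region c x W) = (u \notin W) && ((u \in K) || S u).
  by rewrite in_setD in_set eK (att_comp _ xK).
have [al [be [alA beB alW beW cn]]] := crossed_path b xK.
rewrite -/W in alW beW cn.
have a0F : a0 \in region c x W by rewrite inF R1W // (AS a0A) orbT.
have {cn} : connect (rst G (region c x W)) be a0.
  apply: connect_trans cn _; have := Acl alA a0A => /orP[/eqP->//|ala0].
  by apply: connect1; rewrite /rst a0F inF alW (AS alA) orbT ala0.
case/connectP=> p pp la0; have [pG pF] := rst_path pp.
have beF : be \in region c x W by rewrite inF beW (BS beB) orbT.
have pn : p != [::].
  by apply/negP=> /eqP e; move: la0; rewrite e /= => e'; case: (AB a0A beB); rewrite e' eqxx.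
have a0p : a0 \in p by rewrite la0; case: (p) pn => //= r p' _; exact: mem_last.
have ZF v : v \in Z' -> v \in region c x W.
  move=> vZ; have [nxv nvx] := nZ v vZ; rewrite inF; apply/andP; split.
    by apply/negP=> /Watt/(_ nvx)/attP[]; rewrite (negbTE nxv).
  have := subZ v; rewrite inE vZ orbT => /(_ isT); rewrite in_setU => /orP[->//|/BS->].
  by rewrite orbT.
have Zfar v : v \in Z' -> v \in far G x by move=> /nZ[n1 n2]; rewrite inE n1 n2.
have ZT : Z' != [::] -> {subset Z' <= component G x c}.
  move=> Zn v vZ; have lZ' : last z1 Z' \in Z' by case: (Z') Zn => //= r q _; exact: mem_last.
  have cZ : conn G [set w in Z'].
    case: (Z') Zn pZ => // r q _ /andP[_ /andP[_]]; exact: conn_path.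
  apply: (comp_conn (u := last z1 Z') cZ).
  - by apply/subsetP=> w; rewrite in_set => /Zfar.
  - by rewrite in_set.
  - by rewrite in_set.
  rewrite /= in lZ; apply: (comp_step (u := c)) => //; first exact: Zfar.
  by apply: SK; apply: BS.
(* [Y] follows [Z'] up to [B], crosses the clique [B] to [be], then takes the crossing path to [a0].
   The last clause relates its first node to the component of [c] in the far side of [x]. *)
have [Y [pY YF a0Y hdY]] : exists Y, [/\ path G z1 Y, {subset Y <= region c x W}, a0 \in Y
    & forall y Y', Y = y :: Y' -> if G x y then att G x c y else y \in component G x c].
  case: (eqVneq Z' [::]) => [Z0|Zn].
    exists (be :: p); split.
    - rewrite Z0 /= in lZ; have := Bcl lZ beB; rewrite /= pG andbT => /orP[/eqP e|->//].
      by rewrite -e z1W in beW.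
    - by move=> v; rewrite inE => /orP[/eqP->|/pF].
    - by rewrite inE a0p orbT.
    - move=> y Y' [<- _]; have cb := SK (BS beB).
      have nbx : be != x by apply: contraNneq beW => ->.
      case: ifPn => xb; last by apply: (comp_step (u := c)) => //; rewrite inE nbx.
      by apply/attP; split=> //; exists c; rewrite // adj_sym.
  have hd q y Y' : Z' ++ q = y :: Y' -> if G x y then att G x c y else y \in component G x c.
    move=> e; have yZ : y \in Z' by case: (Z') Zn e => // r r' _ [-> _]; rewrite mem_head.
    by rewrite (negbTE (nZ y yZ).1) ZT.
  have pZ' : path G z1 Z' by case/andP: pZ.
  rewrite /= in lZ.
  case: (eqVneq (last z1 Z') be) => [e|ne].
    exists (Z' ++ p); split; last exact: hd.
    - by rewrite cat_path pZ' e.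
    - by move=> v; rewrite mem_cat => /orP[/ZF|/pF].
    - by rewrite mem_cat a0p orbT.
  exists (Z' ++ be :: p); split; last exact: hd.
  - by rewrite cat_path pZ' /= pG andbT; have := Bcl lZ beB; rewrite (negbTE ne).
  - by move=> v; rewrite mem_cat inE => /or3P[/ZF|/eqP->|/pF].
  - by rewrite mem_cat inE a0p !orbT.
have ipR1 : ipath G R1 := ipath_behead ipH.
have seesR1 v : v \in R1 -> sees G [set w in R1] v.
  by move=> vR; apply: ipath_sees.
have Yne v : v \in Y -> v != x /\ v != h1.
  move=> /YF; rewrite inF => /andP[vW _].
  by split; apply: contraNneq vW => ->.
have /split_first [Y1 [u [Y2 [eY uR1 nY1]]]] : has (sees G [set w in R1]) Y.
  by apply/hasP; exists a0 => //; apply: seesR1.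
have Y1s v : v \in Y1 -> ~~ sees G [set w in R1] v.
  by move=> vY; apply: contra nY1 => h; apply/hasP; exists v.
have Y1n v w : v \in Y1 -> w \in R1 -> ~~ G v w.
  by move=> vY wR; apply: contra (Y1s v vY) => vw; apply: seesI vw; rewrite in_set.
have Y1nR v : v \in Y1 -> v \notin R1.
  by move=> /Y1s; apply: contra => /seesR1.
have pYu : path G z1 (rcons Y1 u).
  by move: pY; rewrite eY -cat_rcons cat_path => /andP[].
have uR1' : u \notin R1.
  apply/negP=> uR1'; case/lastP: Y1 pYu Y1n {eY Y1s Y1nR nY1} => [|q v] pYu Y1n.
    by move: pYu; rewrite /= andbT (negbTE (z1R u uR1')).
  move: pYu; rewrite rcons_path last_rcons => /andP[_ vu].
  by have := Y1n v u; rewrite mem_rcons mem_head vu => /(_ isT uR1').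
have subY : {subset rcons Y1 u <= Y} by move=> v vs; rewrite eY -cat_rcons mem_cat vs.
have DH v : v \in z1 :: rcons Y1 u -> v \notin x :: h1 :: R1.
  rewrite inE => /orP[/eqP->//|vY]; have [n1 n2] := Yne v (subY v vY).
  rewrite !inE (negbTE n1) (negbTE n2) /=; move: vY; rewrite mem_rcons inE.
  by case/orP=> [/eqP->|/Y1nR].
(* Before its first neighbour of [x], the walk stays in the component of [c]; hence this neighbour
   is attached to it. Being outside [W], it is not in the clique of [h1], so it is adjacent to
   [h2]. *)
have att_of q1 v q2 : rcons Y1 u = q1 ++ v :: q2 -> ~~ has (G x) q1 -> G x v -> att G x c v.
  move=> e nh xv; have eY' : Y = q1 ++ v :: (q2 ++ Y2) by rewrite eY -cat_rcons e -catA.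
  case: q1 => [|y0 q1] in e nh eY'.
    by have := hdY v _ eY'; rewrite xv.
  have := hdY y0 _ eY'; have [/negbTE-> _] := norP nh => y0T.
  have pq : path G y0 (q1 ++ v :: (q2 ++ Y2)) by move: pY; rewrite eY' => /andP[].
  move: pq; rewrite cat_path => /and3P[pq lv _]; apply/attP; split=> //.
  exists (last y0 q1); last by rewrite adj_sym.
  apply: (comp_conn (u := y0) (conn_path pq)) => //; rewrite ?in_set ?mem_head ?mem_last //.
  apply/subsetP=> w; rewrite in_set => wq.
  have [nwx _] : w != x /\ w != h1 by apply: Yne; rewrite eY' -cat_cons mem_cat wq.
  rewrite inE nwx /=; apply: contra nh => xw; apply/hasP; by exists w.
have attW q1 v q2 : rcons Y1 u = q1 ++ v :: q2 -> ~~ has (G x) q1 -> G x v ->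
    ~~ G h1 v /\ G v h2.
  move=> e nh xv; have hv := att_of q1 v q2 e nh xv.
  have vY : v \in rcons Y1 u by rewrite e mem_cat mem_head orbT.
  have := YF v (subY v vY); rewrite inF => /andP[vW _].
  have [n1 /orP[/eqP ev|->//]] := notW v hv vW.
  have := DH v; rewrite inE vY orbT => /(_ isT); rewrite ev !inE mem_rcons.
  by rewrite mem_head !orbT.
(* The first node of [Y1] seen by [x] would see [h2], against the choice of [u]. *)
have Y1x v : v \in Y1 -> ~~ G x v.
  move=> vY; apply/negP=> xv.
  have /split_first [q1 [w [q2 [e xw nh]]]] : has (G x) Y1 by apply/hasP; exists v.
  have e' : rcons Y1 u = q1 ++ w :: rcons q2 u by rewrite e rcons_cat.
  have [_ wh2] := attW _ _ _ e' nh xw.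
  have := Y1n w h2; rewrite wh2 e mem_cat mem_head orbT mem_rcons mem_head.
  by move=> /(_ isT isT).
have ux : G x u -> ~~ G h1 u /\ G u h2.
  apply: (attW Y1 u [::]); first by rewrite cats1.
  by apply/hasPn=> v /Y1x.
pose D := [set w in z1 :: rcons Y1 u].
have inD v : (v \in D) = (v \in z1 :: rcons Y1 u) by rewrite in_set.
have cD : conn G D by apply: conn_path.
have z1D : z1 \in D by rewrite inD mem_head.
have uD : u \in D by rewrite inD inE mem_rcons mem_head orbT.
have xz1 : G x z1 by case/attP: atz.
have DnH v w : v \in D -> w \in x :: h1 :: R1 -> v != w.
  by rewrite inD => /DH vH wH; apply: contraNneq vH => ->.
have HD w : w \in x :: h1 :: R1 -> w \notin D.
  by move=> wH; apply/negP => /DnH/(_ wH); rewrite eqxx.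
have xH : x \in x :: h1 :: R1 by rewrite mem_head.
have h1H : h1 \in x :: h1 :: R1 by rewrite in_cons mem_head orbT.
have h2H : h2 \in x :: h1 :: R1 by apply: R1H; rewrite mem_rcons mem_head.
have uH : u \notin x :: h1 :: R1 by apply: DH; rewrite -inD.
have DR v w : v \in D -> w \in R1 -> G v w -> v = u.
  rewrite inD inE mem_rcons inE => /or3P[/eqP->|/eqP->//|vY] wR vw.
    by rewrite (negbTE (z1R w wR)) in vw.
  by rewrite (negbTE (Y1n v w vY wR)) in vw.
have RR1 v : v \in R -> v \in R1 by move=> vR; rewrite mem_rcons inE vR orbT.
(* If [u] sees [x], then [R] and [D] both join [h1] to [h2], which have the common neighbour [x]. *)
have [xu|xu] := boolP (G x u).
  have [uh1 uh2] := ux xu.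
  have [cR h1nR h2nR sR1 sR2] := ipath_inner ipH Rn.
  apply: (no_crossing tG n12 h12 xh1 xh2 (C := [set w in R]) (D := D)).
  - by split; rewrite ?in_set.
  - split=> //; [exact: HD|exact: HD|apply: (seesI z1D)|apply: (seesI uD)];
    by rewrite adj_sym.
  - move=> v w; rewrite in_set => vR wD; split; last by rewrite eq_sym; apply: DnH (R1H v (RR1 v vR)).
    apply/negP=> vw; rewrite adj_sym in vw; have ewu := DR w v wD (RR1 v vR) vw; subst w.
    have := hole_nbrs tG hH uH xH (R1H v (RR1 v vR)) _ vw.
    rewrite adj_sym => /(_ xu); rewrite (negbTE (Rx v vR)) orbF => /eqP e.
    by rewrite e vR in xR.
  - by rewrite in_set.
  - exact: HD.
have [h3 [R2 [eR R2n]]] : exists h3 R2, R1 = h3 :: R2 /\ R2 != [::].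
  rewrite /R1; case: (R) Rn => // r [|r' R'] _; [exists r, [:: h2]|exists r, (r' :: rcons R' h2)] => //.
have lR2 r : last r R2 = h2.
  have : last h1 R1 = h2 by rewrite last_rcons.
  by rewrite eR /=; case: (R2) R2n.
have h2R2 : h2 \in R2 by rewrite -(lR2 h2); case: (R2) R2n => //= r q _; exact: mem_last.
have R2R v : v \in R2 -> v \in R1 by move=> vR; rewrite eR inE vR orbT.
have h3R : h3 \in R1 by rewrite eR mem_head.
have xh3 : ~~ G x h3.
  apply/negP=> xh3; have := xo h3; rewrite -/R1 inE h3R orbT => /(_ isT xh3) [e|e].
    by move: h3R; rewrite mem_rcons inE e (negbTE n12) (negbTE h1R).
  by have := ipath_uniq ipR1; rewrite eR /= e h2R2.
have nxh3 : x != h3.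
  by apply: contraNneq nx1 => e; move: xR nx2; rewrite e; move: h3R; rewrite mem_rcons inE => /orP[->|->].
have h1h3 : G h1 h3 by have := ipH; rewrite -/R1 eR => /and4P[].
have h1R2 v : v \in R2 -> ~~ G h1 v.
  move=> vR; have := ipH; rewrite -/R1 eR => ip.
  by apply: (@ipath_far _ G [:: h1] h3 R2) => //; rewrite mem_head.
have cR2 : conn G [set w in R2].
  by apply: conn_ipath; have := ipR1; rewrite eR => /(@ipath_behead _ _ (h3 :: R2)).
have sR2h3 : sees G [set w in R2] h3.
  have := ipR1; rewrite eR; case: (R2) R2n => // r q _ /and4P[h3r _ _ _].
  by apply: (seesI (u := r)); rewrite ?in_set ?mem_head.
have sR2x : sees G [set w in R2] x by apply: (seesI (u := h2)); rewrite ?in_set.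
have h3R2 : h3 \notin R2 by have := ipath_uniq ipR1; rewrite eR => /andP[].
have nR2 w : w \notin R1 -> w \notin R2 by apply: contra => /R2R.
have xR1 : x \notin R1 by rewrite mem_rcons inE negb_or nx2.
have h1R1 : h1 \notin R1 by rewrite mem_rcons inE negb_or n12.
have h1x : G h1 x by rewrite adj_sym.
(* If [h3] is the only neighbour of [u] in [R1], then [R2] and [D] both join [x] to [h3], which have
   the common neighbour [h1]. *)
have [/hasP[hs0 hs0R uhs0]|nR2u] := boolP (has (G u) R2); last first.
  have uh3 : G u h3.
    case/seesP: uR1 => w; rewrite in_set eR inE => /orP[/eqP->//|wR] uw.
    by case/hasP: nR2u; exists w.
  apply: (no_crossing tG nxh3 xh3 (a := h1) h1x h1h3 (C := [set w in R2]) (D := D)).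
  - by split; rewrite ?in_set //; apply: nR2.
  - split=> //; [exact: HD|exact: HD (R1H _ h3R)|exact: seesI z1D xz1|].
    by apply: (seesI uD); rewrite adj_sym.
  - move=> v w; rewrite in_set => vR wD; split; last by rewrite eq_sym; apply: DnH (R1H v (R2R v vR)).
    apply/negP=> vw; rewrite adj_sym in vw; have ewu := DR w v wD (R2R v vR) vw; subst w.
    by case/hasP: nR2u; exists v.
  - by rewrite in_set nR2.
  - exact: HD.
have uh1 : ~~ G u h1.
  apply/negP=> uh1; have := hole_nbrs tG hH uH h1H (R1H _ (R2R _ hs0R)) uh1 uhs0.
  rewrite (negbTE (h1R2 _ hs0R)) orbF => /eqP e; by rewrite e R2R in h1R1.
(* If [h1] sees [Y1], take its last neighbour [v] there: [x], [h3] and [v] are pairwise nonadjacent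
   neighbours of [h1], and all three see the union of [R2] and the part of the walk after [v]. *)
have [/split_last[Y1a [v [Y1b [eY1 h1v nY1b]]]]|nY1h] := boolP (has (G h1) Y1).
  have vY1 : v \in Y1 by rewrite eY1 mem_cat mem_head orbT.
  have subb w : w \in Y1b -> w \in Y1 by move=> wY; rewrite eY1 mem_cat inE wY !orbT.
  pose q := rcons Y1b u.
  have pq : path G v q.
    by move: pYu; rewrite eY1 rcons_cat rcons_cons cat_path => /and3P[].
  have [cq hq] : conn G [set w in q] /\ sees G [set w in q] v.
    have : q != [::] by rewrite /q; case: (Y1b).
    case: (q) pq => // w q' /andP[vw pq'] _; split; first exact: conn_path.
    by apply: (seesI (u := w)); rewrite ?in_set ?mem_head.
  have qP w : w \in q -> w \in D /\ ~~ G h1 w.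
    rewrite mem_rcons inE => /orP[/eqP->|wY]; first by rewrite uD adj_sym.
    split; first by rewrite inD inE mem_rcons inE subb ?orbT.
    by apply: contra nY1b => h; apply/hasP; exists w.
  apply: (no_claw tG (a := h1) (x := x) (y := h3) (z := v)
    (C := [set w in R2] :|: [set w in q])) => //.
  - apply: (connU (u := hs0) (v := u)); rewrite ?in_set ?mem_rcons ?mem_head //.
    by rewrite adj_sym uhs0 orbT.
  - rewrite in_setU !in_set negb_or nR2 //=; apply/negP=> /qP[h1D _].
    by have := HD h1 h1H; rewrite h1D.
  - by move=> w; rewrite in_setU !in_set => /orP[/h1R2|/qP[]].
  - rewrite /stable3 nxh3 xh3 (Y1x v vY1) /= ![_ == v]eq_sym; apply/and3P; split.
    + by apply: DnH xH; rewrite inD inE mem_rcons inE vY1 !orbT.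
    + by apply: DnH (R1H _ h3R); rewrite inD inE mem_rcons inE vY1 !orbT.
    + by rewrite adj_sym Y1n.
  - by apply: seesS sR2x; apply: subsetUl.
  - by apply: seesS sR2h3; apply: subsetUl.
  - by apply: seesS hq; apply: subsetUr.
have Dh1 v : v \in D -> G h1 v -> v = z1.
  rewrite inD inE mem_rcons inE => /or3P[/eqP->//|/eqP->|vY] h1v.
    by rewrite adj_sym (negbTE uh1) in h1v.
  by case/hasP: nY1h; exists v.
have Dx v : v \in D -> G x v -> v = z1.
  rewrite inD inE mem_rcons inE => /or3P[/eqP->//|/eqP->|vY] xv.
    by rewrite (negbTE xu) in xv.
  by rewrite (negbTE (Y1x v vY)) in xv.
have /split_first[r1 [k0 [r2 [eR1 uk0 nr1]]]] : has (G u) R1.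
  by apply/hasP; exists hs0; rewrite ?R2R.
have uniqH := hole_uniq hH; rewrite -/R1 eR1 in uniqH.
have holeR : hole G (k0 :: r2 ++ x :: h1 :: r1).
  have := hole_rot (size (x :: h1 :: r1)) hH; rewrite -/R1 eR1 -!cat_cons.
  by rewrite rot_size_cat.
have [ipR szR k0hd k0l k0o] := hole_consP holeR.
have k0R : k0 \in R1 by rewrite eR1 mem_cat mem_head orbT.
have r1R v : v \in r1 -> v \in R1 by move=> vR; rewrite eR1 mem_cat vR.
have r2R v : v \in r2 -> v \in R1 by move=> vR; rewrite eR1 mem_cat inE vR !orbT.
(* If [k0] is the only neighbour of [u] in [R1], then [u] and the two hole neighbours [pv] and [nx]
   of [k0] contradict [no_claw] at [k0]. The connected set is the rest of the hole together with
   [z1 :: Y1], where [z1] is adjacent to both [x] and [h1]. *)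
have [|nr2] := boolP (has (G u) r2); last first.
  case/lastP: r1 eR1 nr1 uniqH holeR ipR szR k0hd k0l k0o r1R =>
    [|r1 pv] eR1 nr1 uniqH holeR ipR szR k0hd k0l k0o r1R.
    move: eR1; rewrite eR => -[_ e2]; case/hasP: nr2; exists hs0 => //.
    by rewrite -e2.
  have [nx [r2' er2]] : exists nx r2', rcons r2 x = nx :: r2'.
    by case: (r2) => [|r r2']; [exists x, [::]|exists r, (rcons r2' x)].
  have es : r2 ++ x :: h1 :: rcons r1 pv = (nx :: r2') ++ h1 :: rcons r1 pv.
    by rewrite -er2 cat_rcons.
  rewrite es in ipR k0hd k0l k0o; rewrite /= in k0hd.
  rewrite last_cat /= last_rcons in k0l.
  have ko v : v \in (nx :: r2') ++ h1 :: rcons r1 pv -> G k0 v -> v = nx \/ v = pv.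
    by move=> vs kv; have := k0o v vs kv; rewrite last_cat /= last_rcons.
  have unS := ipath_uniq ipR.
  have pvnx : ~~ G nx pv.
    by apply: (ipath_far ipR); rewrite ?mem_head // mem_rcons mem_head.
  have pvR : pv \in R1 by apply: r1R; rewrite mem_rcons mem_head.
  have nnxpv : nx != pv.
    by move: unS => /= /andP[+ _]; rewrite mem_cat inE mem_rcons inE !negb_or => /and4P[].
  have k0S : k0 \notin (nx :: r2') ++ h1 :: rcons r1 pv.
    by have := hole_uniq holeR; rewrite cons_uniq es => /andP[].
  have ipr : ipath G (h1 :: rcons r1 pv) := ipath_catr ipR.
  have cr1 : conn G [set w in h1 :: r1].
    by apply: conn_ipath; move: ipr; rewrite -rcons_cons -cats1 => /ipath_catl.
  have [pY1 luY] : path G z1 Y1 /\ G (last z1 Y1) u.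
    by move: pYu; rewrite rcons_path => /andP[].
  have cY1 : conn G [set w in z1 :: Y1] by apply: conn_path.
  have YD v : v \in z1 :: Y1 -> v \in D.
    by rewrite inD !inE mem_rcons inE => /orP[->|->]; rewrite ?orbT.
  pose C := ([set w in h1 :: r1] :|: [set w in z1 :: Y1]) :|: [set w in r2'].
  have c01 : conn G ([set w in h1 :: r1] :|: [set w in z1 :: Y1]).
    by apply: (connU (u := h1) (v := z1)) => //; rewrite ?in_set ?mem_head // adj_sym z1h1 orbT.
  have xr2' : r2' != [::] -> x \in r2'.
    have := congr1 (last x) er2; rewrite last_rcons /=.
    by case: (r2') => //= r q ->; rewrite mem_last.
  have cC : conn G C.
    case: (eqVneq r2' [::]) => [e|ne]; first by rewrite /C e set_nil setU0.
    apply: (connU (u := z1) (v := x)) => //.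
    - by apply: conn_ipath; have := ipath_behead (ipath_catl ipR).
    - by rewrite in_setU !in_set mem_head orbT.
    - by rewrite in_set xr2'.
    - by rewrite adj_sym xz1 orbT.
  have inC v : v \in C -> (v \in z1 :: Y1) \/
     [/\ v \in (nx :: r2') ++ h1 :: rcons r1 pv, v != nx & v != pv].
    have [nxn unr] : nx \notin r2' ++ h1 :: rcons r1 pv /\ uniq (r2' ++ h1 :: rcons r1 pv).
      by move: unS => /andP[].
    move: unr; rewrite cat_uniq => /and3P[_ dis unr].
    move: unr; rewrite -rcons_cons rcons_uniq => /andP[pvn _].
    rewrite /C !in_setU !in_set => /orP[/orP[vr|vY]|vr]; [right|by left|right].
      have vs : v \in h1 :: rcons r1 pv by rewrite -rcons_cons mem_rcons inE vr orbT.
      split; [by rewrite mem_cat vs orbT| |by apply: contraNneq pvn => <-].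
      by apply: contraNneq nxn => <-; rewrite mem_cat vs orbT.
    split; first by rewrite mem_cat inE vr orbT.
      by apply: contraNneq nxn => <-; rewrite mem_cat vr.
    apply: contraNneq dis => e; apply/hasP; exists pv; last by rewrite -e.
    by rewrite -rcons_cons mem_rcons mem_head.
  apply: (no_claw tG (a := k0) (x := pv) (y := nx) (z := u) (C := C)) => //.
  - apply/negP=> /inC[/YD kD|[kS _ _]]; last by rewrite kS in k0S.
    by have := HD k0 (R1H _ k0R); rewrite kD.
  - move=> v /inC[vY|[vS n1 n2]]; apply/negP=> kv; last first.
      by case: (ko v vS kv) => e; [rewrite e eqxx in n1|rewrite e eqxx in n2].
    move: vY; rewrite adj_sym in kv; rewrite inE => /orP[/eqP e|vY].
      by rewrite e (negbTE (z1R _ k0R)) in kv.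
    by rewrite (negbTE (Y1n v k0 vY k0R)) in kv.
  - by rewrite adj_sym.
  - have upv : ~~ G u pv by apply: contra nr1 => h; apply/hasP; exists pv; rewrite // mem_rcons mem_head.
    have [nxH unx] : nx \in x :: h1 :: R1 /\ ~~ G u nx.
      have : nx \in rcons r2 x by rewrite er2 mem_head.
      rewrite mem_rcons inE => /orP[/eqP->|nr]; first by rewrite adj_sym.
      split; first by apply: R1H; apply: r2R.
      by apply: contra nr2 => h; apply/hasP; exists nx.
    rewrite /stable3 eq_sym nnxpv adj_sym pvnx adj_sym upv adj_sym unx /= andbT.
    rewrite ![_ == u]eq_sym; apply/andP; split; last exact: DnH.
    exact: DnH (R1H _ pvR).
  - apply: (seesI (u := last h1 r1)); first by rewrite !in_setU in_set mem_last.
    by move: (ipath_path ipr); rewrite rcons_path adj_sym => /andP[].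
  - case: (eqVneq r2' [::]) => [e|ne].
      apply: (seesI (u := z1)); first by rewrite !in_setU !in_set mem_head orbT.
      have := congr1 (last x) er2; rewrite last_rcons e /= => <-; exact: xz1.
    case: (r2') ne ipR @C {xr2' es er2 ko unS k0S inC cC k0o} => // r q _ /and4P[nxr _ _ _] C.
    by apply: (seesI (u := r)); rewrite // !in_setU !in_set mem_head !orbT.
  - apply: (seesI (u := last z1 Y1)); first by rewrite !in_setU !in_set mem_last orbT.
    by rewrite adj_sym.
have ipR1' : ipath G (r1 ++ k0 :: r2) by rewrite -eR1.
have adjR v w : v \in R1 -> w \in R1 -> G u v -> G u w -> (v == w) || G v w.
  by move=> vR wR uv uw; apply: (hole_nbrs tG hH uH) => //; apply: R1H.
case: r2 eR1 uniqH holeR ipR szR k0hd k0l k0o r2R ipR1' => // k1 r3 eR1 uniqH holeR ipR szR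
  k0k1 k0l k0o r2R ipR1' hr2.
have r3k0 v : v \in r3 -> ~~ G k0 v /\ k0 != v.
  move=> vr; split.
    apply: (@ipath_far _ _ (rcons r1 k0) k1 r3); rewrite ?cat_rcons //.
    by rewrite mem_rcons mem_head.
  have := ipath_uniq ipR1'; rewrite cat_uniq => /and3P[_ _ /andP[kn _]].
  by apply: contraNneq kn => ->; rewrite inE vr orbT.
have ur3 v : v \in r3 -> ~~ G u v.
  move=> vr; apply/negP=> uv; have [n1 n2] := r3k0 v vr.
  have vR : v \in R1 by apply: r2R; rewrite inE vr orbT.
  by have := adjR k0 v k0R vR uk0 uv; rewrite (negbTE n1) (negbTE n2).
have uk1 : G u k1.
  by case/hasP: hr2 => v; rewrite inE => /orP[/eqP->//|vr]; rewrite (negbTE (ur3 v vr)).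
have k1R : k1 \in R1 by apply: r2R; rewrite mem_head.
have r1u v : v \in r1 -> ~~ G u v.
  by move=> vr; apply: contra nr1 => h; apply/hasP; exists v.
have inR v : (v \in R1) = (v \in rcons r1 k0) || (v \in k1 :: r3).
  by rewrite eR1 -cat_rcons mem_cat.
have DKS v : v \in D -> (v \in K) || S v.
  rewrite inD inE => /orP[/eqP->|vY].
    have := subZ z1 (mem_head _ _); rewrite in_setU => /orP[->//|/BS->].
    by rewrite orbT.
  by have := YF v (subY v vY); rewrite inF => /andP[].
(* A new hole through [z1] with two nodes of [A] is again a [cut_hole], now with the shorter path
   [Z']. It avoids [B], since [c] would otherwise see two nonadjacent nodes of it; hence [z1] is in
   [K] and [Z'] is not empty. *)
have finish arc u0 t0 e1 e2 : hole G (arc ++ u0 :: t0) -> {subset arc <= x :: h1 :: R1} ->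
    {subset u0 :: t0 <= D} -> z1 \in u0 :: t0 -> e1 \in arc -> e2 \in arc ++ u0 :: t0 ->
    e1 != e2 -> e1 \in A -> e2 \in A -> False.
  move=> hh sarc sD zin e1arc e2in ne e1A e2A.
  have e1in : e1 \in arc ++ u0 :: t0 by rewrite mem_cat e1arc.
  have inKS v : v \in arc ++ u0 :: t0 -> (v \in K) || S v.
    rewrite mem_cat => /orP[/sarc/subH|/sD/DKS//].
    by rewrite in_setU => /orP[->//|/AS->]; rewrite orbT.
  have cH : c \notin arc ++ u0 :: t0.
    apply/negP=> /inKS/orP[|/SK]; last by rewrite adj_irr.
    by rewrite (negbTE (comp_self zf)).
  have noB v : v \in arc ++ u0 :: t0 -> v \notin B.
    move=> vin; apply/negP=> vB; have [n1 n2] := AB e1A vB.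
    have := hole_nbrs tG hh cH e1in vin (SK (AS e1A)) (SK (BS vB)).
    by rewrite (negbTE n1) (negbTE n2).
  have subKA : {subset arc ++ u0 :: t0 <= K :|: A}.
    move=> v vin; rewrite in_setU; have := noB v vin.
    by case/orP: (inKS v vin) => [->//|/SAB/orP[->|->//]]; rewrite orbT.
  have zin' : z1 \in arc ++ u0 :: t0 by rewrite mem_cat zin orbT.
  have z1K : z1 \in K.
    have := subZ z1 (mem_head _ _); rewrite in_setU => /orP[//|zB].
    by have := noB z1 zin'; rewrite zB.
  apply: (@IH (arc ++ u0 :: t0) z1 Z') => //; split=> //.
    by exists e1, e2.
  split.
  - by case/andP: pZ.
  - by move=> v vZ; apply: subZ; rewrite inE vZ orbT.
  - apply/negP=> /eqP Z0; move: lZ; rewrite Z0 /= => zB.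
    by have := noB z1 zin'; rewrite zB.
  - by [].
have sub1 : {subset h1 :: rcons r1 k0 <= x :: h1 :: R1}.
  by move=> v; rewrite inE => /orP[/eqP->//|vr]; apply: R1H; rewrite inR vr.
have sub2 : {subset k1 :: rcons r3 x <= x :: h1 :: R1}.
  move=> v; rewrite -rcons_cons mem_rcons inE => /orP[/eqP->//|vr]; apply: R1H.
  by rewrite inR vr orbT.
have k01 : k1 != k0.
  by have := ipath_uniq ipR1'; rewrite cat_uniq => /and3P[_ _ /andP[kn _]];
    apply: contraNneq kn => <-; rewrite mem_head.
have nk0 : k0 \notin k1 :: r3.
  by have := ipath_uniq ipR1'; rewrite cat_uniq => /and3P[_ _ /andP[kn _]].
have [u1 [t1 [hh1 st1 k0u1 h1t1]]] : exists u1 t1,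
    [/\ hole G ((h1 :: rcons r1 k0) ++ u1 :: t1), {subset u1 :: t1 <= D},
     G k0 u1 & G h1 (last u1 t1)].
  have lk : last h1 (rcons r1 k0) = k0 by rewrite last_rcons.
  have := @hole_of_link _ G h1 (rcons r1 k0) D; rewrite lk; apply=> //.
  - move: ipH; rewrite -/R1 eR1 -cat_rcons -cat_cons; exact: ipath_catl.
  - by case: (r1).
  - move=> v w vD warc; split; first exact: DnH (sub1 w warc).
    move: warc; rewrite inE => /orP[/eqP->|wr vw]; [by left|right].
    have wR : w \in R1 by rewrite inR wr.
    have evu := DR v w vD wR vw; subst v.
    by move: wr; rewrite mem_rcons inE => /orP[/eqP//|/r1u]; rewrite vw.
  - by apply: (seesI z1D); rewrite adj_sym.
  - by apply: (seesI uD); rewrite adj_sym.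
  - move=> _ v vD h1v; have -> := Dh1 v vD h1v.
    by rewrite adj_sym z1R.
have z1t1 : z1 \in u1 :: t1.
  have lD : last u1 t1 \in D by apply: st1; rewrite mem_last.
  by rewrite -(Dh1 _ lD h1t1) mem_last.
have ut1 : u \in u1 :: t1.
  have := DR u1 k0 (st1 u1 (mem_head _ _)) k0R; rewrite adj_sym => /(_ k0u1) <-.
  by rewrite mem_head.
have lx1 : last k1 (rcons r3 x) = x by rewrite last_rcons.
have [u2 [t2 [hh2 st2 xu2 k1t2]]] : exists u1 t1,
    [/\ hole G ((k1 :: rcons r3 x) ++ u1 :: t1), {subset u1 :: t1 <= D},
     G x u1 & G k1 (last u1 t1)].
  have := @hole_of_link _ G k1 (rcons r3 x) D; rewrite lx1; apply=> //.
  - by move: ipR; rewrite -cat_rcons -rcons_cons => /ipath_catl.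
  - by case: (r3).
  - move=> v w vD warc; split; first exact: DnH (sub2 w warc).
    move: warc; rewrite inE mem_rcons inE => /or3P[/eqP->|/eqP->|wr] vw; [by left|by right|].
    have wR : w \in R1 by rewrite inR inE wr !orbT.
    have evu := DR v w vD wR vw; subst v.
    by rewrite (negbTE (ur3 w wr)) in vw.
  - by apply: (seesI uD); rewrite adj_sym.
  - exact: seesI z1D xz1.
  - move=> _ v vD k1v; apply/negP=> xv; rewrite (Dx v vD xv) adj_sym in k1v.
    by rewrite (negbTE (z1R k1 k1R)) in k1v.
have z1t2 : z1 \in u2 :: t2.
  by rewrite -(Dx u2 (st2 u2 (mem_head _ _)) xu2) mem_head.
(* Nodes of [A] on different arcs are adjacent, so they are [k0] and [k1]. As a common neighbour of
   both, [u] is not in [K]; it is not in [B], which has no edge to [A]; and if it is in [A], the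
   pair [k0], [u] lies on the first new hole. *)
have mixed e1 e2 : e1 != e2 -> e1 \in A -> e2 \in A -> e1 \in h1 :: rcons r1 k0 ->
    e2 \in k1 :: rcons r3 x -> False.
  move=> ne e1A e2A e1in e2in; have xA := KA xK.
  have := Acl e1A e2A; rewrite (negbTE ne) /= => G12.
  have {}e2in : e2 \in k1 :: r3.
    move: e2in; rewrite -rcons_cons mem_rcons inE => /orP[/eqP e|//].
    by rewrite -e e2A in xA.
  have ipHH : ipath G ((h1 :: r1) ++ k0 :: k1 :: r3) by rewrite cat_cons -eR1.
  have [_ /(_ G12)[ek0 ek1]] := ipath_cross ipHH e1in e2in.
  subst e1 e2.
  case/orP: (DKS u uD) => [uK|/SAB/orP[uA|uB]].
  - have := no_common_attach tG ht (AS e1A) (AS e2A) G12 _ _ uK uk0; rewrite uk1.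
    have [n1 n2] := AB e1A tB; rewrite eq_sym n2 adj_sym n1 => /(_ isT isT).
    by [].
  - apply: (finish _ _ _ k0 u hh1) => //.
    + by rewrite mem_cat ut1 orbT.
    + by rewrite eq_sym; apply: DnH (R1H _ k0R).
  - by have [n1 _] := AB e1A uB; rewrite adj_sym uk0 in n1.
have inH v : v \in x :: h1 :: R1 -> (v \in h1 :: rcons r1 k0) || (v \in k1 :: rcons r3 x).
  rewrite in_cons => /orP[/eqP->|]; last rewrite in_cons => /orP[/eqP->|].
  - by apply/orP; right; rewrite in_cons mem_rcons mem_head orbT.
  - by rewrite mem_head.
  - rewrite inR => /orP[vr|vr]; first by rewrite inE vr orbT.
    by apply/orP; right; rewrite -rcons_cons mem_rcons in_cons vr orbT.
case/orP: (inH _ a1H) => h1a; case/orP: (inH _ a2H) => h2a.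
- by apply: (finish _ _ _ a1 a2 hh1) => //; rewrite mem_cat h2a.
- exact: (mixed a1 a2).
- by apply: (mixed a2 a1) => //; rewrite eq_sym.
- by apply: (finish _ _ _ a1 a2 hh2) => //; rewrite mem_cat h2a.
Qed.
End Step.

Lemma cut_hole_mem H H' x Z : hole G H' -> H' =i H -> cut_hole H x Z -> cut_hole H' x Z.
Proof.
move=> hH' eH [_ sH [a1 [a2 [n a1A a2A a1H a2H]]] [xH xK] hZ]; split=> //.
- by move=> v; rewrite eH; apply: sH.
- by exists a1, a2; rewrite !eH.
- by rewrite eH.
Qed.

(** With [Z] shortest, it leaves the hole at once and [x] sees only its first node [z1]. The hole
    neighbours [h1] and [h2] of [x] and [z1] are all attached to the component of [c] in the far
    side of [x], so [z1] sees [h1] or [h2]; reversing the hole exchanges the two cases. *)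
Lemma no_cut_hole n H x Z : size Z < n -> cut_hole H x Z -> False.
Proof.
elim: n H x Z => // n IH H x [|z1 Z'] szn hc; first by case: hc => _ _ _ _ [].
have [hH sH [a1 [a2 [na a1A a2A a1H a2H]]] [xH xK] [pZ sZ _ lZ]] := hc.
have AorB v : v \in K :|: A -> v \in B -> False.
  rewrite in_setU => /orP[/KB/negbTE->//|vA] vB.
  by have [_] := AB vA vB; rewrite eqxx.
have KofAB v : v \in K :|: A -> v \in K :|: B -> v \in K.
  by move=> h; rewrite in_setU => /orP[//|/(AorB v h)].
have pZ' : path G z1 Z' by case/andP: pZ.
have xz1 : G x z1 by case/andP: pZ.
have subZ' : {subset Z' <= K :|: B} by move=> v vZ; apply: sZ; rewrite inE vZ orbT.
have z1H : z1 \notin H.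
  apply/negP=> z1H; have z1K : z1 \in K by apply: KofAB; [exact: sH|apply: sZ; rewrite mem_head].
  apply: (IH H z1 Z') => //; split=> //; first by exists a1, a2.
  split=> //; apply/negP=> /eqP Z0; move: lZ; rewrite Z0 /= => zB.
  exact: (AorB z1 (sH z1 z1H)).
have nZ v : v \in Z' -> ~~ G x v /\ v != x.
  move=> vZ; case/splitPr: vZ szn hc pZ sZ lZ pZ' subZ' => q1 q2 szn hc pZ sZ lZ pZ' subZ'.
  have lt2 : size (v :: q2) < n.
    by move: szn; rewrite /= size_cat /= ltnS; apply: leq_trans; rewrite ltnS leq_addl.
  have lq : last v q2 \in B by move: lZ; rewrite /= last_cat.
  split.
    apply/negP=> xv; apply: (IH H x (v :: q2)) => //; split=> //; first by exists a1, a2.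
    split=> //; first by move: pZ'; rewrite cat_path /= xv => /and3P[].
    by move=> w wq; apply: subZ'; rewrite mem_cat wq orbT.
  apply/eqP=> evx; subst v; apply: (IH H x q2) => //; first exact: ltnW.
  split=> //; first by exists a1, a2.
  split=> //.
  - by move: pZ'; rewrite cat_path /= => /and3P[].
  - by move=> w wq; apply: subZ'; rewrite mem_cat inE wq !orbT.
  - apply/negP=> /eqP q0; move: lq; rewrite q0 /= => xB.
    by rewrite (negbTE (KB xK)) in xB.
have [s0 [hs0 es0 _]] := hole_at hH xH.
have [h1 [R [h2 [e0 Rn]]]] : exists h1 R h2, s0 = h1 :: rcons R h2 /\ R != [::].
  have [_ + _ _ _] := hole_consP hs0; case: (s0) => // h1 s1 /=.
  case/lastP: s1 => // R h2; rewrite size_rcons => szR; exists h1, R, h2; split=> //.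
  by case: (R) szR.
subst s0; have hc' := cut_hole_mem hs0 es0 hc.
have [ipH _ xh1 xh2 xo] := hole_consP hs0.
rewrite /= last_rcons in xh1 xh2 xo.
have cx : c \in far G x by rewrite far_sym Kf.
have cT : c \in component G x c := comp_refl _ _ _.
have [nh12 h12] := hole_ends hs0 Rn.
have := hole_uniq hs0; rewrite cons_uniq in_cons mem_rcons in_cons !negb_or.
case/andP=> /and3P[nx1 nx2 xR] unr.
have [cR h1R h2R sR1 sR2] := ipath_inner ipH Rn.
have Rfar v : v \in R -> v \in far G x.
  move=> vR; rewrite inE; apply/andP; split; first by apply: contraNneq xR => <-.
  apply/negP=> xv; have vs : v \in h1 :: rcons R h2 by rewrite inE mem_rcons inE vR !orbT.
  by case: (xo v vs xv) => e; [rewrite -e vR in h1R|rewrite -e vR in h2R].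
have [a0 a0A a0R] : exists2 a0, a0 \in A & a0 \in R.
  have xA := KA xK; move: a1H a2H; rewrite -!es0 !inE !mem_rcons !inE.
  have nx v : v \in A -> (v == x) = false by move=> vA; apply: contraNF xA => /eqP <-.
  rewrite !nx //=; case/or3P=> [/eqP e|/eqP e|h]; case/or3P=> [/eqP e'|/eqP e'|h'];
    try by [exists a1|exists a2].
  - by rewrite e e' eqxx in na.
  - by have := Acl a1A a2A; rewrite e e' (negbTE nh12) (negbTE h12).
  - by have := Acl a2A a1A; rewrite e e' (negbTE nh12) (negbTE h12).
  - by rewrite e e' eqxx in na.
have RT v : v \in R -> v \in component G x c.
  move=> vR; apply: (comp_conn (u := a0) cR).
  - by apply/subsetP=> w; rewrite in_set => /Rfar.
  - by rewrite in_set.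
  - by rewrite in_set.
  by apply: (comp_step (u := c)) => //; [exact: Rfar|apply: SK; exact: AS].
have att_R h : G x h -> sees G [set w in R] h -> att G x c h.
  move=> xh /seesP[w]; rewrite in_set => wR hw; apply/attP; split=> //.
  by exists w => //; apply: RT.
have atz : att G x c z1.
  apply/attP; split=> //; case: (eqVneq Z' [::]) => [Z0|Zn].
    by exists c => //; rewrite adj_sym; apply: SK; apply: BS; move: lZ; rewrite Z0.
  have Zf v : v \in Z' -> v \in far G x by move=> /nZ[n1 n2]; rewrite inE n1 n2.
  have lZ' : last z1 Z' \in Z' by case: (Z') Zn => //= r q _; exact: mem_last.
  have [z2 z2Z z12] : exists2 z2, z2 \in Z' & G z1 z2.
    by case: (Z') Zn pZ' => // r q _ /andP[z1r _]; exists r; rewrite ?mem_head.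
  have cZ : conn G [set w in Z'].
    by case: (Z') Zn pZ' => // r q _ /andP[_]; exact: conn_path.
  exists z2 => //; apply: (comp_conn (u := last z1 Z') cZ).
  - by apply/subsetP=> w; rewrite in_set => /Zf.
  - by rewrite in_set.
  - by rewrite in_set.
  - rewrite /= in lZ; apply: (comp_step (u := c)) => //; first exact: Zf.
    by apply: SK; apply: BS.
have at1 := att_R h1 xh1 sR1; have at2 := att_R h2 xh2 sR2.
have z1H' : z1 \notin x :: h1 :: rcons R h2 by rewrite es0.
have := att_two tG at1 at2 atz nh12 h12.
have nzh h : h \in x :: h1 :: rcons R h2 -> z1 == h = false.
  by move=> hH0; apply: contraNF z1H' => /eqP->.
rewrite !nzh ?inE ?mem_rcons ?mem_head ?inE ?eqxx ?orbT //=.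
have step := @cut_hole_step n (fun H x Z sz => @IH H x Z sz).
case/orP=> z1h; first by apply: (step x h1 R h2 z1 Z').
have hr : hole G (x :: h2 :: rcons (rev R) h1).
  have := hole_rot (size (rcons (rev (rcons R h2)) h1)) (hole_rev hs0).
  rewrite !rev_cons rev_rcons -rcons_cons -[rcons (rcons _ _) x]cats1 rot_size_cat.
  by rewrite rcons_cons.
have er : x :: h2 :: rcons (rev R) h1 =i x :: h1 :: rcons R h2.
  move=> v; rewrite !inE !mem_rcons !inE mem_rev.
  by case: (v == x) (v == h1) (v == h2) (v \in R) => [] [] [] [].
apply: (step x h2 (rev R) h1 z1 Z') => //; last by rewrite er.
exact: cut_hole_mem hr er hc'.
Qed.

End Existence.

Theorem needs_cut_good g c z : tame G -> witness g -> needs_cut c z ->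
  exists2 x, x \in component G c z & good_cut g c x.
Proof.
move=> tG gP /existsP[s /existsP[t /and3P[hs ht]]]; rewrite negb_or => /andP[nst st].
apply/exists_inP; apply: contraT; rewrite negb_exists_in => /forall_inP nocut.
exfalso; pose A := [set u | att G c z u && ((u == s) || G s u)].
have [/existsP[s' /andP[s'A ns]]|] := boolP [exists s', (s' \in A) && (s' != s)].
  have [H [x [Z hc]]] := cut_hole_exists tG hs ht nst st s'A ns.
  exact: (no_cut_hole tG gP hs ht nst st nocut (ltnSn (size Z)) hc).
(* The remaining case: the clique of [s] is [s] alone. The cut at a neighbour of [s], taken on the
   side of [s], leaves no end in this clique for a crossing path. *)
rewrite negb_exists => /forallP A1.
have /seesP[x xK sx] := att_sees hs; have [cs zf _] := attP _ _ _ _ hs.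
have xf := comp_far zf xK.
have hx : att G x c s.
  by apply/attP; split; [rewrite adj_sym|rewrite far_sym|exists c; [exact: comp_refl|rewrite adj_sym]].
have [al [be [alA _ nW _ _]]] :=
  crossed_path tG hs ht nst st nocut (((s == g c x) || G (g c x) s)) xK.
have := A1 al; rewrite alA /= negbK => /eqP e; move: nW.
by rewrite e /cutset !inE hx eqxx orbT.
Qed.

End Cuts.

(** * The three conditions exclude thetas, pyramids and wheels *)

Section Completeness.
Variables (V : finType) (G : sgraph V).
Implicit Types (a c u v w x y z : V).

Definition clean (g : V -> V -> V) : Prop :=
  [/\ forall a v x y z, ~~ claw_attached G a v x y z,
      forall a v x y, ~~ bypass G a v x y
    & forall c z, needs_cut G c z -> exists2 x, x \in component G c z & good_cut G g c x].

Lemma ipath_cons_far a x q w : ipath G (a :: x :: q) -> w \in q -> w \in far G a.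
Proof.
move=> ip wq; rewrite inE; apply/andP; split.
  by have := ipath_uniq ip; apply: contraTneq => <-; rewrite /= inE wq orbT.
by apply: (@ipath_far _ G [:: a] x q); rewrite ?mem_head.
Qed.

Lemma ipath_cons_comp a x q v w : ipath G (a :: x :: q) -> v \in q -> w \in q ->
  w \in component G a v.
Proof.
move=> ip vq wq; have cq : conn G [set u in q].
  by apply: conn_ipath; apply: (@ipath_catr _ _ [:: a; x]).
apply: (comp_conn (u := v) cq).
- by apply/subsetP=> u; rewrite in_set; apply: ipath_cons_far ip.
- by rewrite in_set.
- by rewrite in_set.
- exact: comp_refl.
Qed.

Lemma ipath_att a x q v : ipath G (a :: x :: q) -> v \in q -> att G a v x.
Proof.
move=> ip vq; apply/attP; split.
- by have := ip => /and4P[].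
- exact: ipath_cons_far ip vq.
have [u uq xu] : exists2 u, u \in q & G x u.
  case: q ip vq => // u q ip _; exists u; first by rewrite mem_head.
  by have := ip => /and4P[_ _ _ /and4P[]].
by exists u => //; apply: (ipath_cons_comp ip).
Qed.

Section Clean.
Variables (g : V -> V -> V).
Hypotheses (gP : witness G g) (cl : clean g).

Let nocl a v x y z : ~~ claw_attached G a v x y z. Proof. by case: cl. Qed.
Let nobp a v x y : ~~ bypass G a v x y. Proof. by case: cl. Qed.

Lemma clean_no_theta : ~ theta_in G.
Proof.
case=> a [b [q [cp d1 d2]]].
have /fin_all_exists[x hx] i : exists x, exists q',
    [/\ q i = x :: q', b \in q' & ipath G (a :: x :: q')].
  have [cpi szi] := cp i; have ip := ipath_of_chordless cpi.
  have [_ _ + _] := cpi; case: (q i) szi ip => [|x [|y q']] //= _ ip lb.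
  by exists x, (y :: q'); split=> //; rewrite -lb mem_last.
have xq i : x i \in a :: q i by have [q' [-> _ _]] := hx i; rewrite !inE eqxx orbT.
have xa i : x i != a.
  by have [q' [_ _ /ipath_uniq]] := hx i; apply: contraTneq => ->; rewrite /= mem_head.
have xb i : x i != b.
  have [q' [_ bq /ipath_uniq]] := hx i; apply: contraTneq => ->.
  by rewrite /= bq andbF.
have nx i j : i != j -> x i != x j /\ ~~ G (x i) (x j).
  move=> ij; split.
    apply/eqP=> e; have := d1 i j (x i) ij (xq i); rewrite {1}e => /(_ (xq j)).
    by case=> e'; [have := xa i|have := xb i]; rewrite e' eqxx.
  apply/negP=> /(d2 i j (x i) (x j) ij (xq i) (xq j)).
  by case=> e; [have := xa i|have := xb i|have := xa j|have := xb j]; rewrite e eqxx.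
have at_ i : att G a b (x i) by have [q' [_ bq ip]] := hx i; apply: ipath_att ip bq.
pose i0 := @Ordinal 3 0 isT; pose i1 := @Ordinal 3 1 isT; pose i2 := @Ordinal 3 2 isT.
have := nocl a b (x i0) (x i1) (x i2); rewrite /claw_attached !at_ /stable3.
have [-> ->] := nx i0 i1 isT; have [-> ->] := nx i0 i2 isT.
by have [-> ->] := nx i1 i2 isT.
Qed.

(** Some path [q j] has length at least 2, so [b j] is far from [a], and its component contains the
    ends of all the long paths. If a path is a single edge, its end is itself the neighbour of [a]
    and is attached through the triangle. *)
Lemma clean_no_pyramid : ~ pyramid_in G.
Proof.
case=> a [b [q [[cp c2] d1 tr d2]]].
have /fin_all_exists[x hx] i : exists x, exists q',
    [/\ q i = x :: q', last x q' = b i & ipath G (a :: x :: q')].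
  have [cpi szi] := cp i; have ip := ipath_of_chordless cpi.
  have [_ _ + _] := cpi; case: (q i) szi ip => [|x q'] //= _ ip lb.
  by exists x, q'.
have xq i : x i \in a :: q i by have [q' [-> _ _]] := hx i; rewrite !inE eqxx orbT.
have xa i : x i != a.
  by have [q' [_ _ /ipath_uniq]] := hx i; apply: contraTneq => ->; rewrite /= mem_head.
have long i : 2 <= size (q i) -> exists q', [/\ b i \in q' & ipath G (a :: x i :: q')].
  have [q' [-> lb ip]] := hx i => sz; exists q'; split=> //; rewrite -lb.
  by case: (q') sz => //= y q'' _; apply: mem_last.
have longb i : 2 <= size (q i) -> x i != b i.
  case/long=> q' [bq /ipath_uniq]; apply: contraTneq => ->.
  by rewrite /= bq andbF.
have two i j : i != j -> (2 <= size (q i)) || (2 <= size (q j)).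
  move=> ij; apply: contraTT c2; rewrite negb_or => /andP[ni nj]; rewrite -ltnNge.
  have : #|[pred i | 1 < size (q i)]| <= #|[predC pred2 i j]|.
    apply: subset_leq_card; apply/subsetP=> k; rewrite !inE => hk.
    by apply/negP => /orP[]/eqP e; subst k; [rewrite hk in ni|rewrite hk in nj].
  move=> /leq_ltn_trans; apply.
  by have := cardC (pred2 i j); rewrite card2 ij card_ord => -[e]; rewrite -[X in X < _]add0n e.
have nx i j : i != j -> x i != x j /\ ~~ G (x i) (x j).
  move=> ij; split.
    apply/eqP=> e; have := d1 i j (x i) ij (xq i); rewrite {1}e => /(_ (xq j)) e'.
    by have := xa i; rewrite e' eqxx.
  apply/negP=> /(d2 i j (x i) (x j) ij (xq i) (xq j)) [[e1 e2]|e|e].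
  - by case/orP: (two i j ij) => /longb; rewrite ?e1 ?e2 eqxx.
  - by have := xa i; rewrite e eqxx.
  - by have := xa j; rewrite e eqxx.
have [j lj] : exists j, 2 <= size (q j).
  by have /orP[h|h] := two ord0 ord_max isT; [exists ord0|exists ord_max].
have bfar i : 2 <= size (q i) -> b i \in far G a.
  by case/long=> q' [bq ip]; apply: ipath_cons_far ip bq.
have at_ i : att G a (b j) (x i).
  have [li|ni] := boolP (2 <= size (q i)).
    have [q' [bq ip]] := long i li; rewrite -(@att_comp _ G a (b i)); first exact: ipath_att ip bq.
    case: (eqVneq i j) => [->|ij]; first exact: comp_refl.
    apply: (comp_step (u := b j)); [exact: bfar|exact: comp_refl|exact: bfar|].
    by apply: tr; rewrite eq_sym.
  have ij : i != j by apply: contraNneq ni => ->.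
  have exb : x i = b i.
    have [q' [eq lb _]] := hx i; move: ni (cp i).2; rewrite eq /=; case: (q') lb => //=.
  have [q' [_ _ ip]] := hx i.
  apply/attP; split; [by have := ip => /and4P[]|exact: bfar|].
  by exists (b j); [exact: comp_refl|rewrite exb; apply: tr].
pose i0 := @Ordinal 3 0 isT; pose i1 := @Ordinal 3 1 isT; pose i2 := @Ordinal 3 2 isT.
have := nocl a (b j) (x i0) (x i1) (x i2); rewrite /claw_attached !at_ /stable3.
have [-> ->] := nx i0 i1 isT; have [-> ->] := nx i0 i2 isT.
by have [-> ->] := nx i1 i2 isT.
Qed.

Lemma hole_att x h1 R h2 v : hole G (x :: h1 :: rcons R h2) -> v \in R ->
  att G x v h1 /\ att G x v h2.
Proof.
move=> hh vR; have [ip _ xh1 xh2 xo] := hole_consP hh; rewrite /= last_rcons in xh2 xo.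
have Rn : R != [::] by case: (R) vR.
have [cR h1R h2R s1 s2] := ipath_inner ip Rn.
have := hole_uniq hh; rewrite cons_uniq in_cons mem_rcons in_cons !negb_or.
case/andP=> /and3P[_ _ xR] _.
have Rfar w : w \in R -> w \in far G x.
  move=> wR; rewrite inE; apply/andP; split; first by apply: contraNneq xR => <-.
  apply/negP=> xw; have ws : w \in h1 :: rcons R h2 by rewrite inE mem_rcons inE wR !orbT.
  by case: (xo w ws xw) => e; [rewrite -e wR in h1R|rewrite -e wR in h2R].
have RK w : w \in R -> w \in component G x v.
  move=> wR; apply: (comp_conn (u := v) cR).
  - by apply/subsetP=> u; rewrite in_set; apply: Rfar.
  - by rewrite in_set.
  - by rewrite in_set.
  - exact: comp_refl.
have aux h : G x h -> sees G [set w in R] h -> att G x v h.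
  move=> xh /seesP[w]; rewrite in_set => wR hw; apply/attP; split=> //; first exact: Rfar.
  by exists w => //; apply: RK.
by split; apply: aux.
Qed.

(** Around [x], the nodes [h1] and [h2] are attached to the component of [R], and [c] is a bypass
    between them. *)
Lemma no_three_consecutive x h1 R h2 c : hole G (x :: h1 :: rcons R h2) -> R != [::] ->
  c \notin x :: h1 :: rcons R h2 -> G c x -> G c h1 -> G c h2 -> False.
Proof.
move=> hh Rn ch cx ch1 ch2; have [n12 h12] := hole_ends hh Rn.
have [v vR] : exists v, v \in R by case: (R) Rn => // v R' _; exists v; rewrite mem_head.
have [a1 a2] := hole_att hh vR.
have := nobp x v h1 h2; rewrite /bypass a1 a2 n12 h12 /= => /negP[].
have ao w : att G x v w -> w \in outside G x v.
  move=> h; rewrite inE (att_notin h) andbT; case/attP: h => xw _ _.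
  by apply: contraTneq xw => ->; rewrite adj_irr.
have co : c \in outside G x v.
  rewrite inE; apply/andP; split; first by apply: contraTneq cx => ->; rewrite adj_irr.
  apply/negP=> /comp_far; case/attP: a1 => _ vf _ /(_ vf) /far_adj.
  by rewrite adj_sym cx.
by apply: (@connect_trans _ _ c); apply: connect1; rewrite /rst co !ao //= adj_sym.
Qed.

(** If [c] saw a node [v] of [R], then [h1], [h2] and [c] would be pairwise nonadjacent and
    attached, around [x], to the component of [v]. *)
Lemma no_isolated x h1 R h2 c : hole G (x :: h1 :: rcons R h2) ->
  c \notin x :: h1 :: rcons R h2 -> G c x -> ~~ G c h1 -> ~~ G c h2 -> ~~ has (G c) R.
Proof.
move=> hh ch cx ch1 ch2; apply/negP=> /hasP[v vR cv].
have Rn : R != [::] by case: (R) vR.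
have [n12 h12] := hole_ends hh Rn; have [a1 a2] := hole_att hh vR.
have vf : v \in far G x by case/attP: a1.
have := nocl x v h1 h2 c; rewrite /claw_attached a1 a2 /stable3 n12 h12 /=.
have ne h : h \in x :: h1 :: rcons R h2 -> h != c by move=> hH; apply: contraNneq ch => <-.
rewrite !ne ?inE ?mem_rcons ?inE ?eqxx ?orbT //= !(adj_sym G _ c) ch1 ch2 !andbT.
move=> /negP[]; apply/attP; split=> //; first by rewrite adj_sym.
by exists v => //; apply: comp_refl.
Qed.

(** On the side [false], two nonadjacent nodes would form with [g c x] three pairwise nonadjacent
    attached nodes. *)
Lemma cutset_clique c x b u w : u \in cutset G (g c x) x c b ->
  w \in cutset G (g c x) x c b -> u != x -> w != x -> (u == w) || G u w.
Proof.
rewrite !in_setU1 !in_set => /orP[->//|/andP[hu eu]] /orP[/eqP->|/andP[hw ew]] nux nwx.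
  by rewrite eqxx in nwx.
have hg := gP hu; move/eqP: eu ew => <-; case: (eqVneq u w) => //= nuw.
case: (boolP ((u == g c x) || G (g c x) u)) => [/orP[/eqP eu|gu]|nu]; rewrite ?eqb_id ?eqbF_neg.
- by case/orP=> [/eqP ew|]; [rewrite eu ew eqxx in nuw|rewrite eu].
- case/orP=> [/eqP->|gw]; first by rewrite adj_sym.
  by apply: (att_trans_of nobp hu hg hw) => //; rewrite adj_sym.
rewrite negb_or => /andP[nwg gw].
move: nu; rewrite negb_or => /andP[nug gu].
have := att_two_of nocl hg hu hw; rewrite eq_sym => /(_ nug gu).
rewrite (negbTE nwg) [w == u]eq_sym (negbTE nuw) [G w _]adj_sym (negbTE gw) /=.
by rewrite adj_sym.
Qed.

(** A good cut meets both [y0 :: rcons p y1] and [y2 :: rcons r y3]. The cutset is a clique, so the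
    two nodes met are adjacent, and on the hole they can only be [y0] and [y3], or [y1] and [y2].
    Then the centre [x] of the cut sees two adjacent attached nodes, against admissibility. *)
Lemma paired_wheel c y0 p y1 y2 r y3 v : hole G (y0 :: p ++ y1 :: y2 :: rcons r y3) ->
  {subset p <= component G c v} -> {subset r <= component G c v} -> p != [::] -> r != [::] ->
  att G c v y0 -> att G c v y1 -> att G c v y2 -> att G c v y3 -> ~~ G y0 y1 -> False.
Proof.
move=> hh pK rK pn rn a0 a1 a2 a3 y01.
have [ip _ _ _ y0o] := hole_consP hh.
have un := hole_uniq hh.
have n01 : y0 != y1.
  by move: un => /andP[+ _]; rewrite mem_cat inE !negb_or => /and3P[].
have [x xK /andP[adm sep]] : exists2 x, x \in component G c v & good_cut G g c x.
  case: cl => _ _; apply; apply/existsP; exists y0; apply/existsP; exists y1.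
  by rewrite a0 a1 negb_or n01.
have [b {}sep] : exists b, separates G c x (cutset G (g c x) x c b).
  by case/orP: sep; [exists true|exists false].
pose W := cutset G (g c x) x c b.
have inF u : (u \in region G c x W) = (u \notin W) && ((u \in component G c v) || att G c v u).
  by rewrite in_setD in_set (comp_eq xK) (att_comp _ xK).
have hit z z' q : q != [::] -> att G c v z -> att G c v z' -> {subset q <= component G c v} ->
    ipath G (z :: rcons q z') -> exists2 w, w \in z :: rcons q z' & w \in W.
  move=> qn az az' qK ipq; apply/hasP; apply: contraT => /hasPn nW.
  have zz' : ~~ ((z == z') || G z z').
    case: q qn qK ipq nW => // w q _ _ ipq _; rewrite negb_or; apply/andP; split.
      by have := ipath_uniq ipq => /andP[+ _]; rewrite inE mem_rcons inE !negb_or => /and3P[].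
    by apply: (@ipath_far _ G [:: z] w (rcons q z')); rewrite ?mem_head // mem_rcons mem_head.
  case/negP: sep; apply/existsP; exists z; apply/existsP; exists z'.
  have zW : z \notin W by apply: nW; rewrite mem_head.
  have z'W : z' \notin W by apply: nW; rewrite inE mem_rcons mem_head orbT.
  rewrite /crossed !(att_comp _ xK) az az' zW z'W zz' /=.
  have cq := conn_ipath ipq; have := cq z z'; rewrite !in_set mem_head inE mem_rcons mem_head orbT.
  move=> /(_ isT isT); apply: connect_rstS; apply/subsetP=> w; rewrite in_set => wq.
  rewrite inF nW //=; move: wq; rewrite inE mem_rcons inE => /or3P[/eqP->|/eqP->|/qK->//].
    by rewrite az orbT.
  by rewrite az' orbT.
have ip1 : ipath G (y0 :: rcons p y1).
  have := hole_rot (size (y0 :: p ++ [:: y1, y2 & r])) hh.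
  rewrite -[X in rot _ (_ :: X)]/(p ++ (rcons [:: y1, y2 & r] y3)) -rcons_cat -rcons_cons.
  rewrite -cats1 rot_size_cat => /hole_consP[ip3 _ _ _ _].
  by move: ip3; rewrite -cat_rcons -cat_cons => /ipath_catl.
have ip2 : ipath G (y2 :: rcons r y3).
  by move: ip; rewrite -cat_rcons => /ipath_catr.
have [w1 w1p w1W] := hit y0 y1 p pn a0 a1 pK ip1.
have [w2 w2r w2W] := hit y2 y3 r rn a2 a3 rK ip2.
have done_ u u' : att G c v u -> att G c v u' -> u \in W -> u' \in W -> G u u' -> False.
  move=> au au' uW u'W uu'.
  have nx w : att G c v w -> w != x by move=> h; apply: contraTneq xK => <-; apply: att_notin.
  have Wx w : att G c v w -> w \in W -> G x w.
    move=> h; rewrite in_setU1 (negbTE (nx w h)) /= in_set => /andP[/attP[]//].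
  case/negP: adm; apply/existsP; exists u; apply/existsP; exists u'.
  by rewrite !(att_comp _ xK) au au' uu' !Wx.
have dis w : w \in y0 :: rcons p y1 -> w \in y2 :: rcons r y3 -> False.
  move=> h1 h2; move: un; rewrite -cat_rcons -cat_cons cat_uniq => /and3P[_ /negP nh _].
  by apply: nh; apply/hasP; exists w.
have ww : G w1 w2.
  have n12 : w1 != w2 by apply/eqP=> e; apply: (dis w1) => //; rewrite e.
  have Wx w : w \in W -> w != x -> G x w.
    by move=> + nwx; rewrite in_setU1 (negbTE nwx) /= in_set => /andP[/attP[]].
  case: (eqVneq w1 x) => [e|n1]; first by rewrite e Wx // -e eq_sym.
  case: (eqVneq w2 x) => [e|n2]; first by rewrite e adj_sym Wx.
  by have := cutset_clique w1W w2W n1 n2; rewrite (negbTE n12).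
move: (w1p); rewrite inE => /orP[/eqP e|w1p'].
  subst w1; have w2s : w2 \in p ++ [:: y1, y2 & rcons r y3].
    by rewrite -cat_rcons mem_cat w2r orbT.
  have [e|e] := y0o w2 w2s ww.
    exfalso; apply: (dis w2) w2r; rewrite e; case: (p) pn => //= w q _.
    by rewrite !inE eqxx orbT.
  rewrite last_cat /= last_rcons in e; subst w2; exact: (done_ y0 y3).
have [_ /(_ ww)[e1 e2]] := ipath_cross ip w1p' w2r.
by subst w1 w2; exact: (done_ y1 y2).
Qed.

(** A hub that sees the whole rim is excluded by [no_three_consecutive]; otherwise take the sector
    around a rim node [w] that the hub does not see. The third neighbour of the hub lies in [r]. *)
Lemma wheel_sector h c : hole G h -> c \notin h -> 3 <= count (G c) h ->
  exists y0 p y1 r, hole G (y0 :: p ++ y1 :: r) /\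
   [/\ c \notin y0 :: p ++ y1 :: r, p != [::], ~~ has (G c) p, G c y0 /\ G c y1 & has (G c) r].
Proof.
move=> hh ch cnt.
have [/allP ac|] := boolP (all (G c) h).
  case: h hh ch cnt ac => [|x [|h1 s]] hh ch cnt ac; try by case: hh.
  have [_ + _ _ _] := hole_consP hh; case/lastP: s hh ch cnt ac => // R h2 hh ch cnt ac sz.
  exfalso; apply: (no_three_consecutive hh _ ch); try apply: ac.
  - by move: sz; rewrite /= size_rcons; case: (R).
  - by rewrite mem_head.
  - by rewrite !inE eqxx orbT.
  - by rewrite !inE mem_rcons mem_head !orbT.
case/allPn=> w wh cw; have [s [hs es ps]] := hole_at hh wh.
have cs : 3 <= count (G c) s.
  by move: cnt; rewrite -(permP ps) /= (negbTE cw).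
have cn : c \notin w :: s by rewrite es.
have /split_first[p2 [y1 [s' [e1 cy1 np2]]]] : has (G c) s by rewrite has_count; apply: leq_trans cs.
subst s; rewrite count_cat /= cy1 in cs.
have c0 q : ~~ has (G c) q -> count (G c) q = 0 by rewrite has_count -eqn0Ngt => /eqP.
rewrite (c0 _ np2) in cs.
have /split_last[r [y0 [p1 [e2 cy0 np1]]]] : has (G c) s'.
  by rewrite has_count; move: cs; rewrite add0n add1n ltnS; apply: leq_trans.
subst s'; rewrite count_cat /= cy0 (c0 _ np1) in cs.
exists y0, (p1 ++ w :: p2), y1, r.
have eH : rot (size (w :: p2 ++ y1 :: r)) (w :: p2 ++ y1 :: r ++ y0 :: p1) =
    y0 :: (p1 ++ w :: p2) ++ y1 :: r.
  rewrite -[w :: p2 ++ y1 :: r ++ y0 :: p1]/((w :: p2) ++ (y1 :: r) ++ y0 :: p1).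
  by rewrite catA rot_size_cat /= -catA.
split; first by rewrite -eH; apply: hole_rot.
split.
- by rewrite -eH mem_rot.
- by case: (p1).
- by rewrite has_cat /= negb_or np1 negb_or cw.
- by [].
- by rewrite has_count; lia.
Qed.

(** Let K be the component of the sector [p]. Since there is no bypass between [y0] and [y1], K
    meets the rest of the hole at some [w]; let [y2] and [y3] be the ends of the sector of [w]. They
    differ from [y1] and [y0] respectively by [no_isolated]. Condition (1) then makes [y1] adjacent
    to [y2] and [y0] adjacent to [y3], which is the situation of [paired_wheel]. *)
Lemma clean_no_wheel : ~ wheel_in G.
Proof.
case=> h [c [hh0 ch0 cnt]].
have [y0 [p [y1 [r [hh [ch pn np [cy0 cy1] hr]]]]]] := wheel_sector hh0 ch0 cnt.
have [ip sz _ _ y0o] := hole_consP hh; have un := hole_uniq hh.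
have rn : r != [::] by case: (r) hr.
have cne w : w \in y0 :: p ++ y1 :: r -> w != c by move=> wH; apply: contraNneq ch => <-.
have y01 : ~~ G y0 y1.
  apply/negP=> h1; have := y0o y1; rewrite mem_cat mem_head orbT => /(_ isT h1).
  move: un; rewrite /= => /andP[_]; rewrite cat_uniq => /and3P[_ + /andP[+ _]].
  rewrite /= negb_or => /andP[y1p _] y1r; case=> e.
    by move: y1p; rewrite e; case: (p) pn => //= z q _; rewrite mem_head.
  move: y1r; rewrite e last_cat /=; case: (r) rn => //= z q _.
  by rewrite mem_last.
have [[cp y0p y1p sp0 sp1] [cr y0r y1r sr0 sr1] apr] := hole_arcs hh y01.
have n01 : y0 != y1.
  by move: un => /andP[+ _]; rewrite mem_cat inE !negb_or => /and3P[].
have inHp w : w \in p -> w \in y0 :: p ++ y1 :: r by move=> wp; rewrite inE mem_cat wp !orbT.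
have inHr w : w \in r -> w \in y0 :: p ++ y1 :: r by move=> wp; rewrite inE mem_cat inE wp !orbT.
have farc w : w \in y0 :: p ++ y1 :: r -> ~~ G c w -> w \in far G c.
  by move=> wH cw; rewrite inE cne.
have pc w : w \in p -> ~~ G c w by move=> wp; apply: contra np => h1; apply/hasP; exists w.
have [v vp] : exists v, v \in p by case: (p) pn => // z q _; exists z; rewrite mem_head.
have vf : v \in far G c by apply: farc; [exact: inHp|exact: pc].
have pK : {subset p <= component G c v}.
  move=> w wp; apply: (comp_conn (u := v) cp).
  - by apply/subsetP=> z; rewrite in_set => zp; apply: farc; [exact: inHp|exact: pc].
  - by rewrite in_set.
  - by rewrite in_set.
  - exact: comp_refl.
have attp y : G c y -> sees G [set w in p] y -> att G c v y.
  move=> cy /seesP[w]; rewrite in_set => wp yw; apply/attP; split=> //.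
  by exists w => //; apply: pK.
have at0 := attp _ cy0 sp0; have at1 := attp _ cy1 sp1.
have atO w : att G c v w -> w \in outside G c v.
  move=> h1; rewrite inE (att_notin h1) andbT; case/attP: h1 => cw _ _.
  by apply: contraTneq cw => ->; rewrite adj_irr.
have [/hasP[w wr wK]|nK] := boolP (has (fun w => w \in component G c v) r); last first.
  have := nobp c v y0 y1; rewrite /bypass at0 at1 n01 y01 /= => /negP[].
  have rO z : z \in r -> z \in outside G c v.
    move=> zr; rewrite inE cne ?inHr //=.
    by apply: contra nK => h1; apply/hasP; exists z.
  case/seesP: sr0 => u0; rewrite in_set => u0r y0u0.
  case/seesP: sr1 => u1; rewrite in_set => u1r y1u1.
  apply: (@connect_trans _ _ u0).
    by apply: connect1; apply/and3P; split; [exact: atO|exact: rO|].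
  apply: (@connect_trans _ _ u1).
    have := cr u0 u1; rewrite !in_set => /(_ u0r u1r).
    by apply: connect_rstS; apply/subsetP=> z; rewrite in_set => /rO.
  by apply: connect1; apply/and3P; split; [exact: rO|exact: atO|rewrite adj_sym].
have cw : ~~ G c w by apply: far_adj; apply: comp_far wK.
case/splitPr: wr hh ip sz y0o un hr rn ch cne y0r y1r cr sr0 sr1 apr inHr farc inHp
  => r1 r2 hh ip sz y0o un hr rn ch cne y0r y1r cr sr0 sr1 apr inHr farc inHp.
have [l1 [y2 [l2 [el cy2 nl2]]]] : exists l1 w' l2, [/\ y1 :: r1 = l1 ++ w' :: l2, G c w' & ~~ has (G c) l2].
  by apply: split_last; rewrite /= cy1.
have [f1 [y3 [f2 [ef cy3 nf1]]]] : exists l1 w' l2, [/\ rcons r2 y0 = l1 ++ w' :: l2, G c w' & ~~ has (G c) l1].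
  by apply: split_first; rewrite has_rcons cy0.
have hh' : hole G (y1 :: (r1 ++ w :: r2) ++ y0 :: p).
  by have := hole_rot (size (y0 :: p)) hh; rewrite -cat_cons rot_size_cat.
have [ip' _ _ _ _] := hole_consP hh'.
have wH : w \in y0 :: p ++ y1 :: r1 ++ w :: r2 by apply: inHr; rewrite mem_cat mem_head orbT.
have sub_comp q z : conn G [set z in q] -> w \in q -> {subset q <= y0 :: p ++ y1 :: r1 ++ w :: r2} ->
    {in q, forall z, ~~ G c z} -> z \in q -> z \in component G c v.
  move=> cq wq sq nq zq; apply: (comp_conn (u := w) cq) wK; rewrite ?in_set //.
  by apply/subsetP=> u; rewrite in_set => uq; apply: farc; [exact: sq|exact: nq].
have ipl : ipath G (y1 :: r1 ++ w :: r2) := ipath_catr ip.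
have l2c : {in rcons l2 w, forall z, ~~ G c z}.
  move=> z; rewrite mem_rcons inE => /orP[/eqP->//|zl].
  by apply: contra nl2 => h1; apply/hasP; exists z.
have ipl2 : ipath G (y2 :: rcons l2 w).
  have : ipath G ((y1 :: r1) ++ w :: r2) by [].
  by rewrite el -catA => /ipath_catr; rewrite -cat_rcons => /ipath_catl.
have l2K : {subset rcons l2 w <= component G c v}.
  move=> z; apply: sub_comp l2c; rewrite ?mem_rcons ?mem_head //.
    by apply: conn_ipath; apply: (ipath_behead ipl2).
  move=> u; rewrite mem_rcons inE => /orP[/eqP->//|ul].
  have : u \in y1 :: r1 by rewrite el mem_cat inE ul !orbT.
  by rewrite !inE !mem_cat !inE mem_cat => /orP[->|->]; rewrite !orbT.
have at2 : att G c v y2.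
  apply/attP; split=> //; move: ipl2 l2K; case: (l2) => [|z q] /and4P[y2z _ _ _] lK.
    by exists w; rewrite ?lK ?mem_head.
  by exists z; rewrite ?lK //= ?mem_head.
have ipf : ipath G (w :: f1 ++ y3 :: f2).
  have : ipath G (r1 ++ (w :: rcons r2 y0) ++ p).
    by rewrite -rcons_cons cat_rcons catA.
  by rewrite ef => /ipath_catr/ipath_catl.
have f1c : {in w :: f1, forall z, ~~ G c z}.
  move=> z; rewrite inE => /orP[/eqP->//|zl].
  by apply: contra nf1 => h1; apply/hasP; exists z.
have f1K : {subset w :: f1 <= component G c v}.
  move=> z; apply: sub_comp f1c; rewrite ?mem_head //.
    by apply: conn_ipath; move: ipf; rewrite -cat_cons => /ipath_catl.
  move=> u; rewrite inE => /orP[/eqP->//|ul].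
  have : u \in rcons r2 y0 by rewrite ef mem_cat ul.
  by rewrite mem_rcons !inE !mem_cat inE mem_cat inE => /orP[->|->]; rewrite ?orbT.
have at3 : att G c v y3.
  apply/attP; split=> //; exists (last w f1); first by apply: f1K; rewrite mem_last.
  move: ipf; rewrite -cat_cons lastI cat_rcons => /ipath_next; by rewrite adj_sym.
(* If [y2] is [y1], the hub sees neither hole neighbour of [y1], yet it sees [y0]. *)
case: l1 el => [[e2 e1]|z l1 [ez er1]].
  subst y2 l2; have [h1 [q eq]] : exists h1 q, r1 ++ w :: r2 = h1 :: q.
    by case: (r1) => [|z q]; [exists w, r2|exists z, (q ++ w :: r2)].
  have cn' : c \notin y1 :: (r1 ++ w :: r2) ++ y0 :: p.
    by move: ch; rewrite -(mem_rot (size (y0 :: p))) -cat_cons rot_size_cat.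
  case/lastP: p pn pc hh' cn' {hh ip ip' sz y0o un np ch cne y0p y1p cp sp0 sp1 apr inHr inHp farc vp pK attp wH sub_comp l2K f1K} => // p' h2 _ pc hh' cn'.
  move: hh' cn'; rewrite eq cat_cons -rcons_cons -rcons_cat => hh' cn'.
  have := no_isolated hh' cn' cy1; rewrite has_cat /= cy0 orbT => H.
  have : ~~ G c h1.
    case: (r1) eq l2c => [|z q'] [<- _] l2c //.
    by apply: l2c; rewrite mem_rcons inE mem_head orbT.
  move=> /H; have : ~~ G c h2 by apply: pc; rewrite mem_rcons mem_head.
  by move=> n2 /(_ n2).
subst z.
case/lastP: f2 ef ipf => [|f2 z] ef ipf.
  have [e1 e2] := rcons_inj (etrans ef (cats1 f1 y3)).
  subst f1 y3; have [h2 [q eq]] : exists h2 q, w :: r2 = rcons q h2.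
    by exists (last w r2), (belast w r2); rewrite -lastI.
  have nh2 : ~~ G c h2 by apply: f1c; rewrite eq mem_rcons mem_head.
  case: (p) pn pc hh ch => // h1 p' _ pc hh ch.
  move: hh ch; rewrite eq cat_cons -rcons_cat -rcons_cons -rcons_cat => hh ch.
  have := no_isolated hh ch cy0 (pc h1 (mem_head _ _)) nh2.
  by rewrite has_cat /= cy1 orbT.
have [er2 ez] : (r2, y0) = (f1 ++ y3 :: f2, z).
  by apply: rcons_inj; rewrite ef rcons_cat rcons_cons.
subst z r2 r1.
have y1y3 : ~~ G y1 y3.
  have := @ipath_far _ G (y1 :: l1 ++ y2 :: l2) w (f1 ++ y3 :: f2) y1 y3.
  by apply=> //; rewrite ?mem_head // mem_cat mem_head orbT.
have neq z z' q1 q2 q3 : y0 :: p ++ y1 :: (l1 ++ y2 :: l2) ++ w :: f1 ++ y3 :: f2 =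
    q1 ++ z :: q2 ++ z' :: q3 -> z != z'.
  move=> e; move: un; rewrite e cat_uniq /= mem_cat inE !negb_or.
  by case/and4P=> _ _ /and3P[].
have n02 : y0 != y2 by apply: (neq _ _ [::] (p ++ y1 :: l1) (l2 ++ w :: f1 ++ y3 :: f2)); rewrite ?(=^~ catA, cat_cons, cat0s).
have n12 : y1 != y2 by apply: (neq _ _ (y0 :: p) l1 (l2 ++ w :: f1 ++ y3 :: f2)); rewrite ?(=^~ catA, cat_cons, cat0s).
have n03 : y0 != y3.
  by apply: (neq _ _ [::] (p ++ y1 :: (l1 ++ y2 :: l2) ++ w :: f1) f2); rewrite ?(=^~ catA, cat_cons, cat0s).
have n13 : y1 != y3.
  by apply: (neq _ _ (y0 :: p) ((l1 ++ y2 :: l2) ++ w :: f1) f2); rewrite ?(=^~ catA, cat_cons, cat0s).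
have inT z : z \in (l1 ++ y2 :: l2) ++ w :: f1 ++ y3 :: f2 ->
    z \in p ++ y1 :: (l1 ++ y2 :: l2) ++ w :: f1 ++ y3 :: f2.
  by move=> zin; rewrite mem_cat inE zin !orbT.
have nothead z : z \in (l1 ++ y2 :: l2) ++ w :: f1 ++ y3 :: f2 ->
    z <> head y0 (p ++ y1 :: (l1 ++ y2 :: l2) ++ w :: f1 ++ y3 :: f2).
  move=> zin e; have zp : z \in p by rewrite e; case: (p) pn => //= u q _; rewrite mem_head.
  move: un; rewrite cons_uniq cat_uniq => /andP[_ /and3P[_ /hasPn nh _]].
  by have := nh z; rewrite inE zin orbT zp => /(_ isT).
have y02 : ~~ G y0 y2.
  apply/negP=> y02; have y2in : y2 \in (l1 ++ y2 :: l2) ++ w :: f1 ++ y3 :: f2.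
    by rewrite !mem_cat mem_head orbT.
  have [/(nothead y2 y2in)//|e] := y0o y2 (inT y2 y2in) y02.
  move: e; rewrite last_cat /= last_cat /= last_cat /= => e.
  have [q1 [q2 eq]] : exists q1 q2, y3 :: f2 = q1 ++ last y3 f2 :: q2.
    by exists (belast y3 f2), [::]; rewrite cats1 -lastI.
  have := neq y2 y2 (y0 :: p ++ y1 :: l1) (l2 ++ w :: f1 ++ q1) q2.
  rewrite eqxx eq -e => H; have : ~~ true by apply: H; rewrite ?(=^~ catA, cat_cons, cat0s).
  by [].
have y12 : G y1 y2.
  apply: contraT => y12; have := nocl c v y0 y1 y2.
  by rewrite /claw_attached at0 at1 at2 /stable3 n01 n02 n12 y01 y02 y12.
have y03 : G y0 y3.
  apply: contraT => y03; have := nocl c v y0 y1 y3.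
  by rewrite /claw_attached at0 at1 at3 /stable3 n01 n03 n13 y01 y03 y1y3.
have l10 : l1 = [::].
  case: (l1) ipl => // u q ipl.
  have := @ipath_far _ G [:: y1] u (q ++ y2 :: l2) y1 y2; rewrite y12 mem_head => H.
  have : ~~ true; last by [].
  apply: H => //; last by rewrite mem_cat mem_head orbT.
  exact: (@ipath_catl _ G ([:: y1] ++ u :: q ++ y2 :: l2) (w :: f1 ++ y3 :: f2) ipl).
have f20 : f2 = [::].
  have y3in : y3 \in (l1 ++ y2 :: l2) ++ w :: f1 ++ y3 :: f2.
    by rewrite mem_cat in_cons [y3 \in f1 ++ _]mem_cat mem_head !orbT.
  have [/(nothead y3 y3in)//|] := y0o y3 (inT y3 y3in) y03.
  rewrite last_cat /= last_cat /= last_cat /=; case/lastP: (f2) neq => // q z neq.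
  rewrite last_rcons => e; subst z.
  have := neq y3 y3 (y0 :: p ++ y1 :: (l1 ++ y2 :: l2) ++ w :: f1) q [::].
  rewrite eqxx => H; have : ~~ true by apply: H; rewrite -cats1 ?(=^~ catA, cat_cons, cat0s).
  by [].
subst l1 f2; apply: (@paired_wheel c y0 p y1 y2 (l2 ++ w :: f1) y3 v) => //.
- by move: hh; rewrite /= rcons_cat /= cats1.
- move=> z; rewrite mem_cat => /orP[zl|]; last exact: f1K.
  by apply: l2K; rewrite mem_rcons inE zl orbT.
- by case: (l2).
Qed.

Theorem clean_tame : tame G.
Proof.
by split; [exact: clean_no_theta|exact: clean_no_wheel|exact: clean_no_pyramid].
Qed.

End Clean.

Theorem tame_clean g : witness G g -> tame G <-> clean g.
Proof.
move=> gP; split=> [tG|]; last exact: clean_tame.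
split; [exact: no_claw_attached|exact: no_bypass|].
by move=> c z; apply: needs_cut_good.
Qed.

End Completeness.

(** * A small imperative language on the machine *)

(* [Var] refers to the loop counters and local bindings by de Bruijn level.
   [CFor true] loops over the nodes, [CFor false] over the edges, and [Endpoint]
   reads an end of an edge given by its rank in the input. *)
Inductive atom :=
| Lit of nat
| Var of nat
| Cell of nat & atom & atom & atom
| Endpoint of bool & atom.

Inductive cond :=
| CEq of atom & atom
| CLt of atom & atom
| CNot of cond
| CAnd of cond & cond
| COr of cond & cond.

Inductive cmd :=
| CSkip
| CSet of nat & atom & atom & atom & atom
| CSeq of cmd & cmd
| CIf of cond & cmd & cmd
| CLet of atom & cmd
| CFor of bool & cmd.

Definition state := nat -> nat -> nat -> nat -> nat.

Definition upd (s : state) id i j k x : state := fun id' i' j' k' =>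
  if [&& id' == id, i' == i, j' == j & k' == k] then x else s id' i' j' k'.

(* Registers are the cells 16 * d, the array [id] occupies cells congruent to [id]. *)
Definition width : nat := 16.

Section Syntax.

(** Literals are kept below 2 so that they are smaller than the side of the arrays for every
    input. *)
Fixpoint wf_atom d a :=
  match a with
  | Lit k => k < 2
  | Var i => i < d
  | Cell id a b c => [&& 0 < id < width, wf_atom d a, wf_atom d b & wf_atom d c]
  | Endpoint _ a => wf_atom d a
  end.

Fixpoint wf_cond d c :=
  match c with
  | CEq a b | CLt a b => wf_atom d a && wf_atom d b
  | CNot c => wf_cond d c
  | CAnd c1 c2 | COr c1 c2 => wf_cond d c1 && wf_cond d c2
  end.

Fixpoint wf_cmd d c :=
  match c with
  | CSkip => true
  | CSet id a1 a2 a3 x =>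
      [&& 0 < id < width, wf_atom d a1, wf_atom d a2, wf_atom d a3 & wf_atom d x]
  | CSeq c1 c2 => wf_cmd d c1 && wf_cmd d c2
  | CIf e c1 c2 => [&& wf_cond d e, wf_cmd d c1 & wf_cmd d c2]
  | CLet a c => wf_atom d a && wf_cmd d.+1 c
  | CFor _ c => wf_cmd d.+1 c
  end.

(** Its value [n + m + 2] exceeds every number of the input and every number stored, so it can serve
    as the side of the three-dimensional arrays. *)
Definition base_expr := Add (Add (Input (Const 0)) (Input (Const 1))) (Const 2).

Definition address id e1 e2 e3 :=
  Add (Mul (Add (Mul (Add (Mul e1 base_expr) e2) base_expr) e3) (Const width)) (Const id).

Fixpoint of_atom a :=
  match a with
  | Lit k => Const k
  | Var i => Defs.Mem (Const (i * width))
  | Cell id a b c => Defs.Mem (address id (of_atom a) (of_atom b) (of_atom c))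
  | Endpoint o a => Input (Add (Const (2 + o)) (Mul (Const 2) (of_atom a)))
  end.

(** Any nonzero value is true: conjunction is a product, disjunction a sum, and negation the
    truncated difference from 1. *)
Fixpoint of_cond c :=
  match c with
  | CEq a b => Defs.Sub (Const 1) (Add (Defs.Sub (of_atom a) (of_atom b)) (Defs.Sub (of_atom b) (of_atom a)))
  | CLt a b => Defs.Sub (of_atom b) (of_atom a)
  | CNot c => Defs.Sub (Const 1) (of_cond c)
  | CAnd c1 c2 => Mul (of_cond c1) (of_cond c2)
  | COr c1 c2 => Add (of_cond c1) (of_cond c2)
  end.

Definition reg d := Const (d * width).
Definition loop_test (b : bool) d := Defs.Sub (Input (Const (~~ b))) (Defs.Mem (reg d)).
Definition loop_incr d := Assign (reg d) (Add (Defs.Mem (reg d)) (Const 1)).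

Fixpoint compile d c :=
  match c with
  | CSkip => Skip
  | CSet id a1 a2 a3 x => Assign (address id (of_atom a1) (of_atom a2) (of_atom a3)) (of_atom x)
  | CSeq c1 c2 => Seq (compile d c1) (compile d c2)
  | CIf e c1 c2 => If (of_cond e) (compile d c1) (compile d c2)
  | CLet a c => Seq (Assign (reg d) (of_atom a)) (compile d.+1 c)
  | CFor b c =>
      Seq (Assign (reg d) (Const 0))
          (While (loop_test b d) (Seq (compile d.+1 c) (loop_incr d)))
  end.

(* The value of [e] is less than [(n + 2) ^ growth e]. *)
Fixpoint growth e :=
  match e with
  | Const k => k
  | Input _ | Defs.Mem _ => 2
  | Add e1 e2 => (maxn (growth e1) (growth e2)).+1
  | Defs.Sub e1 _ => growth e1
  | Mul e1 e2 => growth e1 + growth e2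
  end.

Fixpoint expr_growth e := maxn (growth e)
  match e with
  | Const _ => 0
  | Input e1 | Defs.Mem e1 => expr_growth e1
  | Add e1 e2 | Defs.Sub e1 e2 | Mul e1 e2 => maxn (expr_growth e1) (expr_growth e2)
  end.

Fixpoint program_growth p :=
  match p with
  | Skip => 0
  | Assign a e => maxn (expr_growth a) (expr_growth e)
  | Seq p1 p2 => maxn (program_growth p1) (program_growth p2)
  | If e p1 p2 => maxn (expr_growth e) (maxn (program_growth p1) (program_growth p2))
  | While e p => maxn (expr_growth e) (program_growth p)
  end.

End Syntax.

Section Semantics.
Variable inp : seq nat.
Local Notation n := (nth 0 inp 0).
Local Notation m := (nth 0 inp 1).
Let bound (b : bool) := nth 0 inp (~~ b).

Fixpoint aval (env : seq nat) (s : state) a :=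
  match a with
  | Lit k => k
  | Var i => nth 0 env i
  | Cell id a b c => s id (aval env s a) (aval env s b) (aval env s c)
  | Endpoint o a => nth 0 inp (2 + o + 2 * aval env s a)
  end.

Fixpoint cval env s c :=
  match c with
  | CEq a b => aval env s a == aval env s b
  | CLt a b => aval env s a < aval env s b
  | CNot c => ~~ cval env s c
  | CAnd c1 c2 => cval env s c1 && cval env s c2
  | COr c1 c2 => cval env s c1 || cval env s c2
  end.

Fixpoint run env c (s : state) : state :=
  match c with
  | CSkip => s
  | CSet id a1 a2 a3 x => upd s id (aval env s a1) (aval env s a2) (aval env s a3) (aval env s x)
  | CSeq c1 c2 => run env c2 (run env c1 s)
  | CIf e c1 c2 => if cval env s e then run env c1 s else run env c2 s
  | CLet a c => run (rcons env (aval env s a)) c s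
  | CFor b c => foldl (fun s k => run (rcons env k) c s) s (iota 0 (bound b))
  end.

(** An upper bound that counts both branches of a conditional. For a loop, 3 pays for setting the
    counter to 0, 12 for one successful test and one increment, 6 for the final test. *)
Fixpoint time d c :=
  match c with
  | CSkip => 1
  | CSet id a1 a2 a3 x => cost (address id (of_atom a1) (of_atom a2) (of_atom a3)) + cost (of_atom x) + 1
  | CSeq c1 c2 => time d c1 + time d c2
  | CIf e c1 c2 => cost (of_cond e) + time d c1 + time d c2 + 1
  | CLet a c => cost (of_atom a) + 2 + time d.+1 c
  | CFor b c => 3 + bound b * (time d.+1 c + 12) + 6
  end.

Section Compile.
Variable k : nat.
Let b := n + 2.
Let N := n + m + 2.
Let w := b ^ k.
Hypothesis small_inp : forall i, nth 0 inp i < N.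
Hypothesis small_N : N <= b ^ 2.

Let N_gt1 : 1 < N. Proof. by rewrite /N addn2. Qed.
Let b_gt1 : 1 < b. Proof. by rewrite /b addn2. Qed.

Definition cell id i j l := ((i * N + j) * N + l) * width + id.

(** The bound on all the cells, including those that encode nothing, is what keeps every expression
    within the word size. *)
Definition represents (env : seq nat) (s : state) (M : memory) : Prop :=
  [/\ forall i, i < size env -> M (i * width) = nth 0 env i,
      forall id i j l, 0 < id < width -> i < N -> j < N -> l < N -> M (cell id i j l) = s id i j l
    & forall a, M a < N].

(** Input and memory values are below [N], hence below the square of [b], which explains the
    exponent 2. As [b] is at least 2, one more factor absorbs a sum, and a constant [x] is below
    [b ^ x]. *)
Lemma growthP (M : memory) e : (forall a, M a < N) -> eval inp M e < b ^ growth e.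
Proof.
move=> MN; have lt2 x : x < N -> x < b ^ 2 by move=> h; apply: leq_trans small_N.
have b0 : 0 < b by apply: ltnW.
elim: e => [x|e _|e _|e1 IH1 e2 IH2|e1 IH1 e2 IH2|e1 IH1 e2 IH2] /=.
- by apply: leq_trans (ltn_expl x b_gt1) _.
- by apply: lt2.
- exact: lt2.
- have le1 : b ^ growth e1 <= b ^ maxn (growth e1) (growth e2) by rewrite leq_pexp2l // leq_maxl.
  have le2 : b ^ growth e2 <= b ^ maxn (growth e1) (growth e2) by rewrite leq_pexp2l // leq_maxr.
  have : 2 * b ^ maxn (growth e1) (growth e2) <= b ^ (maxn (growth e1) (growth e2)).+1.
    by rewrite expnS leq_mul2r b_gt1 orbT.
  by apply: leq_trans; move: (leq_trans IH1 le1) (leq_trans IH2 le2); lia.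
- by apply: leq_ltn_trans IH1; apply: leq_subr.
- rewrite expnD; apply: (@leq_ltn_trans (eval inp M e1 * b ^ growth e2)).
    by rewrite leq_mul2l ltnW ?orbT.
  by rewrite ltn_pmul2r // expn_gt0 b0.
Qed.

Lemma fits_growth (M : memory) e : (forall a, M a < N) -> expr_growth e <= k -> fits w inp M e.
Proof.
move=> MN.
have ok e' : growth e' <= k -> eval inp M e' < w.
  by move=> le; apply: leq_trans (growthP e' MN) _; rewrite leq_pexp2l // ltnW.
elim: e => [x|e IH|e IH|e1 IH1 e2 IH2|e1 IH1 e2 IH2|e1 IH1 e2 IH2];
  rewrite [expr_growth _]/= geq_max => /andP[h1 h2]; apply/andP; split;
  try exact: ok; try exact: IH; try by [];
  by move: h2; rewrite geq_max => /andP[h2 h3]; apply/andP; split; [exact: IH1|exact: IH2].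
Qed.

Lemma eval_address M id e1 e2 e3 : eval inp M (address id e1 e2 e3) =
  cell id (eval inp M e1) (eval inp M e2) (eval inp M e3).
Proof. by []. Qed.

Lemma eval_atom env s M a : represents env s M -> wf_atom (size env) a ->
  eval inp M (of_atom a) = aval env s a /\ aval env s a < N.
Proof.
move=> [rr ra rN]; elim: a => [x|i|id a IHa a' IHa' a'' IHa''|o a IH].
- by move=> /= x2; split=> //; apply: leq_trans N_gt1.
- by move=> /= i_lt; rewrite rr //; split=> //; rewrite -rr.
- move=> /and4P[hid /IHa[ea la] /IHa'[ea' la'] /IHa''[ea'' la'']].
  have e : eval inp M (of_atom (Cell id a a' a'')) = aval env s (Cell id a a' a'').
    by rewrite [LHS]/= -/(address _ _ _ _) -[X in M X]/(eval inp M (address id (of_atom a) (of_atom a') (of_atom a''))) eval_address ea ea' ea'' ra.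
  by rewrite -e; split=> //; apply: rN.
- by move=> /IH[e l]; split; [rewrite /= e|exact: small_inp].
Qed.

Lemma eval_cond env s M c : represents env s M -> wf_cond (size env) c ->
  (eval inp M (of_cond c) != 0) = cval env s c.
Proof.
move=> r; elim: c => [a a'|a a'|c IH|c1 IH1 c2 IH2|c1 IH1 c2 IH2] /=.
- by move=> /andP[/(eval_atom r)[-> _] /(eval_atom r)[-> _]]; lia.
- by move=> /andP[/(eval_atom r)[-> _] /(eval_atom r)[-> _]]; lia.
- by move=> /IH <-; lia.
- by move=> /andP[/IH1 <- /IH2 <-]; rewrite muln_eq0 negb_or.
- by move=> /andP[/IH1 <- /IH2 <-]; rewrite addn_eq0 negb_and.
Qed.

(** The address has the digits [i], [j], [l], [id] in a mixed radix; only the leading digit [i] may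
    be unbounded. *)
Lemma cell_inj id i j l id' i' j' l' : id < width -> id' < width ->
  j < N -> l < N -> j' < N -> l' < N -> cell id i j l = cell id' i' j' l' ->
  [/\ id = id', i = i', j = j' & l = l'].
Proof.
move=> h h' jN lN jN' lN'; rewrite /cell => e.
have key x y x' y' p : y < p -> y' < p -> x * p + y = x' * p + y' -> x = x' /\ y = y'.
  move=> yp yp' exy; have p0 : 0 < p by apply: leq_ltn_trans yp.
  split; last by have := congr1 (modn^~ p) exy; rewrite !modnMDl !modn_small.
  by have := congr1 (divn^~ p) exy; rewrite !divnMDl // !divn_small // !addn0.
have [e1 e2] := key _ _ _ _ _ h h' e.
have [e3 e4] := key _ _ _ _ _ lN lN' e1.
by have [e5 e6] := key _ _ _ _ _ jN jN' e3.
Qed.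

Lemma represents_set env s M id i j l x : represents env s M -> 0 < id < width ->
  i < N -> j < N -> l < N -> x < N ->
  represents env (upd s id i j l x) (update M (cell id i j l) x).
Proof.
move=> [rr ra rN] /andP[id0 idw] iN jN lN xN; split.
- move=> d dlt; rewrite /update; case: eqP => [e|_]; last exact: rr.
  have := congr1 (modn^~ width) e; rewrite modnMl /cell modnMDl modn_small // => e0.
  by rewrite -e0 in id0.
- move=> id' i' j' l' /andP[id0' idw'] iN' jN' lN'; rewrite /update /upd.
  case: eqP => [e|ne].
    by have [-> -> -> ->] := cell_inj idw' idw jN' lN' jN lN e; rewrite !eqxx.
  case: ifP => [/and4P[/eqP e1 /eqP e2 /eqP e3 /eqP e4]|_]; first by rewrite e1 e2 e3 e4 in ne.
  by rewrite ra // id0'.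
- by move=> a; rewrite /update; case: ifP.
Qed.

Lemma represents_reg env s M x : represents env s M -> x < N ->
  represents (rcons env x) s (update M (size env * width) x).
Proof.
move=> [rr ra rN] xN; split.
- move=> d; rewrite size_rcons ltnS leq_eqVlt /update nth_rcons => /orP[/eqP->|dlt].
    by rewrite eqxx ltnn eqxx.
  by rewrite dlt eqn_mul2r /= (ltn_eqF dlt) rr.
- move=> id i j l hid iN jN lN; rewrite /update; case: eqP => [e|_]; last exact: ra.
  have := congr1 (modn^~ width) e; rewrite modnMl /cell modnMDl.
  by case/andP: hid => h1 h2; rewrite modn_small // => e0; rewrite e0 in h1.
- by move=> a; rewrite /update; case: ifP.
Qed.

Lemma represents_unreg env s M x : represents (rcons env x) s M ->
  represents env s M /\ M (size env * width) = x.
Proof.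
move=> [rr ra rN]; split.
  split=> // i ilt; rewrite rr; last by rewrite size_rcons ltnW.
  by rewrite nth_rcons ilt.
by rewrite rr ?size_rcons // nth_rcons ltnn eqxx.
Qed.

(** Writing into a register the value that it already holds gives a memory that is only pointwise
    equal to the old one; this occurs when a loop counter becomes the top register of the body. *)
Lemma represents_ext env s M M' : M =1 M' -> represents env s M -> represents env s M'.
Proof. by move=> e [rr ra rN]; split=> *; rewrite -e ?rr ?ra. Qed.

Lemma compile_correct c env s M : wf_cmd (size env) c -> program_growth (compile (size env) c) <= k ->
  represents env s M -> exists M' t,
  [/\ exec w inp (compile (size env) c) M M' t, represents env (run env c s) M'
    & t <= time (size env) c].
Proof.
elim: c env s M => [|id a1 a2 a3 x|c1 IH1 c2 IH2|e c1 IH1 c2 IH2|a c IH|bn c IH] env s M.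
- by move=> _ _ r; exists M, 1; split=> //; constructor.
- move=> /and5P[hid w1 w2 w3 wx] /=; rewrite geq_max => /andP[g1 g2] r.
  have rN : forall a, M a < N by case: r.
  exists (update M (eval inp M (address id (of_atom a1) (of_atom a2) (of_atom a3))) (eval inp M (of_atom x))), (cost (address id (of_atom a1) (of_atom a2) (of_atom a3)) + cost (of_atom x)).+1.
  split; last by rewrite addn1.
    by apply: ExecAssign; apply: fits_growth.
  have [[e1 l1] [e2 l2]] := (eval_atom r w1, eval_atom r w2).
  have [[e3 l3] [ex lx]] := (eval_atom r w3, eval_atom r wx).
  by rewrite eval_address e1 e2 e3 ex; apply: represents_set.
- move=> /andP[w1 w2] /=; rewrite geq_max => /andP[g1 g2] r.
  have [M1 [t1 [x1 r1 l1]]] := IH1 env s M w1 g1 r.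
  have [M2 [t2 [x2 r2 l2]]] := IH2 env _ M1 w2 g2 r1.
  by exists M2, (t1 + t2); split; [apply: ExecSeq x1 x2|exact: r2|exact: leq_add].
- move=> /and3P[we w1 w2] /=; rewrite !geq_max => /and3P[ge g1 g2] r.
  have rN : forall a, M a < N by case: r.
  have fe := fits_growth rN ge; have ev := eval_cond r we.
  case: (boolP (cval env s e)) ev => _ ev.
    have [M1 [t1 [x1 r1 l1]]] := IH1 env s M w1 g1 r.
    exists M1, (cost (of_cond e) + t1).+1; split=> //; first by apply: ExecIfTrue.
    by lia.
  have [M1 [t1 [x1 r1 l1]]] := IH2 env s M w2 g2 r.
  exists M1, (cost (of_cond e) + t1).+1; split=> //; last by lia.
  by apply: ExecIfFalse => //; apply/eqP; move/negbFE: ev.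
- move=> /andP[wa wc]; rewrite [program_growth _]/= geq_max => /andP[ga gc] r.
  have rN : forall a, M a < N by case: r.
  have [ea la] := eval_atom r wa.
  move: ga; rewrite geq_max => /andP[gr gs].
  have xa := ExecAssign (fits_growth rN (gr : expr_growth (reg (size env)) <= k)) (fits_growth rN gs).
  rewrite ea in xa.
  have ra := represents_reg r la.
  have wc' : wf_cmd (size (rcons env (aval env s a))) c by rewrite size_rcons.
  have gc' : program_growth (compile (size (rcons env (aval env s a))) c) <= k by rewrite size_rcons.
  have [M1 [t1 [x1 r1 l1]]] := IH _ s _ wc' gc' ra.
  rewrite size_rcons in x1 l1.
  exists M1, ((cost (reg (size env)) + cost (of_atom a)).+1 + t1); split.
  + exact: ExecSeq xa x1.
  + by have [] := represents_unreg r1.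
  + by rewrite /=; lia.
- rewrite [wf_cmd _ _]/= => wc; set d := size env in wc *.
  have -> : program_growth (compile d (CFor bn c)) =
    maxn (maxn (expr_growth (reg d)) (expr_growth (Const 0)))
      (maxn (expr_growth (loop_test bn d))
        (maxn (program_growth (compile d.+1 c)) (program_growth (loop_incr d)))) by [].
  rewrite geq_max => /andP[ga]; rewrite geq_max => /andP[gt].
  rewrite geq_max => /andP[gc gi] r.
  have rN : forall a, M a < N by case: r.
  pose body := Seq (compile d.+1 c) (loop_incr d).
  have bnd_lt : bound bn < N by apply: small_inp.
  (* Induction on the number [j] of remaining rounds. The body runs with the counter [i] as last
     register, so [represents] after the body says that the counter still holds [i]. *)
  have loop : forall j i s M, i + j = bound bn -> represents env s M -> M (d * width) = i ->
    exists M' t, [/\ exec w inp (While (loop_test bn d) body) M M' t,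
      represents env (foldl (fun s k => run (rcons env k) c s) s (iota i j)) M'
      & t <= j * (time d.+1 c + 12) + 6].
    elim=> [|j IHj] i s1 M1 ij r1 Mi.
      exists M1, (cost (loop_test bn d)).+1; split=> //; apply: ExecWhileFalse.
        by apply: fits_growth => //; case: r1.
      by rewrite /= Mi -/(bound bn) -ij addn0 subnn.
    have iN : i < N by apply: leq_ltn_trans bnd_lt; rewrite -ij leq_addr.
    have r2 : represents (rcons env i) s1 M1.
      apply: represents_ext (represents_reg r1 iN) => z.
      by rewrite /update; case: eqP => // ->.
    have wc' : wf_cmd (size (rcons env i)) c by rewrite size_rcons.
    have gc' : program_growth (compile (size (rcons env i)) c) <= k by rewrite size_rcons.
    have [M3 [t3 [x3 r3 l3]]] := IH (rcons env i) s1 M1 wc' gc' r2.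
    rewrite size_rcons -/d in x3 l3.
    have [r4 M3i] := represents_unreg r3.
    have rN3 : forall a, M3 a < N by case: r4.
    have iN1 : i.+1 < N by apply: leq_ltn_trans bnd_lt; rewrite -ij addnS ltnS leq_addr.
    have [r5 M5] := represents_unreg (represents_reg r4 iN1).
    have ij' : i.+1 + j = bound bn by rewrite addSnnS.
    have [M6 [t6 [x6 r6 l6]]] := IHj i.+1 _ _ ij' r5 M5.
    exists M6, (cost (loop_test bn d) + (t3 + 6) + t6).+1; split.
    + apply: ExecWhileTrue x6.
      * by apply: fits_growth => //; case: r1.
      * by rewrite /= Mi -/(bound bn) -ij; lia.
      * apply: ExecSeq x3 _.
        move: gi; rewrite geq_max => /andP[gr gs].
        have := ExecAssign (fits_growth rN3 gr) (fits_growth rN3 gs).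
        by rewrite [eval inp M3 (Add _ _)]/= M3i addn1.
    + exact: r6.
    + by rewrite /=; lia.
  have N0 : 0 < N by apply: ltnW.
  have [r0 M0] := represents_unreg (represents_reg r N0).
  have [M' [t [x' r' l']]] := loop (bound bn) 0 s _ erefl r0 M0.
  exists M', (3 + t); split; last by rewrite /= -/d; lia.
  + apply: ExecSeq x'.
    move: ga; rewrite geq_max => /andP[gr gs].
    exact: ExecAssign (fits_growth rN gr) (fits_growth rN gs).
  + exact: r'.
Qed.

End Compile.
End Semantics.

(** * Running time by loop nesting, and the effect of scans *)

Fixpoint depth (b : bool) c :=
  match c with
  | CSkip | CSet _ _ _ _ _ => 0
  | CSeq c1 c2 | CIf _ c1 c2 => maxn (depth b c1) (depth b c2)
  | CLet _ c => depth b c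
  | CFor b' c => (b == b') + depth b c
  end.

(** Since [n] and [m] are positive, the product is at least 1 and absorbs all additive costs. *)
Lemma time_bound d c : exists C, forall inp, 0 < nth 0 inp 0 -> 0 < nth 0 inp 1 ->
  time inp d c <= C * (nth 0 inp 0 ^ depth true c * nth 0 inp 1 ^ depth false c).
Proof.
have pos inp i j : 0 < nth 0 inp 0 -> 0 < nth 0 inp 1 ->
    0 < nth 0 inp 0 ^ i * nth 0 inp 1 ^ j.
  by move=> n0 m0; rewrite muln_gt0 !expn_gt0 n0 m0.
elim: c d => [|id a1 a2 a3 x|c1 IH1 c2 IH2|e c1 IH1 c2 IH2|a c IH|b c IH] d.
- by exists 1 => inp n0 m0; rewrite /= leq_pmulr // pos.
- by exists (time [::] d (CSet id a1 a2 a3 x)) => inp n0 m0; rewrite leq_pmulr // pos.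
- have [[C1 h1] [C2 h2]] := (IH1 d, IH2 d); exists (C1 + C2) => inp n0 m0.
  rewrite [time _ _ _]/= mulnDl; apply: leq_add; [apply: leq_trans (h1 _ n0 m0) _|apply: leq_trans (h2 _ n0 m0) _];
  by rewrite leq_mul2l; apply/orP; right; apply: leq_mul; rewrite leq_pexp2l //= ?leq_maxl ?leq_maxr.
- have [[C1 h1] [C2 h2]] := (IH1 d, IH2 d); exists (C1 + C2 + cost (of_cond e) + 1) => inp n0 m0.
  rewrite [time _ _ _]/= [depth _ _]/= [depth false _]/=.
  set X := _ ^ _ * _ ^ _.
  have X0 : 0 < X by apply: pos.
  have l1 : time inp d c1 <= C1 * X.
    apply: leq_trans (h1 _ n0 m0) _; rewrite leq_mul2l; apply/orP; right.
    by apply: leq_mul; rewrite leq_pexp2l //= ?leq_maxl.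
  have l2 : time inp d c2 <= C2 * X.
    apply: leq_trans (h2 _ n0 m0) _; rewrite leq_mul2l; apply/orP; right.
    by apply: leq_mul; rewrite leq_pexp2l //= ?leq_maxr.
  have : cost (of_cond e) <= cost (of_cond e) * X by rewrite leq_pmulr.
  by rewrite !mulnDl; lia.
- have [C h] := IH d.+1; exists (C + cost (of_atom a) + 2) => inp n0 m0.
  pose X := nth 0 inp 0 ^ depth true c * nth 0 inp 1 ^ depth false c.
  have X0 : 0 < X := pos _ _ _ n0 m0; have le : time inp d.+1 c <= C * X := h _ n0 m0.
  have lc : cost (of_atom a) <= cost (of_atom a) * X by rewrite leq_pmulr.
  change (cost (of_atom a) + 2 + time inp d.+1 c <= (C + cost (of_atom a) + 2) * X).
  by rewrite !mulnDl; lia.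
(* A loop of [y] rounds adds [12 * y + 9] to the cost of its bodies, which is at most 21 times the
   product. *)
have [C h] := IH d.+1; exists (C + 21) => inp n0 m0.
have key y X t : 0 < y -> 0 < X -> t <= C * X ->
    3 + y * (t + 12) + 6 <= (C + 21) * (y * X).
  move=> y0 X0 tX; have yX : y <= y * X by rewrite leq_pmulr.
  have : y * (t + 12) <= y * (C * X + 12) by rewrite leq_mul2l leq_add2r tX orbT.
  have -> : y * (C * X + 12) = C * (y * X) + 12 * y by rewrite mulnDr mulnCA [12 * y]mulnC.
  by rewrite mulnDl; lia.
have XY0 := pos _ (depth true c) (depth false c) n0 m0; have hh := h _ n0 m0.
case: b.
  change (3 + nth 0 inp 0 * (time inp d.+1 c + 12) + 6 <=
    (C + 21) * (nth 0 inp 0 ^ (depth true c).+1 * nth 0 inp 1 ^ depth false c)).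
  by rewrite expnS -[_ * _ * _]mulnA; exact: (key _ _ _ n0 XY0 hh).
change (3 + nth 0 inp 1 * (time inp d.+1 c + 12) + 6 <=
  (C + 21) * (nth 0 inp 0 ^ depth true c * nth 0 inp 1 ^ (depth false c).+1)).
by rewrite expnS [_ ^ _ * (_ * _)]mulnCA; exact: (key _ _ _ m0 XY0 hh).
Qed.

Fixpoint atom_ids a :=
  match a with
  | Lit _ | Var _ => [::]
  | Cell id a b c => id :: atom_ids a ++ atom_ids b ++ atom_ids c
  | Endpoint _ a => atom_ids a
  end.

Fixpoint cond_ids c :=
  match c with
  | CEq a b | CLt a b => atom_ids a ++ atom_ids b
  | CNot c => cond_ids c
  | CAnd c1 c2 | COr c1 c2 => cond_ids c1 ++ cond_ids c2
  end.

Definition same_on (ids : seq nat) (s s' : state) : Prop :=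
  forall id, id \in ids -> forall i j k, s id i j k = s' id i j k.

Definition frame (id : nat) (s s' : state) : Prop :=
  forall id', id' != id -> forall i j k, s id' i j k = s' id' i j k.

Lemma frame_refl id s : frame id s s. Proof. by []. Qed.

Lemma frame_trans id s1 s2 s3 : frame id s1 s2 -> frame id s2 s3 -> frame id s1 s3.
Proof. by move=> h1 h2 id' ne i j k; rewrite h1 // h2. Qed.

Lemma frame_upd id s i j k x : frame id s (upd s id i j k x).
Proof. by move=> id' /negbTE ne i' j' k'; rewrite /upd ne. Qed.

Lemma frame_same id ids s s' : frame id s s' -> id \notin ids -> same_on ids s s'.
Proof. by move=> f ni id' hid; apply: f; apply: contraNneq ni => <-. Qed.

Lemma foldl_ind (S : Type) (P : nat -> S -> Prop) (f : S -> nat -> S) b s :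
  P 0 s -> (forall k s, k < b -> P k s -> P k.+1 (f s k)) -> P b (foldl f s (iota 0 b)).
Proof.
move=> P0 step; have aux : forall j i s, i + j = b -> P i s -> P b (foldl f s (iota i j)).
  elim=> [|j IH] i s' ij Pi; first by rewrite -ij addn0.
  apply: IH; first by rewrite addSnnS.
  by apply: step => //; rewrite -ij addnS ltnS leq_addr.
exact: (aux b 0).
Qed.

Lemma eq_foldl (S T : Type) (f g : S -> T -> S) s l :
  (forall s y, f s y = g s y) -> foldl f s l = foldl g s l.
Proof. by move=> e; elim: l s => //= y l IH s; rewrite e IH. Qed.

Section Semantics.
Variables (inp : seq nat).
Local Notation n := (nth 0 inp 0).
Local Notation m := (nth 0 inp 1).
Local Notation run := (run inp).
Local Notation aval := (aval inp).
Local Notation cval := (cval inp).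

Lemma aval_same env s s' a : same_on (atom_ids a) s s' -> aval env s a = aval env s' a.
Proof.
elim: a => //= [id a IHa b IHb c IHc|o a IH] h; last by rewrite IH.
rewrite IHa ?IHb ?IHc ?h ?mem_head // => id' hid; apply: h;
by rewrite inE !mem_cat hid !orbT.
Qed.

Lemma cval_same env s s' c : same_on (cond_ids c) s s' -> cval env s c = cval env s' c.
Proof.
have sl ids1 ids2 : same_on (ids1 ++ ids2) s s' -> same_on ids1 s s' /\ same_on ids2 s s'.
  by move=> h; split=> id hid; apply: h; rewrite mem_cat hid ?orbT.
elim: c => //= [a b|a b|c IH|c1 IH1 c2 IH2|c1 IH1 c2 IH2].
- by case/sl=> /aval_same-> /aval_same->.
- by case/sl=> /aval_same-> /aval_same->.
- by move=> /IH->.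
- by case/sl=> /IH1-> /IH2->.
- by case/sl=> /IH1-> /IH2->.
Qed.

(** A relation and not a function: several writes may hit the same cell, and the one that survives
    depends on the order of the edges, which never needs to be known. *)
Definition hits := state -> nat -> nat -> nat -> nat -> Prop.

(* [F] writes only in the array [id], with values prescribed by [H], itself a
   function of the arrays [ids]. *)
Definition marker id ids (F : state -> state) (H : hits) : Prop :=
  [/\ forall s, frame id s (F s),
      forall s i j k, (F s id i j k = s id i j k /\ forall x, ~ H s i j k x) \/
        (exists2 x, H s i j k x & F s id i j k = x)
    & forall s s', same_on ids s s' -> forall i j k x, H s i j k x -> H s' i j k x].

Lemma marker_seq id ids F1 F2 H1 H2 : id \notin ids ->
  marker id ids F1 H1 -> marker id ids F2 H2 ->
  marker id ids (fun s => F2 (F1 s)) (fun s i j k x => H1 s i j k x \/ H2 s i j k x).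
Proof.
move=> nid [f1 v1 d1] [f2 v2 d2]; split.
- by move=> s; apply: frame_trans (f1 s) (f2 _).
- move=> s i j k; have sm := frame_same (f1 s) nid.
  have sm' : same_on ids (F1 s) s by move=> id' h *; rewrite sm.
  case: (v2 (F1 s) i j k) => [[-> n2]|[x h2 e]]; last first.
    by right; exists x => //; right; apply: d2 sm' _ _ _ _ h2.
  case: (v1 s i j k) => [[-> n1]|[x h1 ->]]; last by right; exists x => //; left.
  by left; split=> // x [/n1//|h]; apply: (n2 x); apply: d2 sm _ _ _ _ h.
- by move=> s s' sm i j k x [h|h]; [left; apply: d1 sm _ _ _ _ h|right; apply: d2 sm _ _ _ _ h].
Qed.

Lemma marker_for id ids b (F : nat -> state -> state) (H : nat -> hits) : id \notin ids ->
  (forall y, marker id ids (F y) (H y)) ->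
  marker id ids (fun s => foldl (fun s y => F y s) s (iota 0 b))
    (fun s i j k x => exists2 y, y < b & H y s i j k x).
Proof.
move=> nid mF.
have fr s : frame id s (foldl (fun s y => F y s) s (iota 0 b)).
  apply: (@foldl_ind _ (fun _ s' => frame id s s')) => // y s' _ h.
  by apply: frame_trans h _; case: (mF y).
split=> //.
- move=> s i j k.
  pose P y s' := frame id s s' /\ ((s' id i j k = s id i j k /\ forall y' x, y' < y -> ~ H y' s i j k x) \/
    exists2 x, (exists2 y', y' < b & H y' s i j k x) & s' id i j k = x).
  have [_ h] : P b (foldl (fun s y => F y s) s (iota 0 b)).
    apply: foldl_ind; first by split=> //; left.
    move=> y s' yb [fs' hs']; have [f1 v1 d1] := mF y; split.
      exact: frame_trans fs' (f1 s').
    have sm := frame_same fs' nid; have sm' : same_on ids s' s by move=> id' h *; rewrite sm.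
    case: (v1 s' i j k) => [[-> n1]|[x hx e]]; last first.
      by right; exists x => //; exists y => //; apply: d1 sm' _ _ _ _ hx.
    case: hs' => [[-> no]|h]; last by right.
    left; split=> // y' x; rewrite ltnS leq_eqVlt => /orP[/eqP->|/no//] h.
    by apply: (n1 x); apply: d1 sm _ _ _ _ h.
  case: h => [[e no]|h]; last by right.
  by left; split=> // x [y yb h]; apply: (no y x yb h).
- by move=> s s' sm i j k x [y yb h]; exists y => //; case: (mF y) => _ _ d; apply: d sm _ _ _ _ h.
Qed.

Lemma marker_ext id ids F F' H H' : (forall s, F s = F' s) ->
  (forall s i j k x, H s i j k x <-> H' s i j k x) -> marker id ids F H -> marker id ids F' H'.
Proof.
move=> eF eH [f v d]; split.
- by move=> s; rewrite -eF.
- move=> s i j k; rewrite -eF; case: (v s i j k) => [[-> no]|[x h e]].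
    by left; split=> // x /eH; apply: no.
  by right; exists x => //; apply/eH.
- by move=> s s' sm i j k x /eH h; apply/eH; apply: d sm _ _ _ _ h.
Qed.

Definition mark e id a1 a2 a3 x := CIf e (CSet id a1 a2 a3 x) CSkip.

Definition hit e a1 a2 a3 x env : hits := fun s i j k v =>
  [/\ cval env s e, i = aval env s a1, j = aval env s a2, k = aval env s a3 & v = aval env s x].

Lemma mark_marker id ids e a1 a2 a3 x env :
  {subset cond_ids e ++ atom_ids a1 ++ atom_ids a2 ++ atom_ids a3 ++ atom_ids x <= ids} ->
  marker id ids (run env (mark e id a1 a2 a3 x)) (hit e a1 a2 a3 x env).
Proof.
move=> sub; split.
- by move=> s /=; case: ifP => _; [apply: frame_upd|apply: frame_refl].
- move=> s i j k /=; case: (boolP (cval env s e)) => he; last by left; split=> // v [h]; rewrite h in he.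
  rewrite /upd eqxx /=; case: ifP => [/and3P[/eqP e1 /eqP e2 /eqP e3]|ne].
    by right; exists (aval env s x).
  by left; split=> // v [_ e1 e2 e3 _]; rewrite e1 e2 e3 !eqxx in ne.
- move=> s s' sm i j k v [h1 h2 h3 h4 h5].
  have sm' l : {subset l <= cond_ids e ++ atom_ids a1 ++ atom_ids a2 ++ atom_ids a3 ++ atom_ids x} ->
    same_on l s s' by move=> sl id' /sl/sub; apply: sm.
  by split; rewrite -?(@cval_same env s s') -?(@aval_same env s s') //; apply: sm' => id' h;
    rewrite !mem_cat h ?orbT.
Qed.

(** The input lists each edge once, in an arbitrary orientation, so the body runs for both
    orientations. *)
Definition edge_loop d f := CFor false (CSeq
  (CLet (Endpoint false (Var d)) (CLet (Endpoint true (Var d)) f))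
  (CLet (Endpoint true (Var d)) (CLet (Endpoint false (Var d)) f))).

(** Levels [d] to [d + np - 1] hold nodes, level [d + np] the rank of an edge, and the next two
    levels its ends. *)
Fixpoint scan np d f := if np is np'.+1 then CFor true (scan np' d.+1 f) else edge_loop d f.

Definition is_edge e u v :=
  (u = nth 0 inp (2 + 2 * e) /\ v = nth 0 inp (3 + 2 * e)) \/
  (v = nth 0 inp (2 + 2 * e) /\ u = nth 0 inp (3 + 2 * e)).

Fixpoint scan_hits np env (H : seq nat -> hits) : hits :=
  if np is np'.+1 then fun s i j k x => exists2 y, y < n & scan_hits np' (rcons env y) H s i j k x
  else fun s i j k x => exists2 e, e < m &
    exists u v, is_edge e u v /\ H (rcons (rcons (rcons env e) u) v) s i j k x.

Lemma scan_marker id ids np env f H : id \notin ids ->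
  (forall env, marker id ids (run env f) (H env)) ->
  marker id ids (run env (scan np (size env) f)) (scan_hits np env H).
Proof.
move=> nid mf; elim: np env => [|np IH] env /=; last first.
  apply: marker_for => // y.
  by have := IH (rcons env y); rewrite size_rcons.
apply: (@marker_ext id ids (fun s => foldl (fun s e =>
   run (rcons (rcons (rcons env e) (nth 0 inp (3 + 2 * e))) (nth 0 inp (2 + 2 * e))) f
   (run (rcons (rcons (rcons env e) (nth 0 inp (2 + 2 * e))) (nth 0 inp (3 + 2 * e))) f s)) s (iota 0 m)) _
  (fun s i j k x => exists2 e, e < m &
     H (rcons (rcons (rcons env e) (nth 0 inp (2 + 2 * e))) (nth 0 inp (3 + 2 * e))) s i j k x \/
     H (rcons (rcons (rcons env e) (nth 0 inp (3 + 2 * e))) (nth 0 inp (2 + 2 * e))) s i j k x)).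
- move=> s; apply: eq_foldl => s' e /=.
  rewrite !nth_rcons !size_rcons ltnSn ltnn eqxx.
  by rewrite addn0 addn1.
- move=> s i j k x; split.
    move=> [e em [h|h]]; exists e => //; do 2 eexists; (split; last exact: h); [by left|by right].
  by move=> [e em [u [v [[[-> ->]|[-> ->]] h]]]]; exists e => //; [left|right].
apply: marker_for => // e; exact: marker_seq.
Qed.

End Semantics.

(** * Labelling the components of a family of induced subgraphs *)

Definition row_relax id (ok : atom -> cond) :=
  CIf (CAnd (ok (Var 4)) (ok (Var 5)))
    (CIf (CLt (Cell id (Var 0) (Var 1) (Var 4)) (Cell id (Var 0) (Var 1) (Var 5)))
       (CSet id (Var 0) (Var 1) (Var 5) (Cell id (Var 0) (Var 1) (Var 4)))
       (CSet id (Var 0) (Var 1) (Var 4) (Cell id (Var 0) (Var 1) (Var 5)))) CSkip.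

(* After i rounds a node has a label at most that of any node within distance i,
   so n rounds bring the least node of the component everywhere. *)
Definition label_row id ok := CSeq
  (CFor true (CSet id (Var 0) (Var 1) (Var 2) (Var 2)))
  (CFor true (CFor false
    (CLet (Endpoint false (Var 3)) (CLet (Endpoint true (Var 3)) (row_relax id ok))))).

Definition label_rows id ok := CFor true (CFor true (label_row id ok)).

Section Labels.
Variables (inp : seq nat) (n : nat) (G : rel 'I_n).
Local Notation m := (nth 0 inp 1).
Hypothesis inp_n : nth 0 inp 0 = n.
Hypothesis G_sym : symmetric G.
Hypothesis edge_of : forall e, e < m -> exists a b : 'I_n,
  [/\ G a b, nth 0 inp (2 + 2 * e) = a & nth 0 inp (3 + 2 * e) = b].
Hypothesis edge_ex : forall a b : 'I_n, G a b -> exists2 e, e < m & is_edge inp e a b.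

Definition sub_rel_of (okb : nat -> bool) : rel 'I_n := fun u v => [&& okb u, okb v & G u v].

Definition labelled id (R : rel 'I_n) p q (s : state) : Prop :=
  forall u v : 'I_n, (s id p q u == s id p q v) = connect R u v.

Section Row.
Variables (id : nat) (ids : seq nat) (ok : atom -> cond) (okv : state -> nat -> nat -> nat -> bool).
Hypothesis nid : id \notin ids.
Hypothesis ok4 : forall p q r e u v s, cval inp [:: p; q; r; e; u; v] s (ok (Var 4)) = okv s p q u.
Hypothesis ok5 : forall p q r e u v s, cval inp [:: p; q; r; e; u; v] s (ok (Var 5)) = okv s p q v.
Hypothesis ok_same : forall s s' p q u, same_on ids s s' -> okv s p q u = okv s' p q u.

Variables (s : state) (p q : nat).
Let R := sub_rel_of (okv s p q).

Let R_sym : symmetric R.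
Proof. by move=> u v; rewrite /R /sub_rel_of G_sym andbCA. Qed.

Let cR_sym : connect_sym R := sym_connect_sym R_sym.

Definition only_row (t : state) : Prop := frame id s t /\
  forall i j k, (i, j) != (p, q) -> t id i j k = s id i j k.

Let row_inv (t : state) : Prop := only_row t /\
  forall u : 'I_n, exists2 w : 'I_n, t id p q u = w & connect R w u.

Let near i (w u : 'I_n) := exists r, [/\ path R w r, last w r = u & size r <= i].

Let upd_row t (u : 'I_n) (x : nat) : row_inv t -> forall w : 'I_n, x = w -> (forall v : 'I_n, v = u :> nat -> connect R w v) ->
  row_inv (upd t id p q u x).
Proof.
move=> [[ft rt] lt] w ew cw; split; last first.
  move=> v; rewrite /upd !eqxx /=; case: eqP => [e|_]; last exact: lt.
  by exists w => //; apply: cw.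
split; first by apply: (frame_trans ft); apply: frame_upd.
move=> i j k ne; rewrite /upd eqxx /=; case: ifP; last by rewrite rt.
by case/and3P=> /eqP e1 /eqP e2 _; rewrite e1 e2 eqxx in ne.
Qed.

(** The environment holds the row [p], [q], the round, the rank of the edge and its ends. Relaxing
    only lowers labels, and a label remains a node of the same component. *)
Let relax_ok r e (a b : 'I_n) t : G a b -> row_inv t ->
  let t' := run inp [:: p; q; r; e; val a; val b] (row_relax id ok) t in
  [/\ row_inv t', forall u : 'I_n, t' id p q u <= t id p q u
    & R a b -> t' id p q a <= t id p q b /\ t' id p q b <= t id p q a].
Proof.
move=> Gab it; rewrite /= ok4 ok5; have [[ft rt] lt] := it.
have et v : okv t p q v = okv s p q v.
  by apply: ok_same => id' hid i j k; rewrite (frame_same ft nid).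
rewrite !et; case: (boolP (okv s p q a && okv s p q b)) => [/andP[oa ob]|no]; last first.
  by split=> // /and3P[oa ob _]; rewrite oa ob in no.
have Rab : R a b by rewrite /R /sub_rel_of oa ob.
case: ltnP => h.
- have [w ew cw] := lt a; split.
  + apply: (upd_row it ew) => v /val_inj ->.
    exact: connect_trans cw (connect1 Rab).
  + move=> u; rewrite /upd !eqxx /=; case: eqP => [->|_] //; exact: ltnW.
  + by move=> _; rewrite /upd !eqxx /=; split=> //; case: eqP => // _; apply: ltnW.
- have [w ew cw] := lt b; split.
  + apply: (upd_row it ew) => v /val_inj ->.
    by apply: connect_trans cw (connect1 _); rewrite R_sym.
  + by move=> u; rewrite /upd !eqxx /=; case: eqP => [->|_].
  + by move=> _; rewrite /upd !eqxx /=; split=> //; case: eqP.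
Qed.

Lemma label_row_spec :
  let t := run inp [:: p; q] (label_row id ok) s in only_row t /\ labelled id R p q t.
Proof.
rewrite /= inp_n.
set t0 := foldl _ s _.
have i0 : row_inv t0 /\ forall u : 'I_n, t0 id p q u <= u.
  pose P y (t : state) := only_row t /\ forall u, u < y -> t id p q u = u.
  have [or0 l0] : P n t0.
    apply: foldl_ind; first by split=> //; split.
    move=> y t yn [[ft rt] lt]; split.
      split; first by apply: (frame_trans ft); apply: frame_upd.
      move=> i j k ne; rewrite /upd eqxx /=; case: ifP; last by rewrite rt.
      by case/and3P=> /eqP e1 /eqP e2 _; rewrite e1 e2 eqxx in ne.
    by move=> u; rewrite /upd !eqxx /= ltnS leq_eqVlt; case: eqP => //= _; apply: lt.
  by split=> [|u]; [split=> // u; exists u; rewrite ?l0|rewrite l0].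
set t1 := foldl _ t0 _.
have [i1 near1] : row_inv t1 /\ forall u w : 'I_n, near n w u -> t1 id p q u <= w.
  pose P y t := row_inv t /\ forall u w : 'I_n, near y w u -> t id p q u <= w.
  have : P n t1; last by [].
  apply: foldl_ind.
    split; first by case: i0.
    move=> u w [[|v r] [_ /= <- //]] _; by case: i0.
  move=> y t yn [it nt].
  (* Labels never increase, so what is known at the start of the round survives the relaxations
     already made in it; [Q] only records which edges have been treated. *)
  pose Q e t' := [/\ row_inv t', forall u : 'I_n, t' id p q u <= t id p q u
    & forall e' (a b w : 'I_n), e' < e -> is_edge inp e' a b -> R a b ->
        near y w b -> t' id p q a <= w].
  set t2 := foldl _ t _.
  have [i2 le2 n2] : Q m t2.
    apply: foldl_ind; first by split.
    move=> e t' em [it' le' ne']; have [a [b [Gab ea eb]]] := edge_of em.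
    have ea' : nth 0 inp (2 + 0 + 2 * e) = val a by rewrite addn0.
    have eb' : nth 0 inp (2 + 1 + 2 * e) = val b by [].
    have := relax_ok y e Gab it'; rewrite -ea' -eb' => -[it'' le'' lab].
    rewrite ea' eb' in lab it'' le''.
    split.
    - by move: it''; rewrite /= ea' eb'.
    - by move=> u; apply: leq_trans (le' u); move: (le'' u); rewrite /= ea' eb'.
    - move=> e' a' b' w; rewrite ltnS leq_eqVlt => /orP[/eqP->|lt] he Rab nb; last first.
        apply: leq_trans (ne' e' a' b' w lt he Rab nb).
        by move: (le'' a'); rewrite /= ea' eb'.
      have tb : t' id p q b' <= w by apply: leq_trans (le' b') (nt b' w nb).
      case: he => [[e1 e2]|[e1 e2]].
        have eaa : a' = a by apply: val_inj; rewrite /= e1 ea.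
        have ebb : b' = b by apply: val_inj; rewrite /= e2 eb.
        subst a' b'; have [l1 _] := lab Rab.
        by apply: leq_trans tb; move: l1; rewrite /= ea' eb'.
      have eaa : b' = a by apply: val_inj; rewrite /= e1 ea.
      have ebb : a' = b by apply: val_inj; rewrite /= e2 eb.
      subst a' b'; rewrite R_sym in Rab; have [_ l1] := lab Rab.
      by apply: leq_trans tb; move: l1; rewrite /= ea' eb'.
  split=> // u w [r [pr lr sr]].
  case/lastP: r pr lr sr => [|r v] pr lr sr.
    by apply: leq_trans (le2 u) (nt u w _); exists [::].
  rewrite rcons_path in pr; rewrite last_rcons in lr; subst v.
  case/andP: pr => pr lr; rewrite size_rcons ltnS in sr.
  have Gr : G u (last w r) by rewrite G_sym; case/and3P: lr.
  have [e em he] := edge_ex Gr.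
  apply: (n2 e u (last w r) w em he); first by rewrite R_sym.
  by exists r.
have [or1 l1] := i1; split=> // u v.
(* The label of [v'] is a node [w], and a simple path from [w] to [u'] has fewer than [n] edges, so
   [n] rounds bring a label at most [w] to [u']. *)
have le_con (u' v' : 'I_n) : connect R u' v' -> t1 id p q u' <= t1 id p q v'.
  move=> cuv; have [w -> cw] := l1 v'; apply: near1.
  have /connectP[r pr lr] : connect R w u' by apply: connect_trans cw _; rewrite cR_sym.
  case/shortenP: pr lr => r' pr' ur' _ lr; exists r'; split=> //.
  have := card_uniqP ur'; have := max_card (mem (w :: r')); rewrite card_ord => /[swap] -> /=.
  exact: ltnW.
apply/eqP/idP => [e|c].
  have [w ew cw] := l1 u; have [w' ew' cw'] := l1 v.
  have eww : w = w' by apply: val_inj; rewrite /= -ew -ew'.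
  by subst w'; apply: connect_trans cw'; rewrite cR_sym.
by apply/eqP; rewrite eqn_leq !le_con // cR_sym.
Qed.

End Row.

Lemma label_rows_spec id ids ok okv s : id \notin ids ->
  (forall p q r e u v s, cval inp [:: p; q; r; e; u; v] s (ok (Var 4)) = okv s p q u) ->
  (forall p q r e u v s, cval inp [:: p; q; r; e; u; v] s (ok (Var 5)) = okv s p q v) ->
  (forall s s' p q u, same_on ids s s' -> okv s p q u = okv s' p q u) ->
  let t := run inp [::] (label_rows id ok) s in
  frame id s t /\ forall p q, p < n -> q < n -> labelled id (sub_rel_of (okv s p q)) p q t.
Proof.
move=> nid ok4 ok5 okS t.
pose P p q (t : state) := frame id s t /\ forall p' q', p' < n -> q' < n ->
  (p' < p) || (p' == p) && (q' < q) -> labelled id (sub_rel_of (okv s p' q')) p' q' t.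
suff [ft lt] : P n 0 t by split=> // p q pn qn; apply: lt => //; rewrite pn.
change (P n 0 (foldl (fun s p => foldl (fun s q => run inp [:: p; q] (label_row id ok) s) s
  (iota 0 (nth 0 inp 0))) s (iota 0 (nth 0 inp 0)))).
rewrite inp_n; apply: (@foldl_ind _ (fun p => P p 0)) => [|p t1 pn it1].
  by split=> // p' q' _ _; rewrite !ltn0 andbF.
suff [ft lt] : P p n (foldl (fun s q => run inp [:: p; q] (label_row id ok) s) t1 (iota 0 n)).
  split=> // p' q' pn' qn'; rewrite ltn0 andbF orbF ltnS leq_eqVlt => le.
  by apply: lt => //; rewrite qn' andbT orbC.
apply: (@foldl_ind _ (P p)) => // q t2 qn [ft2 lt2].
have [[ft3 or3] lab3] := label_row_spec nid ok4 ok5 okS t2 p q.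
split; first exact: frame_trans ft2 ft3.
move=> p' q' pn' qn' le.
have [/eqP[-> ->]|ne] := boolP ((p', q') == (p, q)).
  move=> u v; rewrite lab3; apply: eq_connect => x y; rewrite /sub_rel_of.
  by rewrite !(okS s t2) // => id' hid i j k; rewrite (frame_same ft2 nid).
move=> u v; rewrite !or3 //; apply: lt2 => //.
move: le ne; rewrite xpair_eqE ltnS (leq_eqVlt q').
by case: (p' < p) (p' == p) (q' == q) => [] [] [].
Qed.

End Labels.

(** * Sequences of steps, each filling its own array *)

Definition run_all inp L (s : state) := run inp [::] (foldr CSeq CSkip L) s.

Lemma run_allE inp L s :
  run_all inp L s = foldl (fun s i => run inp [::] (nth CSkip L i) s) s (iota 0 (size L)).
Proof.
rewrite /run_all -[L in LHS](mkseq_nth CSkip) /mkseq.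
by elim: (iota 0 (size L)) s => //= i l IH s; rewrite IH.
Qed.

Section Steps.
Variables (inp : seq nat) (L : seq cmd).
Hypothesis local : forall i, i < size L -> forall s, frame i.+1 s (run inp [::] (nth CSkip L i) s).

Let zero : state := fun _ _ _ _ => 0.
Let sf := run_all inp L zero.

(** Each array is written by a single step: when that step starts, the array is still zero and those
    of the previous steps have their final contents. Every specification can therefore be stated in
    the final state alone. *)
Lemma step_state k : k < size L -> exists s1 : state, [/\ forall i j l, s1 k.+1 i j l = 0,
  same_on (iota 1 k) s1 sf & forall i j l, run inp [::] (nth CSkip L k) s1 k.+1 i j l = sf k.+1 i j l].
Proof.
move=> kL; pose step := fun s i => run inp [::] (nth CSkip L i) s.
have keep a b s id : a + b <= size L -> (forall i, a <= i < a + b -> id != i.+1) ->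
    forall i j l, foldl step s (iota a b) id i j l = s id i j l.
  elim: b a s => [//|b IH] a s ab ne i j l /=; rewrite IH.
  - rewrite /step -local //; first by move: ab; lia.
    by apply: ne; lia.
  - by rewrite addSn -addnS.
  - by move=> i' h; apply: ne; lia.
have esf : sf = foldl step (step (foldl step zero (iota 0 k)) k) (iota k.+1 (size L - k.+1)).
  have -> : sf = foldl step zero (iota 0 (size L)) by apply: run_allE.
  have eL : size L = k + (size L - k.+1).+1 by lia.
  by rewrite [in LHS]eL iotaD foldl_cat.
exists (foldl step zero (iota 0 k)); split.
- by move=> i j l; rewrite keep //; [lia|move=> i'; lia].
- move=> id; rewrite mem_iota => hid i j l; rewrite esf [RHS]keep; [|lia|move=> i'; lia].
  by rewrite /step -local //; lia.
- by move=> i j l; rewrite esf keep //; [lia|move=> i'; lia].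
Qed.

Lemma scan_step k np e a1 a2 a3 x : k < size L ->
  nth CSkip L k = scan np 0 (mark e k.+1 a1 a2 a3 x) ->
  all (mem (iota 1 k)) (cond_ids e ++ atom_ids a1 ++ atom_ids a2 ++ atom_ids a3 ++ atom_ids x) ->
  let H := scan_hits inp np [::] (hit inp e a1 a2 a3 x) sf in
  forall i j l, (sf k.+1 i j l = 0 /\ forall v, ~ H i j l v) \/ H i j l (sf k.+1 i j l).
Proof.
move=> kL ek /allP sub H i j l; have [s1 [z1 sm e1]] := step_state kL.
have nid : k.+1 \notin iota 1 k by rewrite mem_iota; lia.
have sm' : same_on (iota 1 k) sf s1 by move=> id hid *; rewrite sm.
have [_ val dep] := @scan_marker inp k.+1 (iota 1 k) np [::] _ _ nid
  (fun env => mark_marker inp k.+1 env sub).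
case: (val s1 i j l) => [[]|[v h]]; rewrite -ek e1 ?z1.
  by move=> -> no; left; split=> // v h; apply: (no v); apply: dep sm' _ _ _ _ h.
by move=> ->; right; apply: dep sm _ _ _ _ h.
Qed.

(** All the values written are 1, so which write comes last is irrelevant. *)
Lemma flag_step k np e a1 a2 a3 : k < size L ->
  nth CSkip L k = scan np 0 (mark e k.+1 a1 a2 a3 (Lit 1)) ->
  all (mem (iota 1 k)) (cond_ids e ++ atom_ids a1 ++ atom_ids a2 ++ atom_ids a3) ->
  forall i j l, 0 < sf k.+1 i j l <-> scan_hits inp np [::] (hit inp e a1 a2 a3 (Lit 1)) sf i j l 1.
Proof.
move=> kL ek sub i j l; have one v env : scan_hits inp np env (hit inp e a1 a2 a3 (Lit 1)) sf i j l v -> v = 1.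
  elim: np env {ek} => [|np IH] env /=; last by case=> y _ /IH.
  by case=> ? _ [? [? [_ []]]].
have sub' : all (mem (iota 1 k)) (cond_ids e ++ atom_ids a1 ++ atom_ids a2 ++ atom_ids a3 ++ atom_ids (Lit 1)).
  by rewrite /= cats0.
case: (scan_step kL ek sub' i j l) => [[-> no]|h]; first by split=> // /no.
by have e1 := one _ _ h; rewrite e1 in h *; split.
Qed.

End Steps.

(** * The decision procedure *)

Definition Flag id i j l := CLt (Lit 0) (Cell id i j l).
Definition Adj x y := Flag 1 x y (Lit 0).
Definition Apart x y := CAnd (CNot (CEq x y)) (CNot (Adj x y)).
Definition Label a x := Cell 2 a (Lit 0) x.
(** The table is indexed by the label of the component, so that for each [a] a single pass over the
    edges fills it for all components. *)
Definition Att a v y := Flag 3 a (Label a v) y.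
Definition Outside a v x := CAnd (CNot (CEq x a)) (CNot (CEq (Label a v) (Label a x))).
Definition Witness c x := Cell 5 c x (Lit 0).
Definition Same (b : bool) c := if b then c else CNot c.
Definition InCutset b c x u :=
  COr (CEq u x) (CAnd (Att x c u) (Same b (COr (CEq u (Witness c x)) (Adj (Witness c x) u)))).
Definition InRegion b c x u :=
  CAnd (CNot (InCutset b c x u)) (COr (CEq (Label c x) (Label c u)) (Att c x u)).
Definition region_id (b : bool) := if b then 6 else 7.
Definition Crossed b c x y y' :=
  CAnd (Att c x y) (CAnd (Att c x y') (CAnd (CNot (InCutset b c x y))
    (CAnd (CNot (InCutset b c x y')) (CAnd (Apart y y')
      (CEq (Cell (region_id b) c x y) (Cell (region_id b) c x y')))))).

(* The i-th step fills the array i + 1, reading only the previous arrays: 1 is the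
   adjacency, 2 and 3 are [component] and [att], 4 the components of [outside],
   5 the function [g] of [good_cut], 6 and 7 the components of [region], 8, 9 and
   10 the negations of [admissible] and [separates], 11 is [needs_cut], 12 the
   existence of a good cut (indexed by the label of a component), and 13 to 15
   the violations of the three clauses of [clean]. Components are represented by
   labels of nodes. *)
Definition steps : seq cmd := [::
  scan 0 0 (mark (CEq (Lit 0) (Lit 0)) 1 (Var 1) (Var 2) (Lit 0) (Lit 1));
  label_rows 2 (fun x => Apart x (Var 0));
  scan 1 0 (mark (CAnd (Adj (Var 0) (Var 2)) (Apart (Var 3) (Var 0)))
    3 (Var 0) (Label (Var 0) (Var 3)) (Var 2) (Lit 1));
  label_rows 4 (Outside (Var 0) (Var 1));
  scan 1 0 (mark (Att (Var 2) (Var 0) (Var 3)) 5 (Var 0) (Var 2) (Lit 0) (Var 3));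
  label_rows 6 (InRegion true (Var 0) (Var 1));
  label_rows 7 (InRegion false (Var 0) (Var 1));
  scan 2 0 (mark (CAnd (Att (Var 0) (Var 1) (Var 3)) (CAnd (Att (Var 0) (Var 1) (Var 4))
    (CAnd (Adj (Var 1) (Var 3)) (Adj (Var 1) (Var 4))))) 8 (Var 0) (Var 1) (Lit 0) (Lit 1));
  scan 2 0 (mark (Crossed true (Var 3) (Var 0) (Var 4) (Var 1)) 9 (Var 3) (Var 0) (Lit 0) (Lit 1));
  scan 2 0 (mark (Crossed false (Var 3) (Var 0) (Var 4) (Var 1)) 10 (Var 3) (Var 0) (Lit 0) (Lit 1));
  scan 2 0 (mark (CAnd (Att (Var 3) (Var 0) (Var 4)) (CAnd (Att (Var 3) (Var 0) (Var 1))
    (Apart (Var 4) (Var 1)))) 11 (Var 3) (Var 0) (Lit 0) (Lit 1));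
  scan 2 0 (mark (CAnd (CNot (Flag 8 (Var 0) (Var 1) (Lit 0)))
    (CNot (CAnd (Flag 9 (Var 0) (Var 1) (Lit 0)) (Flag 10 (Var 0) (Var 1) (Lit 0)))))
    12 (Var 0) (Label (Var 0) (Var 1)) (Lit 0) (Lit 1));
  scan 3 0 (mark (CAnd (Att (Var 4) (Var 0) (Var 5)) (CAnd (Att (Var 4) (Var 0) (Var 1))
    (CAnd (Att (Var 4) (Var 0) (Var 2)) (CAnd (Apart (Var 5) (Var 1))
      (CAnd (Apart (Var 5) (Var 2)) (Apart (Var 1) (Var 2))))))) 13 (Lit 0) (Lit 0) (Lit 0) (Lit 1));
  scan 2 0 (mark (CAnd (Att (Var 3) (Var 0) (Var 4)) (CAnd (Att (Var 3) (Var 0) (Var 1))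
    (CAnd (Apart (Var 4) (Var 1)) (CEq (Cell 4 (Var 3) (Var 0) (Var 4)) (Cell 4 (Var 3) (Var 0) (Var 1))))))
    14 (Lit 0) (Lit 0) (Lit 0) (Lit 1));
  scan 2 0 (mark (CAnd (Flag 11 (Var 0) (Var 1) (Lit 0))
    (CNot (Flag 12 (Var 0) (Label (Var 0) (Var 1)) (Lit 0)))) 15 (Lit 0) (Lit 0) (Lit 0) (Lit 1))].

Definition main := foldr CSeq CSkip steps.

Lemma main_wf : wf_cmd 0 main. Proof. by []. Qed.
Lemma main_depth : depth true main <= 3 /\ depth false main <= 1. Proof. by []. Qed.

Lemma scan_frame inp np e id a1 a2 a3 x s :
  id \notin cond_ids e ++ atom_ids a1 ++ atom_ids a2 ++ atom_ids a3 ++ atom_ids x ->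
  frame id s (run inp [::] (scan np 0 (mark e id a1 a2 a3 x)) s).
Proof.
move=> nid; have [f _ _] := @scan_marker inp id _ np [::] _ _ nid
  (fun env => mark_marker inp id env (fun _ h => h)).
exact: f.
Qed.

(** * Meaning of the computed arrays *)

Section Correct.
Variables (inp : seq nat) (n : nat) (G : sgraph 'I_n).
Local Notation m := (nth 0 inp 1).
Hypothesis inp_n : nth 0 inp 0 = n.
Hypothesis edge_of : forall e, e < m -> exists a b : 'I_n,
  [/\ G a b, nth 0 inp (2 + 2 * e) = a & nth 0 inp (3 + 2 * e) = b].
Hypothesis edge_ex : forall a b : 'I_n, G a b -> exists2 e, e < m & is_edge inp e a b.
Hypothesis m_gt0 : 0 < m.

Let zero : state := fun _ _ _ _ => 0.
Let A := run_all inp steps zero.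

Let G_sym : symmetric G := @adj_sym _ G.

Let label_frame id ok s : let ids := cond_ids (ok (Var 4)) in id \notin ids ->
  (forall p q r e u v s, cval inp [:: p; q; r; e; u; v] s (ok (Var 4)) = cval inp [:: p; q; 0; 0; u; 0] s (ok (Var 4))) ->
  (forall p q r e u v s, cval inp [:: p; q; r; e; u; v] s (ok (Var 5)) = cval inp [:: p; q; 0; 0; v; 0] s (ok (Var 4))) ->
  frame id s (run inp [::] (label_rows id ok) s).
Proof.
move=> ids nid ok4 ok5; have okS s1 s2 p q u : same_on ids s1 s2 ->
    cval inp [:: p; q; 0; 0; u; 0] s1 (ok (Var 4)) = cval inp [:: p; q; 0; 0; u; 0] s2 (ok (Var 4)).
  exact: cval_same.
by have [] := label_rows_spec inp_n G_sym edge_of edge_ex s nid ok4 ok5 okS.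
Qed.

Let local i : i < size steps -> forall s, frame i.+1 s (run inp [::] (nth CSkip steps i) s).
Proof.
do 15![case: i => [|i]; first by move=> _ s; (apply: scan_frame || apply: label_frame)].
by [].
Qed.

Let label_step k ok : k < size steps -> nth CSkip steps k = label_rows k.+1 ok ->
  all (mem (iota 1 k)) (cond_ids (ok (Var 4))) ->
  (forall p q r e u v s, cval inp [:: p; q; r; e; u; v] s (ok (Var 4)) = cval inp [:: p; q; 0; 0; u; 0] s (ok (Var 4))) ->
  (forall p q r e u v s, cval inp [:: p; q; r; e; u; v] s (ok (Var 5)) = cval inp [:: p; q; 0; 0; v; 0] s (ok (Var 4))) ->
  forall (D : {set 'I_n}) p q, p < n -> q < n ->
  (forall u : 'I_n, cval inp [:: p; q; 0; 0; u : nat; 0] A (ok (Var 4)) = (u \in D)) ->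
  forall u v : 'I_n, (A k.+1 p q u == A k.+1 p q v) = connect (rst G D) u v.
Proof.
move=> kL ek /allP sub ok4 ok5 D p q pn qn okD u v.
have [s1 [z1 sm e1]] := step_state local kL.
have okS s s' p' q' u' : same_on (iota 1 k) s s' ->
    cval inp [:: p'; q'; 0; 0; u'; 0] s (ok (Var 4)) = cval inp [:: p'; q'; 0; 0; u'; 0] s' (ok (Var 4)).
  by move=> h; apply: cval_same => id /sub; apply: h.
have nid : k.+1 \notin iota 1 k by rewrite mem_iota; lia.
have [_ lab] := label_rows_spec inp_n G_sym edge_of edge_ex s1 nid ok4 ok5 okS.
have := lab p q pn qn u v; rewrite -ek !e1 => ->.
by apply: eq_connect => a b; rewrite /sub_rel_of !(okS s1 A) // !okD.
Qed.

Let edgeP e u v : e < m -> is_edge inp e u v -> exists a b : 'I_n, [/\ u = a, v = b & G a b].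
Proof.
move=> /edge_of[a [b [Gab e1 e2]]]; rewrite /is_edge e1 e2 => -[[-> ->]|[-> ->]].
  by exists a, b.
by exists b, a; rewrite adj_sym.
Qed.

Let ordE p : p < n -> exists a : 'I_n, p = a. Proof. by move=> pn; exists (Ordinal pn). Qed.

(** Conditions on nodes alone are also tested inside an edge loop; an edge is needed for its body to
    run. *)
Let some_edge : exists2 e, e < m & exists u v, is_edge inp e u v.
Proof. by exists 0 => //; do 2 eexists; left. Qed.

Lemma adjE (a b : 'I_n) : (0 < A 1 a b 0) = G a b.
Proof.
apply/idP/idP => [/(flag_step local (k := 0) isT erefl isT)|Gab].
  case=> e em [u [v [/(edgeP em)[a' [b' [-> -> Gab]]]]]].
  by case=> _ /= /val_inj -> /val_inj ->.
apply/(flag_step local (k := 0) isT erefl isT).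
by have [e em he] := edge_ex Gab; exists e => //; exists a, b.
Qed.

Lemma apartE (a b : 'I_n) : (a != b :> nat) && ~~ (0 < A 1 a b 0) = ~~ ((a == b) || G a b).
Proof. by rewrite adjE val_eqE negb_or. Qed.

Lemma labelE (a u v : 'I_n) : (A 2 a 0 u == A 2 a 0 v) = (v \in component G a u).
Proof.
have n0 : 0 < n by case: (n) a => // -[].
rewrite (label_step (k := 1) isT erefl isT _ _ (D := far G a)) ?inE //.
by move=> w; rewrite [cval _ _ _ _]/= adjE adj_sym inE.
Qed.

Lemma attE (a v y : 'I_n) : (0 < A 3 a (A 2 a 0 v) y) = att G a v y.
Proof.
apply/idP/idP => [/(flag_step local (k := 2) isT erefl isT)|].
  case=> p /[!inp_n] /ordE[a' ->] [e em [u [w [/(edgeP em)[y' [u' [-> -> yu]]]]]]].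
  case=> /= cnd /val_inj eaa; subst a'; move=> /eqP elab /val_inj eyy; subst y'.
  rewrite labelE in elab; move: cnd; rewrite apartE adjE => /andP[ay au] _.
  rewrite /att ay /=; apply/existsP; exists u'; rewrite yu elab !inE.
  by rewrite [G a _]adj_sym -negb_or au.
case/andP=> ay /existsP[u /and3P[yu uf uc]].
apply/(flag_step local (k := 2) isT erefl isT).
exists a; first by rewrite inp_n.
have [e em he] := edge_ex yu; exists e => //; exists y, u; split=> //.
split=> //=; last by apply/eqP; rewrite labelE.
by rewrite apartE adjE ay negb_or adj_sym; move: uf; rewrite inE.
Qed.

Lemma outside_labelE (a v x y : 'I_n) :
  (A 4 a v x == A 4 a v y) = connect (rst G (outside G a v)) x y.
Proof.
rewrite (label_step (k := 3) isT erefl isT _ _ (D := outside G a v)) // => w.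
by rewrite [cval _ _ _ _]/= labelE !inE.
Qed.

(** An entry that is never written keeps the default 0, which is a node since the existence of [c]
    makes [n] positive. *)
Let wit_lt (c x : 'I_n) : A 5 c x 0 < n.
Proof.
case: (scan_step local (k := 4) isT erefl isT c x 0 : (A 5 c x 0 = 0 /\ _) \/ _) => [[-> _]|]; first by case: (n) c => // -[].
case=> p _ [e em [u [w [/(edgeP em)[x' [u' [_ -> _]]]]]]].
by case=> /= _ _ _ _ e'; rewrite (e' : A 5 c x 0 = u').
Qed.

Definition wit (c x : 'I_n) : 'I_n := Ordinal (wit_lt c x).

Lemma wit_witness : witness G wit.
Proof.
move=> c x u xu.
case: (scan_step local (k := 4) isT erefl isT c x 0 : (A 5 c x 0 = 0 /\ _) \/ _) => [[_ no]|].
  case: (no u); exists c; first by rewrite inp_n.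
  have Gxu : G x u by case/andP: xu.
  have [e em he] := edge_ex Gxu; exists e => //; exists x, u; split=> //.
  by split=> //=; rewrite attE.
case=> p /[!inp_n] /ordE[c' ->] [e em [x' [u' [/(edgeP em)[x'' [u'' [-> -> Gxu]]]]]]].
case=> /= + /val_inj ec /val_inj ex _ eu; subst c' x''.
by rewrite attE; congr (att G _ _ _); apply: val_inj.
Qed.

Let cutE b (c x u : 'I_n) :
  (u == x :> nat) || (0 < A 3 x (A 2 x 0 c) u) &&
    (if b then (u == A 5 c x 0 :> nat) || (0 < A 1 (A 5 c x 0) u 0)
     else ~~ ((u == A 5 c x 0 :> nat) || (0 < A 1 (A 5 c x 0) u 0))) =
  (u \in cutset G (wit c x) x c b).
Proof.
rewrite attE -[A 5 c x 0]/(val (wit c x)) adjE !val_eqE !inE.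
by case: b; rewrite ?eqb_id // eqbF_neg.
Qed.

Lemma cut_labelE b (c x y y' : 'I_n) :
  (A (region_id b) c x y == A (region_id b) c x y') =
  connect (rst G (region G c x (cutset G (wit c x) x c b))) y y'.
Proof.
case: b.
  rewrite (label_step (k := 5) isT erefl isT _ _ (D := region G c x (cutset G (wit c x) x c true))) // => u.
  by rewrite [cval _ _ _ _]/= in_setD -cutE inE -labelE -attE.
rewrite (label_step (k := 6) isT erefl isT _ _ (D := region G c x (cutset G (wit c x) x c false))) // => u.
by rewrite [cval _ _ _ _]/= in_setD -cutE inE -labelE -attE.
Qed.

(** The condition [indep] says that the test ignores the rank of the edge, so rank 0 can stand for
    whichever rank the edge has in the input. *)
Let flag2 k e a1 a2 a3 i j l : k < size steps ->
  nth CSkip steps k = scan 2 0 (mark e k.+1 a1 a2 a3 (Lit 1)) ->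
  all (mem (iota 1 k)) (cond_ids e ++ atom_ids a1 ++ atom_ids a2 ++ atom_ids a3) ->
  let H r p q u v := hit inp e a1 a2 a3 (Lit 1) [:: p; q; r; u; v] A i j l 1 in
  (forall r, H r = H 0) ->
  0 < A k.+1 i j l <-> exists p q u v : 'I_n, G u v /\ H 0 p q u v.
Proof.
move=> kL ek sub H indep; apply: (iff_trans (flag_step local kL ek sub i j l)); split.
  rewrite /= inp_n; case=> p /ordE[p' ->] [q /ordE[q' ->]].
  case=> r em [u [v [/(edgeP em)[u' [v' [-> -> uv]]] h]]].
  by exists p', q', u', v'; rewrite -(indep r).
case=> p [q [u [v [uv h]]]]; exists p; first by rewrite inp_n.
exists q; first by rewrite inp_n.
have [r rm hr] := edge_ex uv; exists r => //; exists u, v; split=> //.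
by rewrite -(indep r) in h.
Qed.

Lemma not_admissibleE (c x : 'I_n) : (0 < A 8 c x 0) = ~~ admissible G c x.
Proof.
rewrite negbK; apply/idP/existsP => [/(flag2 (k := 7) (i := c) (j := x) (l := 0) isT erefl isT (fun=> erefl))|].
  case=> c' [x' [y [y' [yy' [/= + /val_inj ec /val_inj ex _ _]]]]]; subst c' x'.
  rewrite !attE !adjE => /and4P[h h' xy xy']; exists y; apply/existsP; exists y'.
  by rewrite h h' yy' xy.
case=> y /existsP[y' /and5P[h h' yy' xy xy']].
apply/(flag2 (k := 7) (i := c) (j := x) (l := 0) isT erefl isT (fun=> erefl)).
by exists c, x, y, y'; split=> //; split=> //=; rewrite !attE !adjE h h' xy.
Qed.

Let crossedE b (c x y y' : 'I_n) : cval inp [:: x : nat; y' : nat; 0; c : nat; y : nat] A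
  (Crossed b (Var 3) (Var 0) (Var 4) (Var 1)) = crossed G c x (cutset G (wit c x) x c b) y y'.
Proof.
rewrite /crossed -cut_labelE -[y \in cutset _ _ _ _ _]cutE -[y' \in cutset _ _ _ _ _]cutE.
rewrite -apartE -[att G c x y]attE -[att G c x y']attE.
by case: b; rewrite /= !andbA.
Qed.

Lemma not_separatesE b (c x : 'I_n) : (0 < A (if b then 9 else 10) c x 0) =
  ~~ separates G c x (cutset G (wit c x) x c b).
Proof.
rewrite negbK; apply/idP/existsP => [h|[y /existsP[y' h]]].
  suff [y [y' hy]] : exists y y', crossed G c x (cutset G (wit c x) x c b) y y'.
    by exists y; apply/existsP; exists y'.
  case: b h => [/(flag2 (k := 8) (i := c) (j := x) (l := 0) isT erefl isT (fun=> erefl))|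
      /(flag2 (k := 9) (i := c) (j := x) (l := 0) isT erefl isT (fun=> erefl))];
    case=> x' [y' [c' [y [_ [+ /= /val_inj ec /val_inj ex _ _]]]]]; subst c' x';
    by rewrite crossedE; exists y, y'.
(* The scan obtains [c] and [y] as the two ends of one edge, which exists because an attached node
   is a neighbour of the centre. *)
have cy : G c y by case/and5P: h => /andP[].
by case: b h => h; [apply/(flag2 (k := 8) (i := c) (j := x) (l := 0) isT erefl isT (fun=> erefl))|
  apply/(flag2 (k := 9) (i := c) (j := x) (l := 0) isT erefl isT (fun=> erefl))];
  exists x, y', c, y; split=> //; split=> //; rewrite crossedE.
Qed.

Lemma needs_cutE (c z : 'I_n) : (0 < A 11 c z 0) = needs_cut G c z.
Proof.
apply/idP/existsP => [/(flag2 (k := 10) (i := c) (j := z) (l := 0) isT erefl isT (fun=> erefl))|].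
  case=> z' [t [c' [s [_ [/= + /val_inj ec /val_inj ez _ _]]]]]; subst c' z'.
  rewrite !attE apartE => /and3P[hs ht st]; exists s; apply/existsP; exists t.
  by rewrite hs ht.
case=> s /existsP[t /and3P[hs ht st]].
apply/(flag2 (k := 10) (i := c) (j := z) (l := 0) isT erefl isT (fun=> erefl)).
exists z, t, c, s; split; first by case/andP: hs.
by split=> //=; rewrite !attE apartE hs ht.
Qed.

Lemma good_cutE (c z : 'I_n) : 0 < A 12 c (A 2 c 0 z) 0 <->
  exists2 x, x \in component G c z & good_cut G wit c x.
Proof.
apply: (iff_trans (flag2 (k := 11) (i := c) (j := (A 2 c 0 z)) (l := 0) isT erefl isT (fun=> erefl))); split.
  case=> c' [x [_ [_ [_ [/= + /val_inj ec /eqP + _ _]]]]]; subst c'.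
  rewrite labelE not_admissibleE (not_separatesE true) (not_separatesE false) => h xc.
  exists x; first exact: xc.
  by apply/andP; case/andP: h => /negPn h1 /nandP h2; split; last by apply/orP; case: h2 => /negPn; [left|right].
case=> x xc h; have [a [b Gab]] : exists a b, G a b.
  by have [e em [u [v /(edgeP em)[a [b [_ _ Gab]]]]]] := some_edge; exists a, b.
exists c, x, a, b; split=> //; split=> //=; last by apply/eqP; rewrite labelE.
rewrite not_admissibleE (not_separatesE true) (not_separatesE false).
case/andP: h => h1 /orP h2; apply/andP; split; first exact/negPn.
by apply/nandP; case: h2 => h2; [left|right]; apply/negPn.
Qed.

Lemma clean_of_flags : A 13 0 0 0 + A 14 0 0 0 + A 15 0 0 0 = 0 <-> clean G wit.
Proof.
suff h : [/\ ~ 0 < A 13 0 0 0, ~ 0 < A 14 0 0 0 & ~ 0 < A 15 0 0 0] <-> clean G wit.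
  apply: iff_trans h; move: (A 13 0 0 0) (A 14 0 0 0) (A 15 0 0 0) => x y z.
  by split=> [e|[]]; [split|]; lia.
have [a0 [b0 Gab0]] : exists a b, G a b.
  by have [e em [u [v /(edgeP em)[a [b [_ _ Gab]]]]]] := some_edge; exists a, b.
split=> -[no1 no2 no3]; split.
- move=> a v x y z; apply/negP=> /and4P[hx hy hz st]; apply: no1.
  apply/(flag_step local (k := 12) isT erefl isT).
  exists v; first by rewrite inp_n.
  exists y; first by rewrite inp_n.
  exists z; first by rewrite inp_n.
  have Gax : G a x by case/andP: hx.
  have [e em he] := edge_ex Gax; exists e => //; exists a, x; split=> //.
  split=> //=; rewrite !attE !apartE hx hy hz /= !negb_or.
  by case/stable3E: st => -[-> -> ->] [-> -> ->].
- move=> a v x y; apply/negP=> /and5P[hx hy nxy xy c]; apply: no2.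
  apply/(flag2 (k := 13) (i := 0) (j := 0) (l := 0) isT erefl isT (fun=> erefl)).
  exists v, y, a, x; split; first by case/andP: hx.
  by split=> //=; rewrite !attE apartE outside_labelE hx hy c negb_or nxy xy.
- move=> c z need; apply/good_cutE; apply/negPn/negP=> ok; apply: no3.
  apply/(flag2 (k := 14) (i := 0) (j := 0) (l := 0) isT erefl isT (fun=> erefl)).
  exists c, z, a0, b0; split=> //; split=> //=.
  by rewrite needs_cutE need.
- move=> /(flag_step local (k := 12) isT erefl isT).
  rewrite /= inp_n; case=> v /ordE[v' ->] [y /ordE[y' ->]] [z /ordE[z' ->]].
  case=> e em [a [x [/(edgeP em)[a' [x' [-> -> _]]] [/= + _ _ _ _]]]].
  rewrite !attE !apartE !negb_or => /and5P[hx hy hz /andP[xy1 xy2]].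
  move=> /andP[/andP[xz1 xz2] /andP[yz1 yz2]].
  by move: (no1 a' v' x' y' z'); rewrite /claw_attached hx hy hz /stable3 xy1 xy2 xz1 xz2 yz1 yz2.
- move=> /(flag2 (k := 13) (i := 0) (j := 0) (l := 0) isT erefl isT (fun=> erefl)).
  case=> v [y [a [x [_ [/= + _ _ _ _]]]]].
  rewrite !attE apartE outside_labelE negb_or => /and4P[hx hy /andP[xy1 xy2] c].
  by move: (no2 a v x y); rewrite /bypass hx hy xy1 xy2 c.
- move=> /(flag2 (k := 14) (i := 0) (j := 0) (l := 0) isT erefl isT (fun=> erefl)).
  case=> c [z [_ [_ [_ [/= + _ _ _ _]]]]].
  rewrite needs_cutE => /andP[need /negP]; apply; apply/good_cutE; exact: no3.
Qed.

End Correct.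

(** * The input encoding and the complete program *)

Lemma edgeless_tame (V : finType) (G : sgraph V) : (forall u v, ~~ G u v) -> tame G.
Proof.
move=> noG; split.
- case=> a [b [q [/(_ ord0)[[pq _ _ _] sq] _ _]]].
  by case: (q ord0) pq sq => //= x q' /andP[ax]; rewrite (negbTE (noG _ _)) in ax.
- case=> h [c [_ _ cnt]]; have : has (G c) h by rewrite has_count; apply: leq_trans cnt.
  by case/hasP=> x _ cx; rewrite (negbTE (noG _ _)) in cx.
- case=> a [b [q [_ _ /(_ ord0 ord_max isT) e _]]]; by rewrite (negbTE (noG _ _)) in e.
Qed.

Lemma nth_input n (s : seq ('I_n * 'I_n)) e p0 : e < size s ->
  nth 0 (graph_input s) (2 + 2 * e) = (nth p0 s e).1 /\
  nth 0 (graph_input s) (3 + 2 * e) = (nth p0 s e).2.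
Proof.
move=> es; set l := flatten [seq [:: val p.1; val p.2] | p <- s].
suff : nth 0 l (2 * e) = (nth p0 s e).1 /\ nth 0 l (2 * e).+1 = (nth p0 s e).2 by [].
rewrite {}/l; elim: s e es => // p s IH [|e] // /IH h.
by rewrite mulnS; exact: h.
Qed.

Lemma graph_input_small n (s : seq ('I_n * 'I_n)) i : nth 0 (graph_input s) i < n + size s + 2.
Proof.
have [lt|ge] := ltnP i (size (graph_input s)); last by rewrite nth_default // addn2.
have : all (fun x => x < n + size s + 2) (graph_input s).
  apply/and3P; split; [lia|lia|].
  apply/allP=> x /flattenP[l /mapP[p _ ->]].
  by rewrite !inE => /orP[]/eqP->; rewrite /= -addnA ltn_addr.
by move/all_nthP; apply.
Qed.

Lemma set2_inj (T : finType) (a b c d : T) : [set a; b] = [set c; d] ->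
  a = c /\ b = d \/ a = d /\ b = c.
Proof.
move=> e; have : d \in [set a; b] by rewrite e set22.
have : c \in [set a; b] by rewrite e set21.
have : b \in [set c; d] by rewrite -e set22.
have : a \in [set c; d] by rewrite -e set21.
by move=> /set2P ha /set2P hb /set2P hc /set2P hd; intuition congruence.
Qed.

Lemma edge_list_n_gt0 n (s : seq ('I_n * 'I_n)) : 0 < size s -> 0 < n.
Proof. by case: s => // -[a b] *; apply: leq_ltn_trans (ltn_ord a). Qed.

Section EdgeList.
Variables (n : nat) (G : sgraph 'I_n) (s : seq ('I_n * 'I_n)).
Hypothesis sG : edge_list G s.

Lemma edge_list_size : size s = #|edges G|.
Proof. by rewrite cardE -(perm_size sG) size_map. Qed.

(** This quadratic bound puts [n + m + 2] below [(n + 2) ^ 2], so that words of O(log n) bits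
    suffice for addresses. *)
Lemma edges_small : #|edges G| <= n ^ 2.
Proof.
apply: leq_trans (leq_imset_card _ _) _.
by apply: leq_trans (max_card _) _; rewrite card_prod card_ord mulnn.
Qed.

Lemma mem_edges a b : ([set a; b] \in edges G) = G a b.
Proof.
apply/imsetP/idP => [[[c d] /=]|Gab]; last by exists (a, b); rewrite ?inE.
by rewrite inE /= => Gcd /set2_inj[[-> ->]|[-> ->]] //; rewrite adj_sym.
Qed.

Lemma edge_list_of e : e < size s -> exists a b : 'I_n,
  [/\ G a b, nth 0 (graph_input s) (2 + 2 * e) = a & nth 0 (graph_input s) (3 + 2 * e) = b].
Proof.
move=> es; have x0 : 'I_n by case: (s) es => // -[a b] *.
have [e1 e2] := nth_input (x0, x0) es.
exists (nth (x0, x0) s e).1, (nth (x0, x0) s e).2; split=> //.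
rewrite -mem_edges -mem_enum -(perm_mem sG).
by apply/mapP; exists (nth (x0, x0) s e) => //; apply: mem_nth.
Qed.

Lemma edge_list_ex (a b : 'I_n) : G a b -> exists2 e, e < size s & is_edge (graph_input s) e a b.
Proof.
rewrite -mem_edges -mem_enum -(perm_mem sG) => /mapP[p ps e].
have es : index p s < size s by rewrite index_mem.
exists (index p s) => //; rewrite /is_edge.
have [-> ->] := nth_input p es; rewrite nth_index //.
by case/set2_inj: e => -[-> ->]; [left|right].
Qed.
End EdgeList.

Definition bad_flag id := Defs.Mem (address id (Const 0) (Const 0) (Const 0)).
Definition verdict := Defs.Sub (Const 1) (Add (Add (bad_flag 13) (bad_flag 14)) (bad_flag 15)).

Theorem theorem7p5 :
  decidable_in_time
    (fun (V : finType) (G : sgraph V) =>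
       [/\ ~ contains_induced is_theta G,
           ~ contains_induced is_wheel G
         & ~ contains_induced is_pyramid G])
    (fun n m => n ^ 3 * m).
Proof.
have [C timeC] := time_bound 0 main.
pose test := Input (Const 1); pose yes := Assign (Const 0) (Const 1).
pose answer := Assign (Const 0) verdict.
pose mp := compile 0 main.
have bound4 a b c d : exists k, [&& a <= k, b <= k, c <= k & d <= k].
  by exists (a + b + c + d); lia.
have [k /and4P[k_test k_yes k_answer k_mp]] := bound4 (expr_growth test) (program_growth yes)
  (program_growth answer) (program_growth mp).
(* The added constant pays for the initial test, the verdict and the assignment of the answer. *)
exists (If test (Seq mp answer) yes), (C + (cost verdict + 10)), k.
move=> n G s sG; set inp := graph_input s.
have esz := edge_list_size sG.
have small i : nth 0 inp i < nth 0 inp 0 + nth 0 inp 1 + 2 by apply: graph_input_small.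
have smallN : nth 0 inp 0 + nth 0 inp 1 + 2 <= (nth 0 inp 0 + 2) ^ 2.
  by rewrite /= esz; have := edges_small G; rewrite sqrnD; lia.
have fits e (M : memory) : expr_growth e <= k -> (forall a, M a < nth 0 inp 0 + nth 0 inp 1 + 2) ->
    fits ((n + 2) ^ k) inp M e.
  by move=> ek hM; apply: (fits_growth small smallN hM ek).
have tameE : [/\ ~ contains_induced is_theta G, ~ contains_induced is_wheel G
    & ~ contains_induced is_pyramid G] <-> tame G.
  by split=> -[h1 h2 h3]; split=> [/contains_theta|/contains_wheel|/contains_pyramid].
have zero_small (a : nat) : 0 < nth 0 inp 0 + nth 0 inp 1 + 2 by rewrite addn2.
(* Without edges the time allowed is a constant, too little for a single loop over the nodes, so the
   program answers yes right after the test. *)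
have [m0|m_gt0] := posnP (size s).
  exists (update (fun=> 0) 0 1), (cost test + 3).+1; split.
  - apply: ExecIfFalse; [exact: (fits _ _ k_test zero_small)| |].
    + by rewrite /= m0.
    + move: k_yes; rewrite geq_max => /andP[k1 k2].
      exact: ExecAssign (fits _ _ k1 zero_small) (fits _ _ k2 zero_small).
  - by rewrite mulnDr muln1 -[cost test]/2; move: (cost verdict) (_ * (_ * _)) => K X; lia.
  - split=> _; [apply/tameE; apply: edgeless_tame => u v; rewrite -mem_edges|discriminate].
    by move/eqP: m0; rewrite esz cards_eq0 => /eqP->; rewrite inE.
have n_gt0 : 0 < n := edge_list_n_gt0 m_gt0.
have rep0 : represents inp [::] (fun _ _ _ _ => 0) (fun=> 0).
  by split=> // a; exact: zero_small.
have [M [t [xM [_ rM lM] tM]]] := compile_correct (c := main) (env := [::]) small smallN main_wf k_mp rep0.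
pose A := run inp [::] main (fun _ _ _ _ => 0).
have eM id : 0 < id < width -> eval inp M (bad_flag id) = A id 0 0 0.
  move=> hid; change (M (cell inp id 0 0 0) = A id 0 0 0); exact: rM hid (zero_small 0) (zero_small 0) (zero_small 0).
exists (update M 0 (eval inp M verdict)), (cost test + (t + (cost verdict + 2))).+1; split.
- apply: ExecIfTrue; [exact: (fits _ _ k_test zero_small)| |].
  + by rewrite /= -lt0n.
  + apply: ExecSeq xM _.
    move: k_answer; rewrite geq_max => /andP[k1 k2].
    exact: ExecAssign (fits _ _ k1 lM) (fits _ _ k2 lM).
- have le := timeC inp n_gt0 m_gt0.
  have le2 : n ^ depth true main * size s ^ depth false main <= n ^ 3 * size s ^ 1.
    by have [d1 d2] := main_depth; apply: leq_mul; rewrite leq_pexp2l.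
  have le3 := leq_trans tM (leq_trans le (leq_mul (leqnn C) le2)).
  rewrite -esz; move: le3; rewrite expn1; set X := _ * size s; move: (cost verdict) => K.
  have -> : cost test = 2 by [].
  by rewrite mulnDr mulnDl muln1; lia.
- apply: (iff_trans _ (iff_sym tameE)).
  have edge_of := edge_list_of sG; have edge_ex := edge_list_ex sG.
  pose witG := wit_witness (inp := inp) (n := n) (G := G) erefl edge_of edge_ex m_gt0.
  apply: (iff_trans _ (iff_sym (tame_clean witG))).
  apply: (iff_trans _ (clean_of_flags (inp := inp) (n := n) (G := G) erefl edge_of edge_ex m_gt0)).
  change (1 - (eval inp M (bad_flag 13) + eval inp M (bad_flag 14) + eval inp M (bad_flag 15)) <> 0 <->
    A 13 0 0 0 + A 14 0 0 0 + A 15 0 0 0 = 0).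
  rewrite (eM 13 isT) (eM 14 isT) (eM 15 isT).
  by move: (A 13 0 0 0 + _ + _) => x; clear; lia.
Qed.
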